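(* Let $d\ge1$, $\alpha>d$, and let $\mathcal{X}_n=\{X_1,\dots,X_n\}$ be i.i.d. samples in $\mathbb{R}^d$ from the density $f_{\mathrm p}(x)=\dfrac{c_{\mathrm p}}{1+\|x\|^\alpha}$. For a sequence $\{R_n\}$ of positive numbers let $\beta_{k,n}=\beta_k\big(\check{C}(\mathcal{X}_n\cap (B_{R_n}(0))^c,1)\big)$. For real $\eta$ put $$R_{0,n}^{\eta}=n^{\frac1{\alpha-d}+\eta},\qquad R_{k,n}^{\eta}=n^{\frac{1}{\alpha-d/(k+2)}+\eta}\ (k\ge1),\qquad R_{k,n}=R_{k,n}^{0}\ (k\ge 0).$$ Then for every $0\le k\le d-1$ and every $\epsilon>0$, $$\lim_{n\to\infty}\mathbb{E}\{\beta_{k,n}\}=\begin{cases}0 & \text{if } R_n=R_{k,n}^{\epsilon}\text{ for all }n,\\ \mu_{\mathrm p,k}&\text{if } R_n=R_{k,n}\text{ for all }n,\\ \infty&\text{if } R_n=R_{k,n}^{-\epsilon}\text{ for all }n,\end{cases}$$ where $$\mu_{\mathrm p,0}=\frac{s_{d-1}c_{\mathrm p}}{\alpha-d},\qquad \mu_{\mathrm p,k}=\frac{s_{d-1}c_{\mathrm p}^{k+2}}{(\alpha(k+2)-d)(k+2)!}\int_{(\mathbb{R}^d)^{k+1}}T_k(0,\mathbf{y})\,d\mathbf{y}\quad(1\le k\le d-1).$$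
   Context: $\|\cdot\|$ is the Euclidean norm; $B_r(x)$ is the closed Euclidean ball of radius $r$ about $x$; $c_{\mathrm p}>0$ is the normalization constant making $f_{\mathrm p}$ a probability density; $s_{d-1}$ is the surface area of the $(d-1)$-dimensional unit sphere in $\mathbb{R}^d$. For a finite set $\mathcal{Y}\subset\mathbb{R}^d$ and $\varepsilon>0$, the Čech complex $\check{C}(\mathcal{Y},\varepsilon)$ is the abstract simplicial complex with vertex set $\mathcal{Y}$ in which $[x_{i_0},\dots,x_{i_m}]$ is a simplex iff $\bigcap_{j=0}^m B_\varepsilon(x_{i_j})\neq\emptyset$. $\beta_k$ denotes the $k$-th Betti number (rank of the $k$-th homology group). For $k\ge1$ and finite $\mathcal{Y}\subset\mathbb{R}^d$, $T_k(\mathcal{Y})=1$ if $|\mathcal{Y}|=k+2$ and $\beta_k(\check{C}(\mathcal{Y},1))=1$, and $T_k(\mathcal{Y})=0$ otherwise; for $\mathbf{y}=(y_1,\dots,y_{k+1})$, $T_k(0,\mathbf{y})=T_k(\{0,y_1,\dots,y_{k+1}\})$. *)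

(* Defs.v *)
From HB Require Import structures.
From mathcomp Require Import all_boot all_order all_algebra finmap.
From mathcomp Require Import all_classical all_reals all_analysis.

Set Implicit Arguments.
Unset Strict Implicit.
Unset Printing Implicit Defensive.

Import Order.TTheory GRing.Theory Num.Theory.
Import numFieldNormedType.Exports.

Local Open Scope classical_set_scope.
Local Open Scope ring_scope.

Section ConsMeasure.
Local Open Scope ereal_scope.
Context {disp : measure_display} {T : measurableType disp} {R : realType}.
Variables (n : nat) (m : {sigma_finite_measure set T -> \bar R}).
Variable mu : {sigma_finite_measure set (n.-tuple T) -> \bar R}.

Definition tcons (p : T * n.-tuple T) : n.+1.-tuple T := [tuple of p.1 :: p.2].

Lemma measurable_tcons : measurable_fun [set: T * n.-tuple T] tcons.
Proof. exact: measurable_cons. Qed.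

Definition cons_measure : set (n.+1.-tuple T) -> \bar R :=
  pushforward (m \x mu) tcons.

Let cons_measure_facts : [/\ cons_measure set0 = 0,
  forall A, 0 <= cons_measure A & semi_sigma_additive cons_measure].
Proof.
pose nu : {measure set (n.+1.-tuple T) -> \bar R} :=
  measure_function_pushforward__canonical__measure_function_Measure
    (m \x mu) measurable_tcons.
split.
- exact: (measure0 nu).
- exact: (measure_ge0 nu).
- exact: (@measure_semi_sigma_additive _ _ _ nu).
Qed.

Let cons_measure0 : cons_measure set0 = 0.
Proof. by case: cons_measure_facts. Qed.

Let cons_measure_ge0 A : 0 <= cons_measure A.
Proof. by case: cons_measure_facts. Qed.

Let cons_measure_sigma_additive : semi_sigma_additive cons_measure.
Proof. by case: cons_measure_facts. Qed.

HB.instance Definition _ := isMeasure.Build _ _ _ cons_measure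
  cons_measure0 cons_measure_ge0 cons_measure_sigma_additive.

Let cons_measure_sigma_finite : sigma_finite [set: n.+1.-tuple T] cons_measure.
Proof.
have /sigma_finiteP[F [TF ndF Foo]] := sigma_finiteT m.
have /sigma_finiteP[G [TG ndG Goo]] := sigma_finiteT mu.
pose beh (t : n.+1.-tuple T) : n.-tuple T := [tuple of behead t].
have behK p : beh (tcons p) = p.2 by exact: val_inj.
exists (fun i => [set t | F i (tnth t ord0)] `&` [set t | G i (beh t)]).
  apply/esym; rewrite -subTset => t _.
  have : [set: T] (tnth t ord0) by [].
  rewrite TF => -[i _ Fi].
  have : [set: n.-tuple T] (beh t) by [].
  rewrite TG => -[j _ Gj].
  exists (maxn i j) => //; split => /=.
    by move: Fi; exact/subsetPset/ndF/leq_maxl.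
  by move: Gj; exact/subsetPset/ndG/leq_maxr.
move=> i; have [mF ?] := Foo i; have [mG ?] := Goo i; split.
  apply: measurableI; rewrite -[X in measurable X]setTI.
    exact: measurable_tnth.
  exact: measurable_behead.
rewrite /cons_measure /pushforward [X in (m \x mu) X](_ : _ = F i `*` G i).
  by rewrite product_measure1E// lte_mul_pinfty// ge0_fin_numE.
by apply/seteqP; split => p; rewrite /= behK.
Qed.

HB.instance Definition _ := Measure_isSigmaFinite.Build _ _ _ cons_measure
  cons_measure_sigma_finite.

End ConsMeasure.

(* [power_measure m n] is the n-fold product measure m x ... x m. *)
Fixpoint power_measure {disp : measure_display} {T : measurableType disp}
    {R : realType} (m : {sigma_finite_measure set T -> \bar R}) (n : nat) :
    {sigma_finite_measure set (n.-tuple T) -> \bar R} :=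
  if n is n'.+1 then cons_measure m (power_measure m n')
  else \d_([tuple] : 0.-tuple T).

(* [lebesgue_measure], registered for the measurable structure that R itself
   carries: the library declares it on the alias [measurableTypeR R], which has
   the same measurable sets but another display. *)
Section Lebesgue1.
Context {R : realType}.

Definition lebesgue1 : set R -> \bar R := @lebesgue_measure R.

Let lebesgue1_0 : lebesgue1 set0 = 0%E.
Proof. exact: (measure0 (@lebesgue_measure R)). Qed.

Let lebesgue1_ge0 A : (0 <= lebesgue1 A)%E.
Proof. exact: (measure_ge0 (@lebesgue_measure R)). Qed.

Let lebesgue1_sigma_additive : semi_sigma_additive lebesgue1.
Proof. exact: (@measure_semi_sigma_additive _ _ _ (@lebesgue_measure R)). Qed.

HB.instance Definition _ := isMeasure.Build _ _ _ lebesgue1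
  lebesgue1_0 lebesgue1_ge0 lebesgue1_sigma_additive.

Let lebesgue1_sigma_finite : sigma_finite [set: R] lebesgue1.
Proof. exact: (sigma_finiteT (@lebesgue_measure R)). Qed.

HB.instance Definition _ := Measure_isSigmaFinite.Build _ _ _ lebesgue1
  lebesgue1_sigma_finite.

End Lebesgue1.

Section Euclidean.
Context {R : realType} {d : nat}.
Implicit Types (x y u : d.-tuple R) (r : R).

Definition origin : d.-tuple R := [tuple 0 | i < d].

Definition tsub x y : d.-tuple R := [tuple tnth x i - tnth y i | i < d].

Definition enorm x : R := Num.sqrt (\sum_(i < d) tnth x i ^+ 2).

Definition eball x r : set (d.-tuple R) := [set y | enorm (tsub y x) <= r].

Definition lebesgue : {sigma_finite_measure set (d.-tuple R) -> \bar R} :=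
  power_measure (@lebesgue1 R) d.

Definition unit_sphere : set (d.-tuple R) := [set u | enorm u = 1].

Definition cone (A : set (d.-tuple R)) : set (d.-tuple R) :=
  [set x | exists t : R, exists u : d.-tuple R,
    [/\ 0 < t <= 1, A u & x = [tuple t * tnth u i | i < d]]].

(* The usual definition of the surface measure of the unit sphere, for which
   integration in polar coordinates holds. *)
Definition sphere_measure (A : set (d.-tuple R)) : \bar R :=
  (d%:R%:E * lebesgue (cone A))%E.

Definition sphere_area : \bar R := sphere_measure unit_sphere.

End Euclidean.

Arguments lebesgue : clear implicits.
Arguments sphere_area : clear implicits.

Section Homology.
Context {V : finType}.
(* An abstract simplicial complex is the family of its nonempty simplices. *)
Implicit Types (K : {set {set V}}) (s t : {set V}).

(* Simplices with m vertices, i.e. of dimension m - 1. *)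
Definition simplices K (m : nat) : {set {set V}} := [set s in K | #|s| == m].

(* The simplices are oriented by the enumeration order of V. *)
Definition vertex_index s (v : V) : nat :=
  #|[set w in s | (enum_rank w < enum_rank v)%N]|.

(* The coefficient of t in the boundary of s. *)
Definition incidence s t : rat :=
  \sum_(v in s | t == s :\ v) (-1) ^+ vertex_index s v.

(* Matrix, acting on row vectors, of the boundary map from k-chains to
   (k-1)-chains, [v_0, ..., v_k] |-> \sum_i (-1)^i [v_0, ..., ^v_i, ..., v_k].
   For k = 0 the target is the zero space, so that homology is unreduced. *)
Definition boundary K (k : nat) :
    'M[rat]_(#|simplices K k.+1|, #|simplices K k|) :=
  \matrix_(i, j) incidence (enum_val i) (enum_val j).

(* dim (ker boundary_k) - dim (im boundary_(k+1)), with rational coefficients: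
   the rank of the k-th homology group. *)
Definition betti K (k : nat) : nat :=
  (\rank (kermx (boundary K k)) - \rank (boundary K k.+1))%N.

End Homology.

Section Cech.
Context {R : realType} {d : nat}.
Implicit Types (Y : {fset d.-tuple R}).

Definition cech Y (r : R) : {set {set Y}} :=
  [set s : {set Y} | (s != finset.set0) &&
    `[< \bigcap_(v in [set` s]) eball (fsval v) r !=set0 >]].

Definition Tk (k : nat) Y : R :=
  ((#|` Y| == k.+2) && (betti (cech Y 1) k == 1%N))%:R.

Definition Tk0 (k : nat) (y : k.+1.-tuple (d.-tuple R)) : R :=
  Tk k [fset x in origin :: y]%fset.

End Cech.

Section Sample.
Context {disp : measure_display} {T : measurableType disp} {R : realType}.
Context {P : probability T R}.

Definition mutually_independent (disp' : measure_display)
    (T' : measurableType disp') (X : nat -> {RV P >-> T'}) : Prop :=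
  forall (J : {fset nat}) (A : nat -> set T'), (forall i, measurable (A i)) ->
    P (\bigcap_(i in [set` J]) X i @^-1` A i) =
    (\prod_(i <- J) P (X i @^-1` A i))%E.

Definition has_density (d : nat) (X : {RV P >-> d.-tuple R})
    (f : d.-tuple R -> R) : Prop :=
  forall A : set (d.-tuple R), measurable A ->
    distribution P X A = (\int[lebesgue R d]_(x in A) (f x)%:E)%E.

Context {d : nat}.
Variable X : nat -> {RV P >-> d.-tuple R}.

(* {X_1, ..., X_n}, the sequence X being indexed from 0. *)
Definition sample (n : nat) (w : T) : {fset d.-tuple R} :=
  [fset x in [seq X i w | i <- iota 0 n]]%fset.

Definition betti_crackle (rad : nat -> R) (k n : nat) (w : T) : R :=
  (betti (cech [fset x in sample n w | x \in ~` eball origin (rad n)]%fset 1)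
     k)%:R.

End Sample.

Section PowerLaw.
Context {R : realType}.
Variables (d : nat) (alpha cp : R).

Definition power_density (x : d.-tuple R) : R := cp / (1 + enorm x `^ alpha).

Definition critical_radius (k : nat) (eta : R) (n : nat) : R :=
  if k == 0%N then n%:R `^ ((alpha - d%:R)^-1 + eta)
  else n%:R `^ ((alpha - d%:R / k.+2%:R)^-1 + eta).

Definition mu_limit (k : nat) : \bar R :=
  (if k == 0%N then sphere_area R d * (cp / (alpha - d%:R))%:E
   else sphere_area R d
     * (cp ^+ k.+2 / ((alpha * k.+2%:R - d%:R) * (k.+2)`!%:R))%:E
     * \int[power_measure (lebesgue R d) k.+1]_y (Tk0 y)%:E)%E.

End PowerLaw.

(* Main.v *)
From mathcomp Require Import all_boot all_order all_algebra finmap.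
From mathcomp Require Import all_classical all_reals all_analysis.
From mathcomp Require Import measurable_realfun ring lra zify.
Require Import Defs.

(** Write m = 1 when k = 0 and m = k + 2 when k >= 1, and put
    gamma = alpha * m - d > 0.  Far from the origin the sample is so sparse that
    a cycle of dimension k is created, with overwhelming probability, by the
    fewest points that can carry one: m points whose closed unit balls have no
    common point although the balls of any m - 1 of them do (for k = 0, a single
    point).  Call such an m-tuple a configuration.

    Deterministic part.  For a finite set of points with Cech complex K,
    - betti K k is at most the number of configurations plus a constant times
      the number of (m + 1)-subsets of diameter at most 6 ([betti_le_count],
      [betti0_le_count]): a cycle vanishing on the k-faces of the larger clusters
      and on one facet of every configuration is a boundary;
    - betti K k is at least the number of configurations to which no other point
      is close ([betti_ge_count], [betti0_ge_count]): the boundaries of the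
      missing simplices are cycles with disjoint supports that no boundary
      meets.
    Both counts are made on sets of indices of the sample.  An isolated set of
    indices has no other index within distance 2 ([isolated_index]), so coinciding
    sample points need no separate treatment.

    Probabilistic part.  The joint law of m sample points is the power measure
    of their common law ([iid_law]).  At a point x far out the density is close
    to cp * |x|^(-alpha), uniformly on the ball of radius 2 around x.  Hence the
    probability that m points form a configuration outside the ball of radius r
    is equivalent to cp^m * I * int_(|x| > r) |x|^(-alpha m) dx, where I is the
    volume of the configurations based at 0 ([config_upper], [config_lower]).
    The radial integral is sphere_area * r^(-gamma) / gamma
    ([radial_integral]).  A cluster of m + 1 points costs an additional factor
    of order r^(-alpha) ([clustered_bound]).

    Conclusion.  With r = n^rho the expectation is n^(m - rho * gamma) times a
    factor that tends to cp^m * I * sphere_area / (gamma * m!), as soon as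
    rho * alpha > 1.  At the critical exponent rho0 = m / gamma the power of n
    is 1; above it the power tends to 0.  Below it the configurations beyond
    radius n^rho', for some rho' slightly smaller than rho0 and larger than
    1 / alpha, already make the expectation tend to infinity.  This uses I > 0,
    which holds because k + 1 <= d leaves room for a simplex with k + 2 vertices
    ([hollow_volume_gt0]). *)

Set Implicit Arguments.
Unset Strict Implicit.
Unset Printing Implicit Defensive.

Import Order.TTheory GRing.Theory Num.Theory.
Import numFieldNormedType.Exports.

Local Open Scope ring_scope.

(** * Homology of a finite simplicial complex *)

Section Homology.
Context {V : finType}.
Implicit Types (K : {set {set V}}) (s t u : {set V}).

Lemma vertex_indexD1 s (v w : V) : w \in s -> v != w -> v \in s ->
  vertex_index s w = (vertex_index (s :\ v) w + (enum_rank v < enum_rank w)%N)%N.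
Proof.
move=> ws vw vs; rewrite /vertex_index.
rewrite (cardsD1 v) inE vs /= addnC; congr (_ + _)%N.
by apply: eq_card => x; rewrite !inE andbA.
Qed.

Definition vsign s v : rat := (-1) ^+ vertex_index s v.

Lemma vsign_neq0 s v : vsign s v != 0.
Proof. by rewrite signr_eq0. Qed.

(** The sign rule behind boundary o boundary = 0: removing v first shifts the
    position of w by one exactly when v precedes w, so exactly one of the two
    orders of removal picks up an extra sign. *)
Lemma vsignD1 s v w : v \in s -> w \in s -> v != w ->
  vsign s v * vsign (s :\ v) w = - (vsign s w * vsign (s :\ w) v).
Proof.
move=> vs ws vw; rewrite /vsign.
rewrite (vertex_indexD1 ws vw vs) (vertex_indexD1 vs _ ws) 1?eq_sym//.
set a := vertex_index _ _; set b := vertex_index _ _.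
have : enum_rank v != enum_rank w by rewrite (inj_eq enum_rank_inj).
rewrite neq_ltn => /orP[] h; rewrite h ltnNge (ltnW h) /= ?addn0 ?addn1 !exprS.
  by rewrite mulN1r mulNr opprK mulrC.
by rewrite mulN1r mulNr mulrC.
Qed.

Lemma incidenceD1 s v : v \in s -> incidence s (s :\ v) = vsign s v.
Proof.
move=> vs; rewrite /incidence (bigD1 v) /=; last by rewrite vs eqxx.
rewrite big1 ?addr0// => w /andP[/andP[ws /eqP e] wv].
by move/finset.setP: e => /(_ w); rewrite !inE wv ws eqxx.
Qed.

Lemma incidence_eq0 s t : (forall v, v \in s -> t != s :\ v) -> incidence s t = 0.
Proof.
by move=> h; rewrite /incidence big1// => v /andP[/h/negPf->].
Qed.

Lemma incidence_neq0 s t : incidence s t != 0 -> exists2 v, v \in s & t = s :\ v.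
Proof.
move=> h; case: (pickP [pred v | (v \in s) && (t == s :\ v)]) => [v /andP[? /eqP]|h0].
  by exists v.
case/eqP: h; apply: incidence_eq0 => v vs.
by have := h0 v; rewrite /= vs /= => ->.
Qed.

Lemma sum_incidence s (F : {set V} -> rat) (A : {set {set V}}) :
  \sum_(t in A) incidence s t * F t =
  \sum_(v in s | s :\ v \in A) vsign s v * F (s :\ v).
Proof.
rewrite (eq_bigr (fun t => \sum_(v in s | t == s :\ v) vsign s v * F t)); last first.
  by move=> t _; rewrite /incidence mulr_suml.
rewrite (exchange_big_dep (fun v => (v \in s) && (s :\ v \in A))) /=; last first.
  by move=> t v tA /andP[-> /eqP <-].
apply: eq_bigr => v /andP[vs sA].
rewrite (bigD1 (s :\ v)) /= ?sA ?vs ?eqxx// big1 ?addr0//.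
by move=> t /andP[/andP[_ /andP[_ ->]]].
Qed.
(** Ordered pairs (v, w) of removed vertices contribute with the sign of
    [vsignD1], so exchanging v and w changes the sign of the sum.  The simplex s
    itself need not belong to A, which makes the boundary of a missing simplex a
    cycle. *)
Lemma boundary_boundary s t (A : {set {set V}}) :
  (forall v, v \in s -> s :\ v \in A) ->
  \sum_(u in A) incidence s u * incidence u t = 0.
Proof.
move=> hA; rewrite (sum_incidence s (fun u => incidence u t)).
under eq_bigr => v _ do rewrite /incidence mulr_sumr.
rewrite (pair_big_dep _ _ (fun v w => vsign s v * vsign (s :\ v) w)) /=.
pose Pr := fun p : V * V => [&& (p.1 \in s) && (s :\ p.1 \in A),
  p.2 \in s :\ p.1 & t == s :\ p.1 :\ p.2].
pose S := \sum_(p | Pr p) vsign s p.1 * vsign (s :\ p.1) p.2; rewrite -/S.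
have hPr p : Pr p = [&& p.1 \in s, p.2 \in s, p.1 != p.2 & t == s :\ p.1 :\ p.2].
  rewrite /Pr; case e: (p.1 \in s) => //=; rewrite (hA _ e) !inE [p.2 == _]eq_sym.
  by case: (p.2 \in s); rewrite ?andbT ?andbF.
suff e : S = - S.
  have : S *+ 2 == 0 by rewrite mulr2n {1}e addNr.
  by rewrite mulrn_eq0 => /eqP.
rewrite {1}/S (reindex_inj (h := fun p : V * V => (p.2, p.1))) /=; last first.
  by move=> [a b] [c d] [-> ->].
rewrite /S -sumrN; apply: eq_big => [[v w]|[v w]].
  rewrite !hPr /= [w == v]eq_sym.
  have -> : s :\ w :\ v = s :\ v :\ w by apply/setP => x; rewrite !inE andbCA.
  by case: (v \in s); case: (w \in s).
rewrite hPr /= => /and4P[ws vs wv _].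
by rewrite vsignD1.
Qed.

Lemma mul_boundaryE K k (z : 'rV[rat]_(#|simplices K k.+1|)) j :
  (z *m boundary K k) 0 j = \sum_i z 0 i * incidence (enum_val i) (enum_val j).
Proof. by rewrite mxE; apply: eq_bigr => i _; rewrite mxE. Qed.

(** Upper bounds for Betti numbers come from test coordinates: if vanishing on
    T forces a cycle to be a boundary, then the cycles modulo boundaries embed in
    the functions on T. *)
Lemma betti_le_test K k (T : {set {set V}}) :
  (forall z : 'rV[rat]_(#|simplices K k.+1|), z *m boundary K k = 0 ->
     (forall i, enum_val i \in T -> z 0 i = 0) ->
     (z <= boundary K k.+1)%MS) ->
  (betti K k <= #|T|)%N.
Proof.
move=> h; rewrite /betti leq_subLR.
pose p : 'M[rat]_(#|simplices K k.+1|, #|T|) :=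
  \matrix_(i, j) (enum_val i == enum_val j)%:R.
rewrite -(mxrank_mul_ker _ p) addnC leq_add ?rank_leq_col//.
apply: mxrankS; apply/row_subP => i.
have : (row i (kermx (boundary K k) :&: kermx p)
         <= kermx (boundary K k) :&: kermx p)%MS by exact: row_sub.
rewrite sub_capmx => /andP[/sub_kermxP z0 /sub_kermxP zp].
apply: h => // i0 i0T.
move/matrixP: zp => /(_ 0 (enum_rank_in i0T (enum_val i0))).
rewrite [LHS]mxE [RHS]mxE (bigD1 i0)//= [p _ _]mxE enum_rankK_in// eqxx mulr1.
rewrite big1 ?addr0 => [|j jn]; first by rewrite mxE.
by rewrite [p _ _]mxE enum_rankK_in// (inj_eq enum_val_inj) (negPf jn) mulr0.
Qed.

(** Lower bounds for Betti numbers come from cycles f s with dual coordinates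
    a s on which every boundary vanishes: such cycles are independent modulo
    boundaries. *)
Lemma betti_ge_test K k (S : {set {set V}}) (f : {set V} -> {set V} -> rat)
    (a : {set V} -> {set V}) :
  boundary K k.+1 *m boundary K k = 0 ->
  (forall s, s \in S -> a s \in simplices K k.+1) ->
  (forall s t, s \in S -> t \in simplices K k ->
     \sum_(u in simplices K k.+1) f s u * incidence u t = 0) ->
  (forall s t, s \in S -> t \in S -> f s (a t) = (s == t)%:R) ->
  (forall s u, s \in S -> u \in simplices K k.+2 -> incidence u (a s) = 0) ->
  (#|S| <= betti K k)%N.
Proof.
move=> BB aS fB fa ua; rewrite /betti leq_subRL; last first.
  by apply: mxrankS; apply/sub_kermxP.
pose p : 'M[rat]_(#|simplices K k.+1|, #|S|) :=
  \matrix_(i, j) (enum_val i == a (enum_val j))%:R.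
pose Z : 'M[rat]_(#|S|, #|simplices K k.+1|) :=
  \matrix_(i, j) f (enum_val i) (enum_val j).
have sump (F : {set V} -> rat) (j : 'I_#|S|) :
    \sum_i F (enum_val i) * p i j = F (a (enum_val j)).
  rewrite (eq_bigr (fun i : 'I_#|simplices K k.+1| =>
      F (enum_val i) * (enum_val i == a (enum_val j))%:R)); last first.
    by move=> i _; rewrite mxE.
  rewrite -(big_enum_val (fun u => F u * (u == a (enum_val j))%:R)).
  rewrite (bigD1 (a (enum_val j))) /=; last exact/aS/enum_valP.
  rewrite eqxx mulr1 big1 ?addr0// => u /andP[_ /negPf->].
  by rewrite mulr0.
rewrite -(mxrank_mul_ker (kermx _) p) addnC leq_add//; last first.
  apply: mxrankS; rewrite sub_capmx; apply/andP; split; apply/sub_kermxP => //.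
  apply/matrixP => i j; rewrite [RHS]mxE [LHS]mxE.
  rewrite (eq_bigr (fun l => incidence (enum_val i) (enum_val l) * p l j));
    last by move=> l _; rewrite mxE.
  by rewrite (sump (incidence (enum_val i))) ua// enum_valP.
have ZB : (Z <= kermx (boundary K k))%MS.
  apply/sub_kermxP/matrixP => i j; rewrite [RHS]mxE [LHS]mxE.
  rewrite -[RHS](fB (enum_val i) (enum_val j)) ?enum_valP//.
  rewrite [RHS]big_enum_val.
  by apply: eq_bigr => l _; rewrite !mxE.
apply: leq_trans (mxrankS (submxMr p ZB)).
have -> : Z *m p = 1%:M.
  apply/matrixP => i j; rewrite [RHS]mxE [LHS]mxE.
  rewrite (eq_bigr (fun l => f (enum_val i) (enum_val l) * p l j));
    last by move=> l _; rewrite mxE.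
  by rewrite sump fa ?enum_valP// (inj_eq enum_val_inj).
by rewrite mxrank1.
Qed.

Lemma simplicesP K m s : (s \in simplices K m) = (s \in K) && (#|s| == m).
Proof. by rewrite inE. Qed.

Definition facets_in K s := [forall v in s, s :\ v \in K].
Definition hollow K s := facets_in K s && (s \notin K).

Section Clique.
Variables (K : {set {set V}}) (e : rel V).
Hypothesis K0 : finset.set0 \notin K.
Hypothesis Kdown : forall s t, s \in K -> t \subset s -> t != finset.set0 -> t \in K.
Hypothesis Kclique : forall s v w, s \in K -> v \in s -> w \in s -> v != w -> e v w.

Definition adjacent v s := [exists w in s, e v w].
Definition isolated s := [forall v, (v \notin s) ==> ~~ adjacent v s].

Lemma isolatedP s v w : isolated s -> w \in s -> e v w -> v \in s.
Proof.
move=> /forallP/(_ v)/implyP is_ ws evw; apply: contraT => /is_.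
by move/existsP; case; exists w; rewrite ws.
Qed.

Lemma facetsK s : s \in K -> (1 < #|s|)%N -> facets_in K s.
Proof.
move=> sK s1; apply/forall_inP => v vs; apply: (Kdown sK); first exact: subD1set.
by rewrite -card_gt0; rewrite (cardsD1 v) vs in s1.
Qed.

Lemma facets_simplices k s v : facets_in K s -> #|s| = k.+1 -> v \in s ->
  s :\ v \in simplices K k.
Proof.
move=> /forall_inP h sk vs; rewrite simplicesP h//=.
by move: sk; rewrite (cardsD1 v) vs add1n => -[->].
Qed.

Lemma boundary_boundary0 k : boundary K k.+1 *m boundary K k = 0.
Proof.
apply/matrixP => i j; rewrite [RHS]mxE [LHS]mxE.
case: k i j => [|k] i j.
  have := enum_valP j; rewrite simplicesP => /andP[+ /eqP/cards0_eq e0].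
  by rewrite e0 (negPf K0).
rewrite (eq_bigr (fun l => incidence (enum_val i) (enum_val l)
    * incidence (enum_val l) (enum_val j))); last by move=> l _; rewrite !mxE.
rewrite -(big_enum_val (fun u => incidence (enum_val i) u
    * incidence u (enum_val j))).
have := enum_valP i; rewrite simplicesP => /andP[iK /eqP ik].
apply: boundary_boundary => v vi; apply: facets_simplices => //.
by apply: facetsK => //; rewrite ik.
Qed.

Definition some_vertex s : option V := [pick v in s].

Lemma some_vertexP k s : #|s| = k.+1 -> exists2 v, v \in s & some_vertex s = Some v.
Proof.
move=> sk; rewrite /some_vertex; case: pickP => [v vs|s0]; first by exists v.
by rewrite (eq_card0 s0) in sk.
Qed.

Definition facet0 s := if some_vertex s is Some v then s :\ v else s.
Definition sign0 s := if some_vertex s is Some v then vsign s v else 1.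

Lemma vsign_sqr s v : vsign s v * vsign s v = 1.
Proof. by rewrite -expr2 /vsign sqrr_sign. Qed.

Lemma setD1_subset s u v : s :\ v \subset u -> v \in u -> s \subset u.
Proof.
move=> /fintype.subsetP h vu; apply/fintype.subsetP => x xs.
by have [->//|xv] := eqVneq x v; apply: h; rewrite !inE xv.
Qed.

(** The boundaries of the missing simplices are the independent cycles.  Each is
    scaled to have coefficient 1 on its first facet; isolation prevents a simplex
    outside s from having a facet in common with s. *)
Lemma betti_ge_isolated_hollow k : (0 < k)%N ->
  (#|[set s : {set V} | [&& #|s| == k.+2, hollow K s & isolated s]]| <= betti K k)%N.
Proof.
move=> k0; apply: (@betti_ge_test K k _
  (fun s t => sign0 s * incidence s t) facet0); first exact: boundary_boundary0.
- move=> s; rewrite inE => /and3P[/eqP sk /andP[fs _] _].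
  rewrite /facet0; have [v vs ->] := some_vertexP sk.
  exact: facets_simplices.
- move=> s t; rewrite inE => /and3P[/eqP sk /andP[fs _] _] _.
  under eq_bigr do rewrite -mulrA.
  rewrite -mulr_sumr boundary_boundary ?mulr0// => v vs.
  exact: facets_simplices.
- move=> s s'; rewrite !inE => /and3P[/eqP sk /andP[fs sK] is_].
  move=> /and3P[/eqP sk' /andP[/forall_inP fs' _] _].
  rewrite /sign0 /facet0; have [v vs pv] := some_vertexP sk; have [v' vs' pv'] := some_vertexP sk'.
  rewrite pv pv'; have [ss'|ss'] := eqVneq s s'.
    move: pv'; rewrite -ss' pv => -[<-].
    by rewrite incidenceD1// vsign_sqr.
  apply/eqP; rewrite mulf_eq0; apply/orP; right; apply/eqP/incidence_eq0 => x xs.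
  apply: contraNneq ss' => E; apply/eqP.
  have sub : s' :\ v' \subset s by rewrite E subD1set.
  apply/esym/eqP; rewrite eqEcard sk sk' leqnn andbT.
  apply: (setD1_subset sub).
  have : (1 < #|s' :\ v'|)%N by move: sk'; rewrite (cardsD1 v') vs' add1n => -[->].
  move=> /card_gt1P[y [z [ys zs yz]]].
  apply: (isolatedP is_ (fintype.subsetP sub _ ys)).
  apply: (Kclique (fs' z _)).
  + by move: zs; rewrite !inE => /andP[].
  + by rewrite !inE vs' andbT; move: zs; rewrite !inE eq_sym => /andP[].
  + by move: ys; rewrite !inE yz => /andP[].
  + by move: ys; rewrite !inE eq_sym => /andP[].
- move=> s r; rewrite inE => /and3P[/eqP sk /andP[fs sK] is_].
  rewrite simplicesP => /andP[rK /eqP rk].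
  rewrite /facet0; have [v vs ->] := some_vertexP sk.
  apply: incidence_eq0 => x xr; apply: contraNneq sK => E.
  have sub : s :\ v \subset r by rewrite E subD1set.
  suff -> : s = r by [].
  apply/esym/eqP; rewrite eqEcard rk sk leqnn andbT.
  apply: (@setD1_subset _ _ x); first by rewrite -E subD1set.
  have : (0 < #|s :\ v|)%N by move: sk; rewrite (cardsD1 v) vs add1n => -[->].
  move=> /card_gt0P[y yv]; have := yv; rewrite E !inE => /andP[yx yr].
  apply: (isolatedP is_ (w := y)); first by move: yv; rewrite !inE => /andP[].
  by apply: (Kclique rK) => //; rewrite eq_sym.
Qed.

(** An isolated vertex is on no edge, so its coordinate vanishes on boundaries. *)
Lemma betti_ge_isolated_vertex :
  (#|[set s in K | (#|s| == 1%N) && isolated s]| <= betti K 0)%N.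
Proof.
apply: (@betti_ge_test K 0 _ (fun s t => (s == t)%:R) id).
- exact: boundary_boundary0.
- by move=> s; rewrite !inE => /and3P[-> ->].
- move=> s t _; rewrite simplicesP => /andP[+ /eqP/cards0_eq e0].
  by rewrite e0 (negPf K0).
- by [].
- move=> s r; rewrite inE => /and3P[_ /cards1P[v ->] is_].
  rewrite simplicesP => /andP[rK /eqP rk].
  apply: incidence_eq0 => x xr; apply/eqP => E.
  have : v \in r :\ x by rewrite -E inE.
  rewrite !inE => /andP[vx vr].
  have : x \in [set v].
    by apply: (isolatedP is_ (set11 v)); apply: (Kclique rK) => //; rewrite eq_sym.
  by rewrite inE eq_sym (negPf vx).
Qed.

Lemma betti0_le : (betti K 0 <= #|V|)%N.
Proof.
rewrite /betti; apply: leq_trans (leq_subr _ _) _.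
apply: leq_trans (rank_leq_row _) _.
rewrite -cardsT -(card_imset [set: V] set1_inj); apply: subset_leq_card.
apply/fintype.subsetP => s; rewrite simplicesP => /andP[_ /cards1P[v ->]].
by rewrite imset_f// inE.
Qed.

(** A face is extendable when two further vertices can be attached to it one
    after the other; such faces lie in clusters of at least k + 3 vertices. *)
Definition extendable k : {set {set V}} :=
  [set t in simplices K k.+1 | [exists u, exists v,
     [&& u \notin t, adjacent u t, v \notin u |: t & adjacent v (u |: t)]]].

Lemma adjacentP v s w : w \in s -> e v w -> adjacent v s.
Proof. by move=> ws evw; apply/existsP; exists w; rewrite ws. Qed.

Lemma vsign_ratio (a b c d x y : rat) : b * b = 1 -> d * d = 1 ->
  a * b = - (c * d) -> x * b + y * d = 0 -> a * x = c * y.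
Proof.
move=> b1 d1 ab /eqP; rewrite addr_eq0 => /eqP xb.
have -> : a * x = (a * b) * (x * b) by rewrite mulrACA b1 mulr1.
by rewrite ab xb mulrNN mulrACA d1 mulr1.
Qed.

Section Cycle.
Variables (k : nat) (F : {set V} -> rat).
Hypothesis k0 : (0 < k)%N.
Hypothesis F0 : forall t, t \notin simplices K k.+1 -> F t = 0.
Hypothesis FB : forall t, t \in simplices K k ->
  \sum_u F u * incidence u t = 0.

(** Inside an isolated set s of k + 2 vertices a cycle looks like a multiple of
    the boundary of s: the face s without v and w has no cofaces other than the
    two facets s without v and s without w, so the cycle condition there compares
    the coefficients of these two facets. *)
Lemma cycle_local_ratio s v w : #|s| = k.+2 -> isolated s -> v \in s -> w \in s ->
  vsign s v * F (s :\ v) = vsign s w * F (s :\ w).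
Proof.
move=> sk is_ vs ws; have [->//|vw] := eqVneq v w.
pose t := s :\ v :\ w.
have t' : t = s :\ w :\ v by apply/setP => x; rewrite !inE andbCA.
have ws' : w \in s :\ v by rewrite !inE eq_sym vw.
have vs' : v \in s :\ w by rewrite !inE vw.
have svk : #|s :\ v| = k.+1 by move: sk; rewrite (cardsD1 v) vs => -[].
have swk : #|s :\ w| = k.+1 by move: sk; rewrite (cardsD1 w) ws => -[].
have tk : #|t| = k by move: svk; rewrite (cardsD1 w) ws' => -[].
have tn0 : t != finset.set0 by rewrite -card_gt0 tk.
have swn : s :\ w != s :\ v.
  by apply: contraTneq vs' => ->; rewrite !inE eqxx.
apply: (vsign_ratio (b := vsign (s :\ v) w) (d := vsign (s :\ w) v)).
- exact: vsign_sqr.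
- exact: vsign_sqr.
- exact: vsignD1.
have [tK|tK] := boolP (t \in K); last first.
  rewrite !F0 ?mul0r ?addr0// simplicesP; apply: contra tK => /andP[+ _].
    by move/Kdown; apply => //; rewrite t' subD1set.
  by move/Kdown; apply => //; rewrite subD1set.
have /FB : t \in simplices K k by rewrite simplicesP tK tk eqxx.
rewrite (bigD1 (s :\ v))//= (bigD1 (s :\ w))//= big1 ?addr0.
  by rewrite {1}/t t' !incidenceD1.
move=> u /andP[uv uw]; have [/F0->|] := boolP (u \notin simplices K k.+1).
  by rewrite mul0r.
rewrite negbK simplicesP => /andP[uK /eqP uk].
rewrite incidence_eq0 ?mulr0// => x xu; apply/eqP => E.
have /card_gt0P[y yt] : (0 < #|t|)%N by rewrite tk.
have := yt; rewrite {1}E !inE => /andP[yx yu].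
have ys : y \in s by move: yt; rewrite !inE => /and3P[].
have xs : x \in s.
  by apply: (isolatedP is_ ys); apply: (Kclique uK) => //; rewrite eq_sym.
have uE : u = x |: t by rewrite E finset.setD1K.
have : x \notin t by rewrite E !inE eqxx.
rewrite !inE xs andbT negb_and !negbK => /orP[] /eqP xE.
  by move: uv; rewrite uE xE /t finset.setD1K ?eqxx.
by move: uw; rewrite uE xE t' finset.setD1K ?eqxx.
Qed.

(** A face that nothing can be attached to is the only coface of each of its own
    facets, so the cycle condition at one of them kills its coefficient. *)
Lemma cycle_eq0 t : t \in simplices K k.+1 -> (forall x : V, x \notin t -> ~~ adjacent x t) ->
  F t = 0.
Proof.
rewrite simplicesP => /andP[tK /eqP tk] nt.
have [v vt _] := some_vertexP tk.
have vtk : #|t :\ v| = k by move: tk; rewrite (cardsD1 v) vt => -[].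
have tvK : t :\ v \in simplices K k.
  by apply: facets_simplices => //; apply: facetsK; rewrite // tk.
have := FB tvK; rewrite (bigD1 t)//= incidenceD1// big1 ?addr0.
  by move=> /eqP; rewrite mulf_eq0 (negPf (vsign_neq0 _ _)) orbF => /eqP.
move=> u ut; have [/F0->|] := boolP (u \notin simplices K k.+1).
  by rewrite mul0r.
rewrite negbK simplicesP => /andP[uK /eqP uk].
rewrite incidence_eq0 ?mulr0// => x xu; apply/eqP => E.
have /card_gt0P[y yt] : (0 < #|t :\ v|)%N by rewrite vtk.
have := yt; rewrite {1}E !inE => /andP[yx yu].
have yt' : y \in t by move: yt; rewrite !inE => /andP[].
have exy : e x y by apply: (Kclique uK) => //; rewrite eq_sym.
have xt : x \in t.
  by apply: contraT => /nt; rewrite (adjacentP yt' exy).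
case/eqP: ut; apply/eqP; rewrite eqEcard uk tk leqnn andbT.
apply: (@setD1_subset _ _ x); first by rewrite -E subD1set.
exact: xt.
Qed.

(** The chain whose boundary is F, when F is a boundary: by [cycle_local_ratio]
    the coefficient of an isolated simplex can be read off any of its facets. *)
Definition fill s := if isolated s then sign0 s * F (facet0 s) else 0.

(** Three kinds of k-faces: extendable ones, where F vanishes and no isolated
    simplex has them as a facet; those with no adjacent vertex, where
    [cycle_eq0] applies; and facets of a single isolated set of k + 2 vertices,
    where [cycle_local_ratio] propagates the value at the first facet. *)
Lemma cycle_fill :
  (forall t, t \in extendable k -> F t = 0) ->
  (forall s, #|s| = k.+2 -> hollow K s -> F (facet0 s) = 0) ->
  forall t, t \in simplices K k.+1 ->
  F t = \sum_(s in simplices K k.+2) fill s * incidence s t.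
Proof.
move=> FA FH t tKk; have := tKk; rewrite simplicesP => /andP[tK /eqP tk].
have [w wt _] := some_vertexP tk.
(* a coface of t is obtained by adding an adjacent vertex *)
have coface s : s \in simplices K k.+2 -> incidence s t != 0 ->
    exists x, [/\ x \notin t, adjacent x t & s = x |: t].
  rewrite simplicesP => /andP[sK _] /incidence_neq0[x xs E]; exists x.
  have xt : x \notin t by rewrite E !inE eqxx.
  split=> //; last by rewrite E finset.setD1K.
  apply: (adjacentP wt); apply: (Kclique sK) => //.
    by move: wt; rewrite E !inE => /andP[].
  by apply: contraNneq xt => ->.
have [tA|tA] := boolP (t \in extendable k).
  rewrite FA// big1// => s sK; have [->|] := eqVneq (incidence s t) 0.
    by rewrite mulr0.
  move/(coface _ sK) => [x [xt ax sE]]; rewrite /fill.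
  case: ifPn => [is_|]; last by rewrite mul0r.
  move: tA; rewrite inE tKk /= => /existsP[u /existsP[v /and4P[ut au vut av]]].
  have us : u \in s.
    case/existsP: au => y /andP[yt euy].
    by apply: (isolatedP is_ (w := y)) => //; rewrite sE !inE yt orbT.
  have ux : u = x by move: us; rewrite sE !inE (negPf ut) orbF => /eqP.
  move: vut av; rewrite ux -sE => vs /existsP[y /andP[ys evy]].
  by rewrite (isolatedP is_ ys evy) in vs.
have [/existsP[u /andP[ut au]]|nt] :=
    boolP [exists u, (u \notin t) && adjacent u t]; last first.
  have nt' (u : V) : u \notin t -> ~~ adjacent u t.
    move=> ut; apply: contra nt => au; apply/existsP; exists u.
    by rewrite ut.
  rewrite (cycle_eq0 tKk)// big1// => s sK.
  have [->|] := eqVneq (incidence s t) 0; first by rewrite mulr0.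
  by move/(coface _ sK) => [x [xt ax sE]]; have := nt' x xt; rewrite ax.
pose s := u |: t.
have sk : #|s| = k.+2 by rewrite cardsU1 ut tk.
have us : u \in s by rewrite finset.setU11.
have st : s :\ u = t by rewrite finset.setU1K.
have is_ : isolated s.
  apply/forallP => v; apply/implyP => vs; apply: contra tA => av.
  rewrite inE tKk; apply/existsP; exists u; apply/existsP; exists v.
  by rewrite ut au vs av.
have [v vs pv] := some_vertexP sk.
have ratio : vsign s v * F (s :\ v) = vsign s u * F t.
  by rewrite -st; exact: cycle_local_ratio.
have unique r : r \in simplices K k.+2 -> r != s -> incidence r t = 0.
  move=> rK; apply: contraNeq => /(coface _ rK)[x [xt /existsP[y /andP[yt exy]] rE]].
  have ys : y \in s by rewrite !inE yt orbT.
  have := isolatedP is_ ys exy; rewrite !inE (negPf xt) orbF => /eqP xu.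
  by rewrite rE xu.
have [sK|sK] := boolP (s \in simplices K k.+2).
  rewrite (bigD1 s)//= big1 ?addr0; last first.
    by move=> r /andP[rK /(unique _ rK)->]; rewrite mulr0.
  rewrite /fill is_ /sign0 /facet0 pv ratio.
  have -> : incidence s t = vsign s u by rewrite -[in LHS]st incidenceD1.
  by rewrite mulrAC vsign_sqr mul1r.
rewrite big1; last first.
  move=> r rK; rewrite unique ?mulr0//; by apply: contraNneq sK => <-.
have {}sK : s \notin K by move: sK; rewrite simplicesP sk eqxx andbT.
apply/eqP; rewrite -[_ == 0]orFb -[false](negPf (vsign_neq0 s u)) -mulf_eq0.
have [fs|] := boolP (facets_in K s).
  have := FH s sk; rewrite /hollow fs sK => /(_ isT).
  by rewrite /facet0 pv -ratio => ->; rewrite mulr0.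
rewrite negb_forall => /existsP[y]; rewrite negb_imply => /andP[ys syK].
rewrite -st -(cycle_local_ratio sk is_ ys us) F0 ?mulr0//.
by rewrite simplicesP (negPf syK).
Qed.

End Cycle.

(** Test coordinates: the extendable faces, and one facet of each hollow set. *)
Lemma betti_le_hollow k : (0 < k)%N ->
  (betti K k <= #|[set s : {set V} | (#|s| == k.+2) && hollow K s]|
               + #|extendable k|)%N.
Proof.
move=> k0; set H := finset _.
apply: (@leq_trans #|(facet0 @: H) :|: extendable k|); last first.
  rewrite (leq_trans (leq_card_setU _ _))// leq_add2r.
  exact: leq_imset_card.
apply: betti_le_test => z zB zT.
pose F t := \sum_(i | enum_val i == t) z 0 i.
have Fz i : F (enum_val i) = z 0 i.
  rewrite /F (eq_bigl (pred1 i)) ?big_pred1_eq// => j.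
  by rewrite /= (inj_eq enum_val_inj).
have F0 t : t \notin simplices K k.+1 -> F t = 0.
  move=> tK; rewrite /F big1// => i /eqP it.
  by case/negP: tK; rewrite -it enum_valP.
have FB t : t \in simplices K k -> \sum_u F u * incidence u t = 0.
  move=> tK; rewrite (bigID (mem (simplices K k.+1)))/= [X in _ + X]big1; last first.
    by move=> u /F0->; rewrite mul0r.
  rewrite addr0 big_enum_val.
  move/matrixP: zB => /(_ 0 (enum_rank_in tK t)); rewrite mul_boundaryE.
  rewrite [RHS]mxE enum_rankK_in// => zt; rewrite -[RHS]zt.
  by apply: eq_bigr => i _; rewrite Fz.
have FA t : t \in extendable k -> F t = 0.
  move=> tA; have tK : t \in simplices K k.+1 by move: tA; rewrite inE => /andP[].
  rewrite -(enum_rankK_in tK tK) Fz; apply: zT.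
  by rewrite enum_rankK_in// inE tA orbT.
have FH s : #|s| = k.+2 -> hollow K s -> F (facet0 s) = 0.
  move=> sk hs; have tK : facet0 s \in simplices K k.+1.
    rewrite /facet0; have [v vs ->] := some_vertexP sk.
    by apply: facets_simplices => //; case/andP: hs.
  rewrite -(enum_rankK_in tK tK) Fz; apply: zT.
  by rewrite enum_rankK_in// inE imset_f// inE sk eqxx.
apply/submxP; exists (\row_i fill F (enum_val i)).
apply/rowP => j; rewrite -Fz mul_boundaryE.
rewrite (cycle_fill k0 F0 FB FA FH (enum_valP j)) big_enum_val.
by apply: eq_bigr => i _; rewrite mxE.
Qed.

End Clique.
End Homology.

Local Open Scope classical_set_scope.
Local Open Scope ring_scope.

(** * Euclidean distance and configurations of points *)

Section Euclid.
Context {R : realType} {d : nat}.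
Implicit Types (x y z : d.-tuple R).

Definition edist x y : R := enorm (tsub x y).

Lemma enorm_sqr x : enorm x ^+ 2 = \sum_(i < d) tnth x i ^+ 2.
Proof. by rewrite sqr_sqrtr// sumr_ge0// => i _; rewrite sqr_ge0. Qed.

Lemma enorm_ge0 x : 0 <= enorm x.
Proof. exact: sqrtr_ge0. Qed.

(** Lagrange's identity: the difference of the two sides is half the sum of the
    squares of the minors a i * b j - a j * b i. *)
Lemma cauchy_schwarz_sum (a b : 'I_d -> R) :
  (\sum_i a i * b i) ^+ 2 <= (\sum_i a i ^+ 2) * (\sum_i b i ^+ 2).
Proof.
have : 0 <= \sum_i \sum_j (a i * b j - a j * b i) ^+ 2.
  by apply: sumr_ge0 => i _; apply: sumr_ge0 => j _; rewrite sqr_ge0.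
suff -> : \sum_i \sum_j (a i * b j - a j * b i) ^+ 2 =
  2 * ((\sum_i a i ^+ 2) * (\sum_i b i ^+ 2)) - 2 * (\sum_i a i * b i) ^+ 2.
  by rewrite -mulrBr pmulr_rge0 ?subr_ge0.
rewrite expr2 !big_distrlr /= !mulr_sumr -sumrB.
have -> : \sum_i \sum_j (a i * b j - a j * b i) ^+ 2 =
   \sum_i \sum_j (2 * (a i ^+ 2 * b j ^+ 2) - 2 * (a i * b i * (a j * b j)))
   + (\sum_i \sum_j (a j ^+ 2 * b i ^+ 2) - \sum_i \sum_j (a i ^+ 2 * b j ^+ 2)).
  rewrite -sumrB -big_split /=; apply: eq_bigr => i _.
  rewrite -sumrB -big_split /=; apply: eq_bigr => j _; ring.
rewrite [X in X - _]exchange_big /= subrr addr0.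
apply: eq_bigr => i _; rewrite !mulr_sumr -sumrB; apply: eq_bigr => j _; ring.
Qed.

Lemma enorm_add_le (a b : 'I_d -> R) :
  enorm [tuple a i + b i | i < d] <= enorm [tuple a i | i < d] + enorm [tuple b i | i < d].
Proof.
rewrite -(@ler_pXn2r _ 2)// ?nnegrE ?addr_ge0 ?enorm_ge0//.
rewrite sqrrD !enorm_sqr.
under eq_bigr do rewrite tnth_mktuple sqrrD.
rewrite !big_split /= [X in _ <= X + _ + _](eq_bigr (fun i => a i ^+ 2)); last first.
  by move=> i _; rewrite tnth_mktuple.
rewrite [X in _ <= _ + X](eq_bigr (fun i => b i ^+ 2)); last first.
  by move=> i _; rewrite tnth_mktuple.
rewrite lerD2r lerD2l -mulr2n lerMn2r/=.
apply: (le_trans (ler_norm _)).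
rewrite -(@ler_pXn2r _ 2)// ?nnegrE ?mulr_ge0 ?enorm_ge0//.
rewrite real_normK ?num_real// exprMn !enorm_sqr.
apply: le_trans (cauchy_schwarz_sum _ _) _.
rewrite le_eqVlt; apply/orP; left; apply/eqP.
by congr (_ * _); apply: eq_bigr => i _; rewrite tnth_mktuple.
Qed.

Lemma edist_triangle x y z : edist x z <= edist x y + edist y z.
Proof.
have := enorm_add_le (fun i => tnth x i - tnth y i) (fun i => tnth y i - tnth z i).
rewrite /edist; congr (_ <= _); rewrite /tsub.
by congr enorm; apply: eq_from_tnth => i; rewrite !tnth_mktuple subrKA.
Qed.

Lemma edistC x y : edist x y = edist y x.
Proof.
rewrite /edist /enorm; congr Num.sqrt; apply: eq_bigr => i _.
by rewrite !tnth_mktuple -sqrrN opprB.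
Qed.

Lemma edistxx x : edist x x = 0.
Proof.
rewrite /edist /enorm big1 ?sqrtr0// => i _.
by rewrite tnth_mktuple subrr expr0n.
Qed.

Lemma edist_origin x : edist x origin = enorm x.
Proof.
rewrite /edist; congr enorm; apply: eq_from_tnth => i.
by rewrite !tnth_mktuple subr0.
Qed.

Lemma enorm_le_edist x y : enorm x <= enorm y + edist x y.
Proof. by rewrite -!edist_origin addrC edist_triangle. Qed.

End Euclid.

Section Configurations.
Context {R : realType} {d : nat}.
Implicit Types (p : nat -> d.-tuple R).

Definition far m (r : R) : set (m.-tuple (d.-tuple R)) :=
  [set t | forall i, r < enorm (tnth t i)].

(** The constant 6 accommodates a simplex (diameter 2) with two vertices
    attached one after the other at distance at most 2. *)
Definition clustered m : set (m.-tuple (d.-tuple R)) :=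
  [set t | forall i j, edist (tnth t i) (tnth t j) <= 6].

(** The Cech complex of such a tuple, at radius 1, is the boundary of a simplex. *)
Definition hollow_config m : set (m.-tuple (d.-tuple R)) :=
  [set t | (forall i, exists z, forall j, j != i -> edist z (tnth t j) <= 1) /\
           ~ exists z, forall j, edist z (tnth t j) <= 1].

(** The points with index in J, in increasing order of indices; the default
    index 0 of [nth] is never reached when J has m elements. *)
Definition subtuple p m n (J : {set 'I_n}) : m.-tuple (d.-tuple R) :=
  [tuple p (nth 0%N [seq val j | j <- enum J] i) | i < m].

(** Symmetric predicates of a subtuple become statements about J itself through
    the increasing enumeration f of J. *)
Lemma subtupleP p m n (J : {set 'I_n}) : #|J| = m -> exists f : 'I_m -> 'I_n,
  [/\ injective f, f @: [set: 'I_m]%SET = J &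
      forall i, tnth (subtuple p m J) i = p (f i)].
Proof.
move=> Jm; have sm : size (enum J) = m by rewrite -cardE.
case: m => [|m] in Jm sm *.
  exists (fun i : 'I_0 => False_rect _ (notF (ltn_ord i))); split => //.
  + by case.
  + move/cards0_eq : Jm => ->; apply/eqP; rewrite -finset.subset0.
    by apply/fintype.subsetP => x /imsetP[[]].
  + by case.
have [j0 j0J] : exists j0, j0 \in J by apply/card_gt0P; rewrite Jm.
exists (fun i => nth j0 (enum J) i); split.
- move=> i j /eqP; rewrite nth_uniq ?enum_uniq ?sm// => /eqP ?; exact: val_inj.
- apply/finset.setP => j; apply/imsetP/idP => [[i _ ->]|jJ].
    by rewrite -mem_enum mem_nth ?sm.
  have jm : (index j (enum J) < m.+1)%N by rewrite -sm index_mem mem_enum.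
  by exists (Ordinal jm); rewrite // nth_index ?mem_enum.
- move=> i; rewrite tnth_mktuple (nth_map j0) ?sm//.
Qed.

End Configurations.

(** * Betti numbers of the Cech complex against counts of configurations *)

Section CechComplex.
Context {R : realType} {d : nat}.
Variable Y : {fset d.-tuple R}.
Local Notation K := (cech Y 1).

Lemma cechP (s : {set Y}) : reflect
  (s != finset.set0 /\ exists z, forall v, v \in s -> edist z (fsval v) <= 1)
  (s \in K).
Proof.
rewrite inE; apply: (iffP andP) => [[-> /asboolP[z sz]]|[-> [z sz]]]; split => //.
  by exists z => v vs; exact: (sz v).
by apply/asboolP; exists z => v /= vs; exact: (sz v).
Qed.

Definition near_points : rel Y := fun v w => edist (fsval v) (fsval w) <= 2.

Lemma cech0 : finset.set0 \notin K.
Proof. by apply/negP => /cechP[]; rewrite eqxx. Qed.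

Lemma cech_down (s t : {set Y}) : s \in K -> t \subset s -> t != finset.set0 -> t \in K.
Proof.
move=> /cechP[_ [z sz]] /fintype.subsetP ts t0; apply/cechP; split => //.
by exists z => v /ts; exact: sz.
Qed.

Lemma cech_clique (s : {set Y}) (v w : Y) : s \in K -> v \in s -> w \in s -> v != w -> near_points v w.
Proof.
move=> /cechP[_ [z sz]] vs ws _; rewrite /near_points.
have := edist_triangle (fsval v) z (fsval w).
have := sz _ vs; have := sz _ ws; rewrite edistC [edist z (fsval v)]edistC; lra.
Qed.

End CechComplex.

Section Counting.
Context {R : realType} {d : nat}.
Variables (p : nat -> d.-tuple R) (n : nat) (Y : {fset d.-tuple R}) (r : R).
Hypothesis YP : forall x, x \in Y <-> exists2 i : 'I_n, p i = x & r < enorm x.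
Local Notation K := (cech Y 1).

Definition count_config m (E : set (m.-tuple (d.-tuple R))) : nat :=
  #|finset (fun J : {set 'I_n} => (#|J| == m) && `[< E (subtuple p m J) >])|.

Lemma index_of_point : exists f : Y -> 'I_n,
  injective f /\ forall v, p (f v) = fsval v.
Proof.
have h (v : Y) : exists i : 'I_n, p i = fsval v.
  by have [i pi _] := (YP (fsval v)).1 (fsvalP v); exists i.
exists (fun v => sval (cid (h v))); split; last by move=> v; case: cid.
by move=> v w; case: cid => i /= vi; case: cid => j /= wj ij; apply: val_inj;
  rewrite /= -vi -wj ij.
Qed.

Section WithIndex.
Variable f : Y -> 'I_n.
Hypotheses (f_inj : injective f) (pf : forall v, p (f v) = fsval v).

Lemma far_index v : r < enorm (p (f v)).
Proof. by rewrite pf; have [] := (YP (fsval v)).1 (fsvalP v). Qed.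

Lemma subtuple_far m (s : {set Y}) : #|s| = m -> far r (subtuple p m (f @: s)).
Proof.
rewrite -(card_imset s f_inj) => /(subtupleP p)[g [_ gs gE]] i.
rewrite gE; have : g i \in f @: s by rewrite -gs imset_f.
by move=> /imsetP[v _ ->]; exact: far_index.
Qed.

Lemma hollow_subtuple m (s : {set Y}) : #|s| = m -> (1 < m)%N -> hollow K s ->
  hollow_config (subtuple p m (f @: s)).
Proof.
move=> sm m1 /andP[/forall_inP sf sK].
have fm := card_imset s f_inj; rewrite sm in fm.
have [g [g_inj gs gE]] := subtupleP p fm.
have gP i : exists2 v, v \in s & g i = f v.
  have : g i \in f @: s by rewrite -gs imset_f.
  by move=> /imsetP[v vs ->]; exists v.
split=> [i|[z hz]].
  have [v vs gi] := gP i; have /cechP[_ [z hz]] := sf v vs.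
  exists z => j ji; have [w ws gj] := gP j.
  rewrite gE gj pf; apply: hz; rewrite !inE ws andbT.
  by apply: contraNneq ji => wv; apply/eqP/g_inj; rewrite gi gj wv.
case/negP: sK; apply/cechP; split; first by rewrite -card_gt0 sm ltnW.
exists z => v vs; have : f v \in g @: [set: 'I_m]%SET by rewrite gs imset_f.
by move=> /imsetP[i _ fvi]; rewrite -pf fvi -gE.
Qed.

Lemma count_hollow m : (1 < m)%N ->
  (#|[set s : {set Y} | (#|s| == m) && hollow K s]%SET|
   <= count_config (@hollow_config R d m `&` @far R d m r))%N.
Proof.
move=> m1; rewrite -(card_imset _ (imset_inj f_inj)).
apply: subset_leq_card; apply/fintype.subsetP => J /imsetP[s].
rewrite inE => /andP[/eqP sm hs] ->; rewrite inE card_imset// sm eqxx /=.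
by apply/asboolP; split; [exact: hollow_subtuple|exact: subtuple_far].
Qed.

(** Each extendable face lies in the cluster made of it and two attached
    vertices, and a cluster has 2^(k + 3) subsets. *)
Lemma count_extendable k :
  (#|extendable K (@near_points _ _ Y) k|
   <= 2 ^ k.+3 * count_config (@clustered R d k.+3 `&` @far R d k.+3 r))%N.
Proof.
rewrite -(card_imset _ (imset_inj f_inj)).
rewrite /count_config; set C := (_ @: _)%SET; set D := finset _.
have CD : C \subset (\bigcup_(J in D) powerset J)%SET.
  apply/fintype.subsetP => I /imsetP[t + ->{I}].
  rewrite inE simplicesP => /andP[/andP[tK /eqP tk]].
  move=> /existsP[u /existsP[v /and4P[ut /existsP[a /andP[at_ ua]] vut]]].
  move=> /existsP[b /andP[bt vb]].
  pose s := v |: (u |: t).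
  have sk : #|s| = k.+3 by rewrite cardsU1 vut cardsU1 ut tk.
  apply/finset.bigcupP; exists (f @: s); last first.
    rewrite powersetE; apply: imsetS; apply/fintype.subsetP => x xt.
    by rewrite !inE xt !orbT.
  rewrite inE card_imset// sk eqxx /=; apply/asboolP; split; last exact: subtuple_far.
  have fk := card_imset s f_inj; rewrite sk in fk.
  have [g [g_inj gs gE]] := subtupleP p fk.
  have tt x y : x \in t -> y \in t -> edist (fsval x) (fsval y) <= 2.
    move=> xt yt; have [->|xy] := eqVneq x y; first by rewrite edistxx.
    exact: (cech_clique tK).
  have ut4 x : x \in t -> edist (fsval u) (fsval x) <= 4.
    move=> xt; have := edist_triangle (fsval u) (fsval a) (fsval x).
    have := tt _ _ at_ xt; move: ua; rewrite /near_points; lra.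
  have vs6 x : x \in u |: t -> edist (fsval v) (fsval x) <= 6.
    move=> xt; have := edist_triangle (fsval v) (fsval b) (fsval x).
    suff : edist (fsval b) (fsval x) <= 4 by move: vb; rewrite /near_points; lra.
    move: bt xt; rewrite !inE => /orP[/eqP->|bt] /orP[/eqP->|xt].
    - by rewrite edistxx.
    - exact: ut4.
    - by rewrite edistC ut4.
    - by have := tt _ _ bt xt; lra.
  have ss x y : x \in s -> y \in s -> edist (fsval x) (fsval y) <= 6.
    rewrite !(finset.in_setU1 _ v) => /predU1P[->|xs] /predU1P[->|ys].
    - by rewrite edistxx.
    - exact: vs6.
    - by rewrite edistC vs6.
    move: xs ys; rewrite !(finset.in_setU1 _ u) => /predU1P[->|xs] /predU1P[->|ys].
    - by rewrite edistxx.
    - by have := ut4 _ ys; lra.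
    - by rewrite edistC; have := ut4 _ xs; lra.
    - by have := tt _ _ xs ys; lra.
  move=> i j; rewrite !gE.
  have /imsetP[x xs ->] : g i \in f @: s by rewrite -gs imset_f.
  have /imsetP[y ys ->] : g j \in f @: s by rewrite -gs imset_f.
  by rewrite !pf; exact: ss.
apply: (leq_trans (subset_leq_card CD)).
apply: (@leq_trans (\sum_(J in D) #|powerset J|)).
  elim/big_rec2 : _ => [|J a A _ ih]; first by rewrite cards0.
  by rewrite (leq_trans (leq_card_setU _ _))// leq_add2l.
rewrite (eq_bigr (fun=> 2 ^ k.+3)%N); last first.
  by move=> J; rewrite inE card_powerset => /andP[/eqP->].
by rewrite sum_nat_const mulnC.
Qed.

End WithIndex.

Lemma betti_le_count k :
  (betti K k.+1 <= count_config (@hollow_config R d k.+3 `&` @far R d k.+3 r)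
    + 2 ^ k.+4 * count_config (@clustered R d k.+4 `&` @far R d k.+4 r))%N.
Proof.
have [f [f_inj pf]] := index_of_point.
apply: leq_trans (leq_add (count_hollow f_inj pf _) (count_extendable f_inj pf _)) => //.
apply: (@betti_le_hollow _ K (@near_points _ _ Y)) => //.
all: first [exact: cech_down|exact: cech_clique].
Qed.

Lemma betti0_le_count : (betti K 0 <= count_config (@far R d 1 r))%N.
Proof.
have [f [f_inj pf]] := index_of_point.
apply: (leq_trans (betti0_le _)).
rewrite -cardsT -(card_imset _ (inj_comp (imset_inj f_inj) set1_inj)).
apply: subset_leq_card; apply/fintype.subsetP => J /imsetP[v _ ->].
rewrite inE /= card_imset// cards1 eqxx /=; apply/asboolP/subtuple_far => //.
by rewrite cards1.
Qed.

(** Isolation is expressed by the absence of clusters with one more index.  The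
    radius r' - 2 allows for the additional point to be slightly closer to the
    origin than the configuration. *)
Definition count_isolated m (E : set (m.-tuple (d.-tuple R))) (r' : R) : nat :=
  #|finset (fun J : {set 'I_n} => (#|J| == m) &&
     `[< (E `&` @far R d m r') (subtuple p m J) /\
         forall i, i \notin J ->
         ~ (@clustered R d m.+1 `&` @far R d m.+1 (r' - 2))
             (subtuple p m.+1 (i |: J)) >])|.

Section Isolated.
Variables (f : Y -> 'I_n) (m : nat) (J : {set 'I_n}).
Hypotheses (f_inj : injective f) (pf : forall v, p (f v) = fsval v).
Variables (E : set (m.-tuple (d.-tuple R))) (r' : R).
Hypothesis rr' : r <= r'.
Hypothesis E2 : forall t, E t -> forall i j, edist (tnth t i) (tnth t j) <= 2.
Hypothesis E_inj : forall t, E t -> forall i j, tnth t i = tnth t j -> i = j.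
Hypothesis Jm : #|J| = m.
Hypothesis JE : E (subtuple p m J).
Hypothesis Jfar : far r' (subtuple p m J).
Hypothesis Jiso : forall i, i \notin J ->
  ~ (@clustered R d m.+1 `&` @far R d m.+1 (r' - 2)) (subtuple p m.+1 (i |: J)).

Let J2 i j : i \in J -> j \in J -> edist (p i) (p j) <= 2.
Proof.
have [g [g_inj gs gE]] := subtupleP p Jm.
rewrite -gs => /imsetP[a _ ->] /imsetP[b _ ->]; rewrite -!gE; exact: E2.
Qed.

Let J_inj i j : i \in J -> j \in J -> p i = p j -> i = j.
Proof.
have [g [g_inj gs gE]] := subtupleP p Jm.
rewrite -gs => /imsetP[a _ ->] /imsetP[b _ ->]; rewrite -!gE => ab.
by congr g; exact: E_inj ab.
Qed.

Let J_far i : i \in J -> r' < enorm (p i).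
Proof.
have [g [g_inj gs gE]] := subtupleP p Jm.
by rewrite -gs => /imsetP[a _ ->]; rewrite -gE.
Qed.

(** An index i outside J with p i within 2 of the configuration would turn J into
    a cluster of diameter at most 4. *)
Lemma isolated_index (i j : 'I_n) : j \in J -> edist (p i) (p j) <= 2 -> i \in J.
Proof.
move=> jJ ij; apply/negPn/negP => iJ; apply: (Jiso iJ).
have iJm : #|i |: J| = m.+1 by rewrite cardsU1 iJ Jm.
have [g [g_inj gs gE]] := subtupleP p iJm.
have i4 x : x \in J -> edist (p i) (p x) <= 4.
  by move=> xJ; have := edist_triangle (p i) (p j) (p x); have := J2 jJ xJ; lra.
have gP a : g a \in i |: J by rewrite -gs imset_f.
split=> [a b|a]; rewrite !gE.
  move: (gP a) (gP b); rewrite !inE => /orP[/eqP->|aJ] /orP[/eqP->|bJ].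
  - by rewrite edistxx.
  - by have := i4 _ bJ; lra.
  - by rewrite edistC; have := i4 _ aJ; lra.
  - by have := J2 aJ bJ; lra.
move: (gP a); rewrite !inE => /orP[/eqP->|aJ]; last by have := J_far aJ; lra.
by have := enorm_le_edist (p j) (p i); rewrite edistC; have := J_far jJ; lra.
Qed.

(** An index whose point coincides with a point of J is at distance 0 from it,
    hence in J by [isolated_index]. *)
Lemma imset_preimset : f @: (f @^-1: J) = J.
Proof.
apply/finset.setP => j; apply/imsetP/idP => [[v + ->]|jJ]; first by rewrite inE.
have jY : p j \in Y.
  by apply/YP; exists j => //; apply: (le_lt_trans rr'); exact: J_far.
have fj : p (f [` jY]%fset) = p j by rewrite pf.
have fJ : f [` jY]%fset \in J.
  by apply: (isolated_index jJ); rewrite fj edistxx.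
by exists [` jY]%fset; [rewrite inE|exact: J_inj].
Qed.

Lemma isolated_preimset : isolated (@near_points _ _ Y) (f @^-1: J).
Proof.
apply/forallP => v; apply/implyP; apply: contra => /existsP[w].
rewrite !inE => /andP[wJ vw]; apply: (isolated_index wJ).
by rewrite !pf.
Qed.

End Isolated.

(** If two points coincide, dropping one of them does not change the set of
    balls, so the balls of the whole tuple would meet. *)
Lemma hollow_config_inj m (t : m.-tuple (d.-tuple R)) : hollow_config t ->
  forall i j, tnth t i = tnth t j -> i = j.
Proof.
move=> [ht hn] i j ij; apply/eqP; apply: contraT => ineq.
have [z hz] := ht i; case: hn; exists z => a.
have [->|ai] := eqVneq a i; last exact: hz.
by rewrite ij; apply: hz; rewrite eq_sym.
Qed.

Lemma hollow_config_le2 m (t : m.-tuple (d.-tuple R)) : (2 < m)%N -> hollow_config t ->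
  forall i j, edist (tnth t i) (tnth t j) <= 2.
Proof.
move=> m2 [ht _] i j.
have [a [ai aj]] : exists a, a != i /\ a != j.
  have : (0 < #|~: [set i; j]%SET|)%N.
    rewrite -[ltnRHS](addKn #|[set i; j]%SET|) cardsC card_ord subn_gt0.
    by apply: leq_ltn_trans m2; rewrite cards2; case: (_ != _).
  by move=> /card_gt0P[a]; rewrite !inE negb_or => /andP[? ?]; exists a.
have [z hz] := ht a.
have := hz i; have := hz j; rewrite eq_sym aj eq_sym ai => /(_ isT) zj /(_ isT) zi.
have := edist_triangle (tnth t i) z (tnth t j).
by rewrite [edist _ z]edistC; lra.
Qed.

Lemma betti_ge_count k r' : r <= r' ->
  (count_isolated (@hollow_config R d k.+3) r' <= betti K k.+1)%N.
Proof.
move=> rr'; have [f [f_inj pf]] := index_of_point.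
apply: leq_trans (betti_ge_isolated_hollow (@cech0 _ _ Y) (@cech_down _ _ Y)
  (@cech_clique _ _ Y) (ltn0Sn k)).
have E2 := @hollow_config_le2 k.+3 ^~ isT.
have E_inj := @hollow_config_inj k.+3.
rewrite /count_isolated; set C := finset _.
have CP J : J \in C -> [/\ #|J| = k.+3, @hollow_config R d k.+3 (subtuple p k.+3 J),
    f @: (f @^-1: J) = J & isolated (@near_points _ _ Y) (f @^-1: J)].
  rewrite inE => /andP[/eqP Jm /asboolP[[JE Jfar] Jiso]]; split => //.
    exact: (imset_preimset pf rr' E2 E_inj Jm JE Jfar Jiso).
  exact: (isolated_preimset pf E2 Jm JE Jfar Jiso).
rewrite -(card_in_imset (f := fun J : {set 'I_n} => f @^-1: J) (D := C)); last first.
  by move=> I J /CP[_ _ fI _] /CP[_ _ fJ _] IJ; rewrite -fI IJ fJ.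
apply: subset_leq_card; apply/fintype.subsetP => s /imsetP[J /CP[Jm JE fJ Ji] ->].
set s0 := f @^-1: J.
have sm : #|s0| = k.+3 by rewrite -(card_imset _ f_inj) fJ.
rewrite inE sm eqxx Ji andbT /=.
have [g [g_inj gs gE]] := subtupleP p Jm.
have gP v : v \in s0 -> exists a, f v = g a.
  by rewrite inE -gs => /imsetP[a _ ->]; exists a.
case: JE => JE1 JE2; apply/andP; split.
  apply/forall_inP => v vs; have [a fva] := gP _ vs.
  apply/cechP; split.
    by have := cardsD1 v s0; rewrite -card_gt0 sm vs add1n => -[<-].
  have [z hz] := JE1 a; exists z => w; rewrite !finset.inE => /andP[wv ws].
  have [b fwb] : exists b, f w = g b by apply: gP; rewrite inE.
  rewrite -pf fwb -gE; apply: hz; apply: contraNneq wv => ba.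
  by apply/eqP/f_inj; rewrite fva fwb ba.
apply/negP => /cechP[_ [z hz]]; apply: JE2; exists z => b.
have : g b \in f @: s0 by rewrite fJ -gs imset_f.
by move=> /imsetP[v vs gb]; rewrite gE gb pf; exact: hz.
Qed.

Lemma betti0_ge_count r' : r <= r' ->
  (count_isolated [set: 1.-tuple (d.-tuple R)] r' <= betti K 0)%N.
Proof.
move=> rr'; have [f [f_inj pf]] := index_of_point.
apply: leq_trans (betti_ge_isolated_vertex (@cech0 _ _ Y) (@cech_down _ _ Y)
  (@cech_clique _ _ Y)).
have E2 (t : 1.-tuple (d.-tuple R)) : [set: 1.-tuple (d.-tuple R)] t ->
    forall i j, edist (tnth t i) (tnth t j) <= 2.
  by move=> _ i j; rewrite (ord1 i) (ord1 j) edistxx.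
have E_inj (t : 1.-tuple (d.-tuple R)) : [set: 1.-tuple (d.-tuple R)] t ->
    forall i j, tnth t i = tnth t j -> i = j.
  by move=> _ i j _; rewrite (ord1 i) (ord1 j).
rewrite /count_isolated; set C := finset _.
have CP J : J \in C -> [/\ #|J| = 1%N,
    f @: (f @^-1: J) = J & isolated (@near_points _ _ Y) (f @^-1: J)].
  rewrite inE => /andP[/eqP Jm /asboolP[[JE Jfar] Jiso]]; split => //.
    exact: (imset_preimset pf rr' E2 E_inj Jm JE Jfar Jiso).
  exact: (isolated_preimset pf E2 Jm JE Jfar Jiso).
rewrite -(card_in_imset (f := fun J : {set 'I_n} => f @^-1: J) (D := C)); last first.
  by move=> I J /CP[_ fI _] /CP[_ fJ _] IJ; rewrite -fI IJ fJ.
apply: subset_leq_card; apply/fintype.subsetP => s /imsetP[J /CP[Jm fJ Ji] ->].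
have sm : #|f @^-1: J| = 1%N by rewrite -(card_imset _ f_inj) fJ.
rewrite inE sm eqxx Ji !andbT /=; have /eqP/cards1P[v ->] := sm.
apply/cechP; split; first by rewrite -card_gt0 cards1.
by exists (fsval v) => w; rewrite inE => /eqP ->; rewrite edistxx ler01.
Qed.

End Counting.

(** * Power measures, independence and densities *)

Section Rectangles.
Local Open Scope ereal_scope.
Context {disp : measure_display} {T : measurableType disp} {R : realType}.
Implicit Types (m : {sigma_finite_measure set T -> \bar R}).

Definition rectangle n (A : 'I_n -> set T) : set (n.-tuple T) :=
  [set t | forall i, A i (tnth t i)].

Lemma measurable_rectangle n (A : 'I_n -> set T) :
  (forall i, measurable (A i)) -> measurable (rectangle A).
Proof.
move=> mA; have -> : rectangle A = \bigcap_(i in [set: 'I_n]) (@tnth n T ^~ i @^-1` A i).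
  by apply/seteqP; split => [t h i _|t h i]; [exact: h|exact: (h i Logic.I)].
apply: fin_bigcap_measurable => // i _.
by rewrite -[X in measurable X]setTI; exact: measurable_tnth.
Qed.

Lemma measurable_tupleE n :
  measurable = <<s [set B : set (n.-tuple T) |
    exists2 A : 'I_n -> set T, (forall i, measurable (A i)) & B = rectangle A] >>.
Proof.
apply/seteqP; split; last first.
  apply: smallest_sub; first exact: sigma_algebra_measurable.
  by move=> _ [A mA ->]; exact: measurable_rectangle.
apply: smallest_sub; first exact: smallest_sigma_algebra.
move=> B; rewrite -bigcup_seq/= => -[i _ [C mC <-]].
apply: sub_sigma_algebra; exists (fun j => if j == i then C else setT).
  by move=> j; case: ifP.
rewrite setTI; apply/seteqP; split => [t Ct j|t /(_ i)]; last by rewrite eqxx.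
by case: eqP => [->|].
Qed.

Lemma power_measureS m n (B : set (n.+1.-tuple T)) :
  power_measure m n.+1 B =
  \int[m]_x power_measure m n [set t : n.-tuple T | B [tuple of x :: t]].
Proof.
rewrite /= /cons_measure /pushforward /product_measure1/=; apply: eq_integral => x _ /=.
by congr (power_measure m n _); apply/seteqP; split => t; rewrite /xsection/= inE.
Qed.

Lemma power_measure_rectangle m n (A : 'I_n -> set T) :
  (forall i, measurable (A i)) ->
  power_measure m n (rectangle A) = \prod_(i < n) m (A i).
Proof.
elim: n A => [|n ih] A mA.
  rewrite big_ord0 /= diracE mem_set//; by case.
rewrite big_ord_recl /= /cons_measure /pushforward.
rewrite [X in (m \x _) X](_ : _ = A ord0 `*` rectangle (fun i => A (lift ord0 i))).
  rewrite product_measure1E//; last exact: measurable_rectangle.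
  by rewrite ih.
apply/seteqP; split => [[x t] h|[x t] [/= h0 h] i].
  split; first exact: (h ord0).
  by move=> i /=; have := h (lift ord0 i); rewrite tnthS.
by have [j ->|->] := unliftP ord0 i; rewrite ?tnthS//; exact: h.
Qed.

(** Rectangles form a pi-system that generates the product sigma-algebra. *)
Lemma power_measure_unique m n (mu : {measure set (n.-tuple T) -> \bar R}) :
  (forall A : 'I_n -> set T, (forall i, measurable (A i)) ->
     mu (rectangle A) = \prod_(i < n) m (A i)) ->
  forall B, measurable B -> mu B = power_measure m n B.
Proof.
move=> h B mB; apply/esym.
have /sigma_finiteP[F [TF ndF Foo]] := sigma_finiteT m.
apply: (measure_unique _ (fun k => rectangle (fun=> F k)) (measurable_tupleE n)) => //.
- move=> _ _ [A mA ->] [C mC ->]; exists (fun i => A i `&` C i).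
    by move=> i; exact: measurableI.
  apply/seteqP; split => [t [tA tC] i|t AC]; first by split; [exact: tA|exact: tC].
  by split => i; have [] := AC i.
- by move=> k; exists (fun=> F k) => // i; exact: (Foo k).1.
- rewrite -subTset => t _.
  have /choice[k kP] : forall i : 'I_n, exists k, F k (tnth t i).
    move=> i; have : [set: T] (tnth t i) by [].
    by rewrite TF => -[k _ ?]; exists k.
  exists (\max_(i < n) k i)%N => // i.
  apply: (subsetPset _ _ (ndF _ _ _)) (kP i).
  exact: (leq_bigmax i).
- move=> _ [A mA ->]; rewrite h//; exact: power_measure_rectangle.
- move=> k; apply: (@le_lt_trans _ _ (\prod_(i < n) m (F k))).
    rewrite le_eqVlt; apply/orP; left; apply/eqP.
    by apply: power_measure_rectangle => i; exact: (Foo k).1.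
  have [_ Fk] := Foo k; rewrite ltey; apply/eqP => E.
  have : (\prod_(i < n) m (F k)) \is a fin_num.
    elim/big_ind : _ => // [x y|i _]; first exact: fin_numM.
    by rewrite ge0_fin_numE.
  by rewrite E.
Qed.

End Rectangles.
Section IID.
Local Open Scope ereal_scope.
Context {disp : measure_display} {Om : measurableType disp} {R : realType}.
Context {P : probability Om R}.
Context {disp' : measure_display} {T : measurableType disp'}.
Variable X : nat -> {RV P >-> T}.
Hypothesis X_indep : mutually_independent X.
Hypothesis X_ident : forall i A, measurable A ->
  distribution P (X i) A = distribution P (X 0%N) A.

Let joint m (s : m.-tuple nat) (w : Om) : m.-tuple T := [tuple X (tnth s i) w | i < m].

Lemma measurable_joint m (s : m.-tuple nat) : measurable_fun setT (joint s).
Proof.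
apply/measurable_fun_tnthP => i.
rewrite (_ : _ \o _ = X (tnth s i)); last by apply/funext => w; rewrite /= tnth_mktuple.
exact: measurable_funP.
Qed.

(** Independence is exactly the product formula on rectangles, and these
    determine the law. *)
Lemma iid_law m (s : m.-tuple nat) B : uniq s -> measurable B ->
  P [set w | B [tuple X (tnth s i) w | i < m]] =
  power_measure (distribution P (X 0%N)) m B.
Proof.
move=> us; pose mu : {measure set (m.-tuple T) -> \bar R} :=
  measure_function_pushforward__canonical__measure_function_Measure
    P (measurable_joint s).
apply: (@power_measure_unique _ _ _ _ _ mu) => A mA.
pose A' j := if insub (index j s) is Some i then A i else setT.
have mA' j : measurable (A' j) by rewrite /A'; case: insub.
have A's i : A' (tnth s i) = A i.
  rewrite /A' (tnth_nth 0%N) index_uniq ?size_tuple//.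
  by rewrite insubT//= => h; congr A; apply: val_inj.
have := X_indep [fset j in tval s]%fset mA'.
rewrite (perm_big s) /=; last first.
  apply: uniq_perm => //; first exact: fset_uniq.
  by move=> j; rewrite inE.
rewrite big_tuple (eq_bigr (fun i => distribution P (X 0%N) (A i))); last first.
  by move=> i _; rewrite A's; exact: X_ident.
move=> <-; rewrite /mu /= /pushforward; congr (P _).
apply/seteqP; split => w.
  move=> h j /=; rewrite inE => js.
  have jm : (index j s < m)%N by rewrite -[ltnRHS](size_tuple s) index_mem.
  have -> : j = tnth s (Ordinal jm) by rewrite (tnth_nth 0%N) nth_index.
  by rewrite /preimage /= A's; have := h (Ordinal jm); rewrite tnth_mktuple.
move=> h i; rewrite tnth_mktuple -A's; apply: h.
by rewrite /= inE mem_tnth.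
Qed.

End IID.

Section PowerPreimage.
Local Open Scope ereal_scope.
Context {disp : measure_display} {T : measurableType disp} {R : realType}.
Variables (m : {sigma_finite_measure set T -> \bar R}) (n : nat).
Variables (phi : 'I_n -> T -> T) (c : R).
Hypothesis c_gt0 : (0 < c)%R.
Hypothesis mphi : forall i, measurable_fun setT (phi i).
Hypothesis phi_scale : forall i A, measurable A -> m (phi i @^-1` A) = c%:E * m A.

Let tphi (t : n.-tuple T) : n.-tuple T := [tuple phi i (tnth t i) | i < n].

Lemma measurable_tuple_map : measurable_fun setT tphi.
Proof.
apply/measurable_fun_tnthP => i.
rewrite (_ : _ \o _ = phi i \o (@tnth n T ^~ i)); last first.
  by apply/funext => w; rewrite /= tnth_mktuple.
apply: measurableT_comp => //; exact: measurable_tnth.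
Qed.

(** Covers translations (c = 1) and dilations, of R^d and of tuples of points. *)
Lemma power_measure_preimage B : measurable B ->
  power_measure m n (tphi @^-1` B) = (c ^+ n)%:E * power_measure m n B.
Proof.
have cn0 : (0 < c ^+ n)%R by rewrite exprn_gt0.
have cn0' : (0 <= (c ^+ n)^-1)%R by rewrite invr_ge0 ltW.
pose mu0 : {measure set (n.-tuple T) -> \bar R} :=
  measure_function_pushforward__canonical__measure_function_Measure
    (power_measure m n) measurable_tuple_map.
pose mu : {measure set (n.-tuple T) -> \bar R} := mscale (NngNum cn0') mu0.
have muE C : mu C = ((c ^+ n)^-1)%:E * power_measure m n (tphi @^-1` C) by [].
move=> mB; suff <- : mu B = power_measure m n B.
  by rewrite muE muleA -EFinM divff ?mul1e//; exact: lt0r_neq0.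
apply: power_measure_unique => // A mA; rewrite muE.
rewrite (_ : _ @^-1` _ = rectangle (fun i => phi i @^-1` A i)); last first.
  by apply/seteqP; split => t h i; have := h i; rewrite tnth_mktuple.
have -> : (power_measure m n (rectangle (fun i => phi i @^-1` A i)) =
   \prod_(i < n) m (phi i @^-1` A i)).
  apply: power_measure_rectangle => i.
  by rewrite -[X in measurable X]setTI; exact: mphi.
under eq_bigr do rewrite phi_scale//.
rewrite big_split /= muleA.
suff -> : \prod_(i < n) c%:E = (c ^+ n)%:E.
  by rewrite -EFinM mulVf ?mul1e//; exact: lt0r_neq0.
by rewrite prodEFin prodr_const card_ord.
Qed.

End PowerPreimage.

Section Density.
Local Open Scope ereal_scope.
Context {disp : measure_display} {T : measurableType disp} {R : realType}.
Variables (nu mu : {measure set T -> \bar R}) (g : T -> R).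
Hypothesis mg : measurable_fun setT g.
Hypothesis g0 : forall x, (0 <= g x)%R.
Hypothesis nuE : forall A, measurable A -> nu A = \int[mu]_(x in A) (g x)%:E.

Import HBNNSimple.

(** True for indicators by definition of the density, hence for simple functions
    by linearity and for all nonnegative functions by monotone convergence. *)
Lemma integral_density (h : T -> \bar R) : measurable_fun setT h -> (forall x, 0 <= h x) ->
  \int[nu]_x h x = \int[mu]_x (h x * (g x)%:E).
Proof.
move=> mh h0; pose E := [set: T].
have mE : measurable E by exact: measurableT.
pose s := nnsfun_approx mE mh.
have -> : \int[nu]_(x in E) h x =
    lim (\int[nu]_(x in E) (EFin \o s n) x @[n --> \oo]).
  have fE x : E x -> h x = lim ((EFin \o s n) x @[n --> \oo]).
    by move=> Ex; apply/esym/cvg_lim => //; exact: cvg_nnsfun_approx.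
  under eq_integral => x /[!inE] /fE -> //.
  apply: monotone_convergence => //.
  - by move=> n; exact/measurable_EFinP/measurable_funP.
  - by move=> n x Ex //=; rewrite lee_fin.
  - by move=> x Ex a b ab; rewrite lee_fin; exact/lefP/nd_nnsfun_approx.
have mgE : measurable_fun setT (EFin \o g) by exact/measurable_EFinP.
have -> : \int[mu]_(x in E) (h x * (g x)%:E) =
    lim (\int[mu]_(x in E) ((EFin \o s n) \* (EFin \o g)) x @[n --> \oo]).
  have fg x : E x -> h x * (g x)%:E = lim (((EFin \o s n) \* (EFin \o g)) x @[n --> \oo]).
    by move=> Ex; apply/esym/cvg_lim => //; apply: cvgeZr => //;
      exact: cvg_nnsfun_approx.
  under eq_integral => x /[!inE] /fg -> //.
  apply: monotone_convergence => [//| | |].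
  - by move=> n; apply/emeasurable_funM => //; exact/measurable_EFinP/measurable_funP.
  - by move=> n x Ex /=; apply: mule_ge0; rewrite lee_fin.
  - by move=> x Ex a b ab/=; rewrite lee_wpmul2r ?lee_fin//; exact/lefP/nd_nnsfun_approx.
suff suf n : \int[mu]_(x in E) ((EFin \o s n) x * (g x)%:E) =
    \int[nu]_(x in E) (EFin \o s n) x.
  by under [in RHS]eq_fun do rewrite suf.
transitivity (\int[nu]_(x in E)
   (\sum_(y \in range (s n)) (y * \1_(s n @^-1` [set y]) x)%:E)); last first.
  by apply: eq_integral => t tE; rewrite /= fimfunE -fsumEFin.
have indich m r : measurable_fun E (fun x => (r * \1_(s m @^-1` [set r]) x)%:E).
  by apply: (measurable_comp measurableT) => //; exact: measurable_funM.
rewrite ge0_integral_fsum//; last by move=> m y Ey; exact: nnfun_muleindic_ge0.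
transitivity (\int[mu]_(x in E) (\sum_(y \in range (s n))
    (y * \1_(s n @^-1` [set y]) x)%:E * (g x)%:E)).
  under [RHS]eq_integral => x xE.
    rewrite -ge0_mule_fsuml => [|y]; last exact: nnfun_muleindic_ge0.
    rewrite fsumEFin // -(fimfunE _ x); over.
  by [].
rewrite ge0_integral_fsum//; last 2 first.
  - by move=> y; apply: emeasurable_funM.
  - by move=> m y Ey; apply: mule_ge0; [exact: nnfun_muleindic_ge0|rewrite lee_fin].
apply: eq_fsbigr => r rhn.
under [RHS]eq_integral do rewrite EFinM.
rewrite integralZl_indic_nnsfun => //.
under eq_integral do rewrite EFinM -muleA.
rewrite ge0_integralZl//.
- under eq_integral do rewrite muleC.
  rewrite (eq_integral ((EFin \o g) \_ (s n @^-1` [set r]))); last first.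
    by move=> x xE; rewrite epatch_indic.
  by rewrite -integral_mkcondr -nuE// integral_indic// setIC.
- apply: emeasurable_funM => //; exact/measurable_EFinP.
- by move=> t Et; apply: mule_ge0; rewrite lee_fin.
- by move: rhn; rewrite inE => -[t _ <-]; rewrite lee_fin.
Qed.

End Density.

Section PowerDensity.
Local Open Scope ereal_scope.
Context {disp : measure_display} {T : measurableType disp} {R : realType}.
Variables (nu mu : {sigma_finite_measure set T -> \bar R}) (g : T -> R).
Hypothesis mg : measurable_fun setT g.
Hypothesis g0 : forall x, (0 <= g x)%R.
Hypothesis nuE : forall A, measurable A -> nu A = \int[mu]_(x in A) (g x)%:E.

Lemma measurable_section n (B : set (n.+1.-tuple T)) (x : T) : measurable B ->
  measurable [set t : n.-tuple T | B [tuple of x :: t]].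
Proof.
move=> mB; rewrite -[X in measurable X]setTI.
by apply: measurable_cons => //; exact: measurable_cst.
Qed.

Lemma measurable_fun_section m n (B : set (n.+1.-tuple T)) : measurable B ->
  measurable_fun setT
    (fun x => power_measure m n [set t : n.-tuple T | B [tuple of x :: t]] : \bar R).
Proof.
move=> mB.
have mB' : measurable (@tcons _ T n @^-1` B).
  by rewrite -[X in measurable X]setTI; exact: measurable_tcons.
apply: eq_measurable_fun (measurable_fun_xsection (power_measure m n) mB').
move=> x _ /=; congr (power_measure m n _).
by apply/seteqP; split => t; rewrite /xsection/= inE.
Qed.

(** Induction on n, integrating over the first coordinate; the density is
    controlled only on W, outside of which the sections of B are empty. *)
Lemma power_measure_density_bounds n (W : set T) (a b : R) (B : set (n.-tuple T)) :
  (0 <= a)%R -> (forall x, W x -> (a <= g x <= b)%R) -> measurable B ->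
  B `<=` [set t | forall i, W (tnth t i)] ->
  (a ^+ n)%:E * power_measure mu n B <= power_measure nu n B <=
  (b ^+ n)%:E * power_measure mu n B.
Proof.
move=> a0 gW; elim: n B => [|n ih] B mB BW.
  by rewrite !expr0 !mul1e lexx.
have ihx x : (a ^+ n)%:E * power_measure mu n [set t : n.-tuple T | B [tuple of x :: t]]
    <= power_measure nu n [set t : n.-tuple T | B [tuple of x :: t]] <=
  (b ^+ n)%:E * power_measure mu n [set t : n.-tuple T | B [tuple of x :: t]].
  apply: ih; first exact: measurable_section.
  by move=> t /= /BW h i; have := h (lift ord0 i); rewrite tnthS.
have [[x0 Wx0]|W0] := pselect (exists x, W x); last first.
  have -> : B = set0.
    by apply/seteqP; split => // t /BW /(_ ord0) w; case: W0; exists (tnth t ord0).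
  by rewrite !measure0 !mule0 lexx.
rewrite !power_measureS (integral_density (mu := mu) mg g0 nuE)//; last exact: measurable_fun_section.
have b_ge0 x : W x -> (0 <= b)%R.
  by move=> /gW /andP[ag gb]; exact: le_trans gb.
have mmu := measurable_fun_section mu mB.
have mnu := measurable_fun_section nu mB.
have out x : ~ W x -> [set t : n.-tuple T | B [tuple of x :: t]] = set0.
  by move=> Wx; apply/seteqP; split => // t /= /BW /(_ ord0).
apply/andP; split.
  rewrite -ge0_integralZl//; last by rewrite lee_fin exprn_ge0.
  apply: ge0_le_integral => //.
  - by move=> x _; rewrite mule_ge0// lee_fin exprn_ge0.
  - exact: emeasurable_funM.
  - by apply: emeasurable_funM => //; exact/measurable_EFinP.
  move=> x _; have [Wx|/out ->] := pselect (W x); last by rewrite !measure0 mule0 mul0e.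
  have /andP[ag gb] := gW _ Wx; have /andP[h _] := ihx x.
  apply: le_trans (lee_wpmul2r _ h); last by rewrite lee_fin.
  rewrite exprSr EFinM muleAC; apply: lee_wpmul2l; last by rewrite lee_fin.
  by rewrite mule_ge0// lee_fin exprn_ge0.
have b0 := b_ge0 _ Wx0.
rewrite -ge0_integralZl//; last by rewrite lee_fin exprn_ge0.
apply: ge0_le_integral => //.
- by move=> x _; rewrite mule_ge0// lee_fin.
- by apply: emeasurable_funM => //; exact/measurable_EFinP.
- exact: emeasurable_funM.
move=> x _; have [Wx|/out ->] := pselect (W x); last by rewrite !measure0 mule0 mul0e.
have /andP[ag gb] := gW _ Wx; have /andP[_ h] := ihx x.
apply: (le_trans (lee_wpmul2r _ h)); first by rewrite lee_fin.
rewrite exprSr EFinM [leRHS]muleAC; apply: lee_wpmul2l; last by rewrite lee_fin.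
by rewrite mule_ge0// lee_fin exprn_ge0.
Qed.

End PowerDensity.

(** * Lebesgue measure of R^d: translations, dilations and balls *)

Section LebesguePreimage.
Context {R : realType}.

(** It suffices to compare both sides on half-open intervals. *)
Lemma lebesgue1_affine (a b : R) (A : set R) : 0 < a -> measurable A ->
  (lebesgue1 ((fun x => (a * x + b)%R) @^-1` A) = (a^-1)%:E * lebesgue1 A)%E.
Proof.
move=> a0 mA.
pose phi : measurableTypeR R -> measurableTypeR R := fun x => (a * x + b)%R.
have mphi : measurable_fun setT phi.
  by apply: measurable_funD => //; apply: measurable_funM => //; exact: measurable_cst.
pose mu0 : {measure set (measurableTypeR R) -> \bar R} :=
  measure_function_pushforward__canonical__measure_function_Measure
    (@lebesgue_measure R) mphi.
pose mu : {measure set (measurableTypeR R) -> \bar R} := mscale (NngNum (ltW a0)) mu0.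
have muE C : mu C = (a%:E * lebesgue_measure (phi @^-1` C))%E by [].
have : lebesgue_measure A = mu A.
  apply: lebesgue_measure_unique => //= _ [[s t]] _ <-; rewrite muE.
  have -> : phi @^-1` `]s, t] = `](s - b) / a, (t - b) / a]%classic.
    apply/seteqP; split => x /=; rewrite !in_itv/= /phi.
      by rewrite ltr_pdivrMr// ler_pdivlMr// ltrBlDr lerBrDr mulrC.
    by rewrite ltr_pdivrMr// ler_pdivlMr// ltrBlDr lerBrDr mulrC.
  rewrite !lebesgue_measure_itv/= !lte_fin ltr_pM2r ?invr_gt0// ltrD2r.
  case: ifP => _; last by rewrite mule0.
  rewrite -!EFinB -EFinM; congr EFin; field; exact: lt0r_neq0.
rewrite muE => h; rewrite /lebesgue1 [in RHS]h muleA -EFinM mulVf ?mul1e//.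
exact: lt0r_neq0.
Qed.

Context {d : nat}.

Definition tadd (x v : d.-tuple R) : d.-tuple R := [tuple tnth x i + tnth v i | i < d].
Definition tscale (a : R) (x : d.-tuple R) : d.-tuple R := [tuple a * tnth x i | i < d].

Lemma measurable_tadd v : measurable_fun setT (tadd ^~ v).
Proof.
apply: (@measurable_tuple_map _ R d (fun i x => (x + tnth v i)%R)) => i.
by apply: measurable_funD.
Qed.

Lemma lebesgue_tadd v (A : set (d.-tuple R)) : measurable A ->
  lebesgue R d (tadd ^~ v @^-1` A) = lebesgue R d A.
Proof.
move=> mA; have := @power_measure_preimage _ _ R (@lebesgue1 R) d
  (fun i x => (x + tnth v i)%R) 1 ltr01 _ _ A mA.
rewrite expr1n mul1e; apply => [i|i B mB]; first exact: measurable_funD.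
rewrite mul1e -[RHS]mul1e -[in RHS]invr1 -(lebesgue1_affine (tnth v i) ltr01 mB).
by congr lebesgue1; apply/seteqP; split => x /=; rewrite mul1r.
Qed.

Lemma lebesgue_tscale (a : R) (A : set (d.-tuple R)) : 0 < a -> measurable A ->
  (lebesgue R d (tscale a @^-1` A) = (a^-1 ^+ d)%:E * lebesgue R d A)%E.
Proof.
move=> a0 mA; apply: (@power_measure_preimage _ _ R (@lebesgue1 R) d
  (fun i x => (a * x)%R) a^-1 _ _ _ A mA); first by rewrite invr_gt0.
  by move=> i; apply: measurable_funM => //; exact: measurable_cst.
move=> i B mB; rewrite -(lebesgue1_affine 0 a0 mB).
by congr lebesgue1; apply/seteqP; split => x /=; rewrite addr0.
Qed.

Lemma power_lebesgue_translate n v (B : set (n.-tuple (d.-tuple R))) : measurable B ->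
  power_measure (lebesgue R d) n
    [set t | B [tuple tadd (tnth t i) v | i < n]] = power_measure (lebesgue R d) n B.
Proof.
move=> mB; have := @power_measure_preimage _ _ R (lebesgue R d) n
  (fun i x => tadd x v) 1 ltr01 _ _ B mB.
rewrite expr1n mul1e; apply => [i|i A mA]; first exact: measurable_tadd.
by rewrite mul1e lebesgue_tadd.
Qed.

Lemma measurable_enorm : measurable_fun [set: d.-tuple R] (@enorm R d).
Proof.
apply: (measurableT_comp (f := @Num.sqrt R)).
  by apply: continuous_measurable_fun; exact: sqrt_continuous.
by apply: measurable_sum => i; apply: measurable_funX; exact: measurable_tnth.
Qed.

Lemma measurable_edist disp (T : measurableType disp) (f g : T -> d.-tuple R) :
  measurable_fun setT f -> measurable_fun setT g ->
  measurable_fun setT (fun x => edist (f x) (g x)).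
Proof.
move=> mf mg; apply: (measurableT_comp measurable_enorm).
apply/measurable_fun_tnthP => i.
rewrite (_ : _ \o _ = (fun x => tnth (f x) i - tnth (g x) i)%R); last first.
  by apply/funext => w; rewrite /= tnth_mktuple.
by apply: measurable_funB;
  apply: (measurableT_comp (f := fun t : d.-tuple R => tnth t i)) => //;
  exact: measurable_tnth.
Qed.

Lemma enorm_tscale a (x : d.-tuple R) : 0 <= a -> enorm (tscale a x) = a * enorm x.
Proof.
move=> a0; rewrite /enorm -[in RHS](ger0_norm a0) -sqrtr_sqr -sqrtrM ?sqr_ge0//.
by rewrite mulr_sumr; congr Num.sqrt; apply: eq_bigr => i _;
  rewrite tnth_mktuple exprMn.
Qed.

End LebesguePreimage.

Section Ball.
Local Open Scope ereal_scope.
Context {R : realType} {d : nat}.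

Definition punctured_ball (r : R) : set (d.-tuple R) := [set x | (0 < enorm x <= r)%R].

Lemma measurable_punctured_ball r : measurable (punctured_ball r).
Proof.
have -> : punctured_ball r = @enorm R d @^-1` `]0%R, r]%classic.
  by apply/seteqP; split => x /=; rewrite in_itv.
by rewrite -[X in measurable X]setTI; exact: measurable_enorm.
Qed.

(** Polar decomposition x = |x| * (x / |x|).  The origin is excluded because
    [cone] only uses factors t > 0. *)
Lemma punctured_ballE : punctured_ball 1 = cone unit_sphere.
Proof.
apply/seteqP; split => [x /= /andP[x0 x1]|_ [t [u [/andP[t0 t1] u1 ->]]]].
  exists (enorm x), (tscale (enorm x)^-1 x); split; first by rewrite x0 x1.
    by rewrite /unit_sphere /= enorm_tscale ?invr_ge0 ?enorm_ge0// mulVf// lt0r_neq0.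
  apply: eq_from_tnth => i; rewrite !tnth_mktuple mulrA mulfV ?mul1r//.
  exact: lt0r_neq0.
have := enorm_tscale u (ltW t0); rewrite u1 mulr1 => h.
by rewrite /punctured_ball /= -/(tscale t u) h t0 t1.
Qed.

Lemma sphere_areaE : sphere_area R d = d%:R%:E * lebesgue R d (punctured_ball 1).
Proof. by rewrite punctured_ballE. Qed.

Lemma lebesgue_punctured_ball r : (0 < r)%R ->
  lebesgue R d (punctured_ball r) = (r ^+ d)%:E * lebesgue R d (punctured_ball 1).
Proof.
move=> r0.
have -> : punctured_ball 1 = tscale r @^-1` punctured_ball r.
  apply/seteqP; split => x; rewrite /punctured_ball /= (enorm_tscale _ (ltW r0));
    by rewrite pmulr_rgt0// ger_pMr.
rewrite lebesgue_tscale//; last exact: measurable_punctured_ball.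
rewrite muleA -EFinM exprVn mulfV ?mul1e//.
by rewrite expf_neq0// lt0r_neq0.
Qed.

Lemma lebesgue1_itv (a b : R) : (a <= b)%R -> lebesgue1 `[a, b]%classic = (b - a)%:E.
Proof.
move=> ab; rewrite /lebesgue1 lebesgue_measure_itv/= lte_fin.
by case: ltP => // ba; rewrite (@le_anti _ _ a b) ?ab// subrr.
Qed.

Lemma lebesgue1_itvoc (a b : R) : (a <= b)%R -> lebesgue1 `]a, b]%classic = (b - a)%:E.
Proof.
move=> ab; rewrite /lebesgue1 lebesgue_measure_itv/= lte_fin.
by case: ltP => // ba; rewrite (@le_anti _ _ a b) ?ab// subrr.
Qed.

Lemma lebesgue_cube (c : d.-tuple R) (r : R) : (0 <= r)%R ->
  lebesgue R d [set x | forall i, (tnth c i - r <= tnth x i <= tnth c i + r)%R]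
  = ((2 * r) ^+ d)%:E.
Proof.
move=> r0; rewrite (_ : [set _ | _] =
    rectangle (fun i => `[(tnth c i - r)%R, (tnth c i + r)%R]%classic)); last first.
  by apply/seteqP; split => x /= h i; have := h i; rewrite /= in_itv.
rewrite [LHS]power_measure_rectangle//.
rewrite (eq_bigr (fun=> (2 * r)%:E)); last first.
  move=> i _; transitivity (((tnth c i + r) - (tnth c i - r))%:E : \bar R).
    by apply: lebesgue1_itv; lra.
  by congr EFin; lra.
by rewrite prodEFin prodr_const card_ord.
Qed.

Lemma le_enorm (x : d.-tuple R) i : (`|tnth x i| <= enorm x)%R.
Proof.
rewrite -sqrtr_sqr ler_sqrt ?sumr_ge0// => [|j _]; last by rewrite sqr_ge0.
by rewrite (bigD1 i)//= lerDl sumr_ge0// => j _; rewrite sqr_ge0.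
Qed.

Lemma enorm_le_sup (x : d.-tuple R) (r : R) : (0 <= r)%R ->
  (forall i, (`|tnth x i| <= r)%R) -> (enorm x <= d%:R * r)%R.
Proof.
move=> r0 xr; rewrite -(@ler_pXn2r _ 2)// ?nnegrE ?mulr_ge0 ?enorm_ge0//.
rewrite enorm_sqr (@le_trans _ _ (\sum_(i < d) r ^+ 2))%R//.
  apply: ler_sum => i _; rewrite -(@real_normK _ (tnth x i)) ?num_real//.
  by rewrite ler_pXn2r ?nnegrE// normr_ge0.
rewrite sumr_const card_ord exprMn -[leLHS]mulr_natl ler_wpM2r ?sqr_ge0//.
by rewrite -natrX ler_nat; case: d => // n; rewrite expnS expn1 leq_pmulr.
Qed.

Lemma lebesgue_ball_fin (c : d.-tuple R) (r : R) : (0 <= r)%R ->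
  lebesgue R d [set x | (edist x c <= r)%R] <= ((2 * r) ^+ d)%:E.
Proof.
move=> r0; rewrite -(lebesgue_cube c r0); apply: le_measure.
- rewrite inE -[X in measurable X]setTI.
  rewrite (_ : [set x | _] = (fun x => edist x c) @^-1` `]-oo, r]%classic).
    by apply: measurable_edist => //; exact: measurable_cst.
  by apply/seteqP; split => x /=; rewrite in_itv.
- rewrite inE (_ : [set _ | _] =
    rectangle (fun i => `[(tnth c i - r)%R, (tnth c i + r)%R]%classic)); last first.
    by apply/seteqP; split => x /= h i; have := h i; rewrite /= in_itv.
  exact: measurable_rectangle.
move=> x /= xc i; have := le_enorm (tsub x c) i; rewrite tnth_mktuple.
move=> /le_trans/(_ xc); rewrite ler_norml; lra.
Qed.

Lemma lebesgue_punctured_ball1_fin : lebesgue R d (punctured_ball 1) < +oo.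
Proof.
apply: (@le_lt_trans _ _ (lebesgue R d [set x | (edist x origin <= 1)%R])); last first.
  exact: (le_lt_trans (lebesgue_ball_fin _ ler01) (ltry _)).
apply: le_measure.
- by rewrite inE; exact: measurable_punctured_ball.
- rewrite inE -[X in measurable X]setTI.
  rewrite (_ : [set x | _] = (fun x => edist x origin) @^-1` `]-oo, 1%R]%classic).
    by apply: measurable_edist => //; exact: measurable_cst.
  by apply/seteqP; split => x /=; rewrite in_itv.
by move=> x /= /andP[_]; rewrite edist_origin.
Qed.

Lemma lebesgue_punctured_ball1_gt0 : (0 < d)%N -> 0 < lebesgue R d (punctured_ball 1).
Proof.
move=> d0; have d0' : (0 < d%:R :> R)%R by rewrite ltr0n.
pose C : set (d.-tuple R) := @rectangle _ R d (fun=> `]0%R, (d%:R^-1)%R]%classic).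
suff CB : lebesgue R d C <= lebesgue R d (punctured_ball 1).
  apply: lt_le_trans CB; rewrite [ltRHS]power_measure_rectangle//.
  rewrite (eq_bigr (fun=> (d%:R^-1)%:E)); last first.
    move=> i _; transitivity ((d%:R^-1 - 0)%:E : \bar R); last by rewrite subr0.
    by apply: lebesgue1_itvoc; rewrite invr_ge0 ltW.
  by rewrite prodEFin prodr_const card_ord lte_fin exprn_gt0// invr_gt0.
apply: le_measure; rewrite ?inE.
- exact: measurable_rectangle.
- exact: measurable_punctured_ball.
move=> x xh; rewrite /punctured_ball /=; apply/andP; split.
  have := xh (Ordinal d0); rewrite /= in_itv/= => /andP[h _].
  exact: lt_le_trans h (le_trans (ler_norm _) (le_enorm x (Ordinal d0))).
rewrite -(@mulfV _ (d%:R : R)) ?lt0r_neq0//; apply: enorm_le_sup.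
  by rewrite invr_ge0 ltW.
move=> i; have := xh i; rewrite /= in_itv/= => /andP[h h'].
by rewrite gtr0_norm.
Qed.

End Ball.

(** * Integrals of powers of the norm *)

Section PowerTail.
Context {R : realType}.
Local Notation mu := (@lebesgue_measure R).

Lemma cvg_powRN (c : R) : 0 < c -> t `^ (- c) @[t --> +oo] --> (0 : R).
Proof.
move=> c0; apply/cvgr0Pnorm_lt => e e0; near=> t.
have t0 : 0 < t by near: t; exact: nbhs_pinfty_gt.
rewrite ger0_norm ?powR_ge0// powRN -[ltRHS]invrK ltf_pV2 ?posrE ?invr_gt0 ?powR_gt0//.
have -> : e^-1 = (e `^ (- c^-1)) `^ c.
  by rewrite -powRrM mulNr mulVf ?lt0r_neq0// powR_inv1// ltW.
have et : e `^ (- c^-1) < t by near: t; exact: nbhs_pinfty_gt.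
by apply: gt0_ltr_powR; rewrite ?nnegrE ?powR_ge0// ltW.
Unshelve. all: by end_near. Qed.

Lemma is_derive_powRN (c t : R) : 0 < t ->
  is_derive t 1 (fun t => - t `^ (- c)) (c * t `^ (- c - 1)).
Proof.
move=> t0.
have tI : t \in `]0, +oo[%R by rewrite in_itv/= t0.
apply: DeriveDef.
  by apply: derivableN; exact: derivable_powR.
rewrite deriveN; last exact: derivable_powR.
by rewrite -derive1E powR_derive1// mulNr opprK.
Qed.

(** The antiderivative is - t^(-c), which vanishes at infinity. *)
Lemma integral_powR_tail (c a : R) : 0 < c -> 0 < a ->
  (\int[mu]_(t in `[a, +oo[) (c * t `^ (- c - 1))%:E = (a `^ (- c))%:E)%E.
Proof.
move=> c0 a0.
have der x : a < x -> is_derive x 1 (fun t => - t `^ (- c)) (c * x `^ (- c - 1)).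
  by move=> ax; apply: is_derive_powRN; exact: lt_trans ax.
have der' (e x : R) : 0 < x -> derivable (fun t : R => t `^ e) x 1.
  by move=> x0; apply: derivable_powR; rewrite in_itv/= x0.
have cont (e x : R) : 0 < x -> {for x, continuous (fun t : R => t `^ e)}.
  by move=> x0; apply: differentiable_continuous; exact/derivable1_diffP/der'.
rewrite (@ge0_continuous_FTC2y _ _ (fun t => - t `^ (- c)) a 0).
- by rewrite EFinN oppeK add0e.
- by move=> x _; rewrite mulr_ge0 ?powR_ge0// ltW.
- apply: continuous_in_subspaceT => x; rewrite inE/= in_itv/= andbT => ax.
  apply: cvgM; first exact: cvg_cst.
  by apply: cont; exact: lt_le_trans ax.
- by rewrite -[X in _ --> X]oppr0; apply: cvgN; exact: cvg_powRN.
- by move=> x /der [].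
- apply: cvg_at_right_filter; apply: cvgN; exact: cont.
- by move=> x; rewrite in_itv/= andbT => ax; rewrite derive1E; have [_ ->] := der x ax.
Qed.

End PowerTail.

Section Radial.
Context {R : realType} {d : nat}.
Local Notation mu := (@lebesgue_measure R).
Local Notation lam := (lebesgue R d).

Let measurable_pow (c e : R) (D : set R) :
  measurable_fun D (fun t : R => c * t `^ e).
Proof.
apply: measurable_funTS; apply: measurable_funM; first exact: measurable_cst.
exact: measurable_powR.
Qed.

(** Expanding t^d - r^d gives two powers, each integrated by
    [integral_powR_tail]; the difference is taken as a cancellation in a sum
    since both integrals are of nonnegative functions. *)
Lemma integral_shell_weight (b r : R) : d%:R < b -> 0 < r ->
  (\int[mu]_(t in `[r, +oo[) (b * t `^ (- b - 1) * (t ^+ d - r ^+ d))%:E =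
  (d%:R / (b - d%:R) * r `^ (d%:R - b))%:E)%E.
Proof.
move=> db r0; have b0 : 0 < b by apply: le_lt_trans db; rewrite ler0n.
set J := (LHS).
have mE (f : R -> R) : measurable_fun `[r, +oo[ f ->
    measurable_fun `[r, +oo[ (EFin \o f) by move=> ?; exact/measurable_EFinP.
have pos (t : R) : `[r, +oo[%classic t -> 0 < t.
  by rewrite /= in_itv/= andbT; exact: lt_le_trans.
have e2 : (\int[mu]_(t in `[r, +oo[) (r ^+ d * (b * t `^ (- b - 1)))%:E =
    (r `^ (d%:R - b))%:E)%E.
  under eq_integral do rewrite EFinM.
  rewrite ge0_integralZl//.
  - rewrite integral_powR_tail// -EFinM -powR_mulrn ?ltW// -powRD//.
    by rewrite lt0r_neq0// implybT.
  - by apply: mE; exact: measurable_pow.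
  - by move=> t _; rewrite lee_fin mulr_ge0 ?powR_ge0// ltW.
  - by rewrite lee_fin exprn_ge0// ltW.
have e3 : (\int[mu]_(t in `[r, +oo[) (b * t `^ (d%:R - b - 1))%:E =
    (b / (b - d%:R) * r `^ (d%:R - b))%:E)%E.
  have bd : 0 < b - d%:R by rewrite subr_gt0.
  transitivity (\int[mu]_(t in `[r, +oo[)
     ((b / (b - d%:R))%:E * ((b - d%:R) * t `^ (- (b - d%:R) - 1))%:E))%E.
    apply: eq_integral => t _; rewrite -EFinM opprB mulrA divfK//.
    exact: lt0r_neq0.
  rewrite ge0_integralZl//.
  - by rewrite integral_powR_tail// -EFinM opprB.
  - by apply: mE; exact: measurable_pow.
  - by move=> t _; rewrite lee_fin mulr_ge0 ?powR_ge0// ltW.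
  - by rewrite lee_fin divr_ge0// ltW.
have : (J + (r `^ (d%:R - b))%:E = (b / (b - d%:R) * r `^ (d%:R - b))%:E)%E.
  rewrite -e2 -e3 -ge0_integralD//.
  - apply: eq_integral => t; rewrite inE => /pos t0; rewrite -EFinD; congr EFin.
    have -> : t `^ (d%:R - b - 1) = t ^+ d * t `^ (- b - 1).
      rewrite -powR_mulrn ?ltW// -powRD ?lt0r_neq0 ?implybT//.
      by congr powR; ring.
    ring.
  - move=> t tr; have := pos t tr => t0; rewrite lee_fin mulr_ge0//.
      by rewrite mulr_ge0 ?powR_ge0// ltW.
    rewrite subr_ge0 lerXn2r ?nnegrE ?(ltW r0) ?(ltW t0)//.
    by move: tr; rewrite /= in_itv/= andbT.
  - apply: mE; apply: measurable_funM; first exact: measurable_pow.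
    apply: measurable_funB; last exact: measurable_cst.
    exact: measurable_funX.
  - by move=> t _; rewrite lee_fin mulr_ge0 ?exprn_ge0 ?mulr_ge0 ?powR_ge0 ?ltW.
  - by apply: mE; apply: measurable_funM; [exact: measurable_cst|exact: measurable_pow].
have bd : b - d%:R != 0 by rewrite lt0r_neq0// subr_gt0.
move=> h; have Jfin : J \is a fin_num.
  have : (J + (r `^ (d%:R - b))%:E)%E \is a fin_num by rewrite h.
  by rewrite fin_numD => /andP[].
move: h; rewrite -(fineK Jfin) -EFinD => -[] h; congr EFin.
apply: (@addIr _ (r `^ (d%:R - b))); rewrite h.
by field.
Qed.

Lemma lebesgue_shell (r t : R) : 0 < r -> r <= t ->
  (lam [set x | (r < enorm x <= t)%R] =
   (t ^+ d - r ^+ d)%:E * lam (punctured_ball 1))%E.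
Proof.
move=> r0 rt; have t0 : 0 < t := lt_le_trans r0 rt.
have -> : [set x | r < enorm x <= t] = punctured_ball t `\` punctured_ball r :> set (d.-tuple R).
  apply/seteqP; split => x; rewrite /punctured_ball /=.
    move=> /andP[rx xt]; rewrite xt (lt_trans r0 rx); split => //.
    by move=> /andP[_]; rewrite leNgt rx.
  move=> [/andP[x0 xt] h]; rewrite xt andbT ltNge; apply/negP => xr.
  by apply: h; rewrite x0 xr.
have fin := @lebesgue_punctured_ball1_fin R d.
have k_fin : lam (punctured_ball 1) \is a fin_num by rewrite ge0_fin_numE.
transitivity (lam (punctured_ball t) - lam (punctured_ball r))%E.
  rewrite measureD; [|exact: measurable_punctured_ball|exact: measurable_punctured_ball|].
    rewrite setIidr//.
    by move=> x; rewrite /punctured_ball /= => /andP[-> /le_trans]; apply.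
  apply: (@le_lt_trans _ _ ((t ^+ d)%:E * lam (punctured_ball 1))%E).
    by rewrite -lebesgue_punctured_ball.
  by rewrite -(fineK k_fin) -EFinM ltry.
rewrite (lebesgue_punctured_ball t0) (lebesgue_punctured_ball r0).
by rewrite -(fineK k_fin) -!EFinM -EFinB mulrBl.
Qed.

(** Layer cake: |x|^(-b) is the integral of b * t^(-b-1) over t >= |x|, and
    exchanging the integrals leaves the volume of the shell r < |x| <= t, which
    is proportional to t^d - r^d. *)
Lemma radial_integral (b r : R) : d%:R < b -> 0 < r ->
  (\int[lam]_(x in [set x | (r < enorm x)%R]) (enorm x `^ (- b))%:E =
   sphere_area R d * (r `^ (d%:R - b) / (b - d%:R))%:E)%E.
Proof.
move=> db r0; have b0 : 0 < b by apply: le_lt_trans db; rewrite ler0n.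
pose T2 := measurableTypeR R.
pose S : set (d.-tuple R * T2) := [set p | (r < enorm p.1) && (enorm p.1 <= p.2)].
pose F (p : d.-tuple R * T2) : \bar R :=
  ((b * p.2 `^ (- b - 1))%:E * (\1_S p)%:E)%E.
have mS : measurable S.
  have m1 : measurable_fun setT (fun p : d.-tuple R * T2 => enorm p.1).
    exact: (measurableT_comp measurable_enorm).
  rewrite -[X in measurable X]setTI.
  apply: (measurable_and (f := fun p : d.-tuple R * T2 => r < enorm p.1)
     (g := fun p : d.-tuple R * T2 => enorm p.1 <= p.2)) => //.
    by apply: measurable_fun_ltr => //; exact: measurable_cst.
  exact: (@measurable_fun_ler _ _ R setT (fun p : d.-tuple R * T2 => enorm p.1)
    (fun p : d.-tuple R * T2 => p.2) m1 measurable_snd).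
have mF : measurable_fun setT F.
  apply: (@emeasurable_funM _ _ _ setT
    (fun p : d.-tuple R * T2 => (b * p.2 `^ (- b - 1))%:E) (fun p => (\1_S p)%:E)).
    apply/measurable_EFinP.
    have m2 : @measurable_fun _ _ (d.-tuple R * T2)%type R setT (fun p => p.2).
      exact: measurable_snd.
    exact: (measurableT_comp (f := fun t : R => b * t `^ (- b - 1))
      (@measurable_pow b (- b - 1) setT) m2).
  by apply/measurable_EFinP; exact: measurable_indic.
have F0 p : (0 <= F p)%E.
  by rewrite mule_ge0// lee_fin mulr_ge0 ?powR_ge0// ltW.
have inner1 x : (\int[mu]_t F (x, t) =
    ((fun x => (enorm x `^ (- b))%:E) \_ [set x | (r < enorm x)%R]) x)%E.
  rewrite patchE; case: ifPn; rewrite ?inE/=.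
    move=> rx; rewrite -(integral_powR_tail b0 (lt_trans r0 rx)).
    rewrite [RHS]integral_mkcond; apply: eq_integral => t _.
    rewrite patchE /F indicE /=.
    have -> : ((x, t) \in S) = (t \in `[enorm x, +oo[%classic).
      by apply/idP/idP; rewrite !inE /S /= in_itv/= andbT rx.
    by case: ifP => _; rewrite ?mule1 ?mule0.
  move=> rx; apply: integral0_eq => t _; rewrite /F indicE memNset ?mule0//.
  by move=> /andP[/= h _]; move/negP: rx; apply; rewrite inE.
have inner2 t : (\int[lam]_x F (x, t) =
    ((fun t => (b * t `^ (- b - 1) * (t ^+ d - r ^+ d))%:E * lam (punctured_ball 1))
      \_ `[r, +oo[) t)%E.
  rewrite patchE; case: ifPn => [|tr].
    rewrite inE /= in_itv/= andbT => rt.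
    rewrite EFinM -muleA -lebesgue_shell//.
    have mSt : measurable [set x : d.-tuple R | r < enorm x <= t].
      rewrite (_ : [set _ | _] = ysection S t); first exact: measurable_ysection.
      by apply/seteqP; split => x; rewrite /ysection /= inE.
    rewrite -[RHS](@integral_cst _ _ _ lam [set x : d.-tuple R | r < enorm x <= t])//.
    rewrite [RHS]integral_mkcond; apply: eq_integral => x _; rewrite patchE /F indicE.
    have -> : ((x, t) \in S) = (x \in [set x : d.-tuple R | r < enorm x <= t]).
      by apply/idP/idP; rewrite !inE.
    by case: ifP => _; rewrite ?mule1 ?mule0.
  apply: integral0_eq => x _; rewrite /F indicE memNset ?mule0//.
  move=> /andP[/= h1 h2]; move/negP: tr; apply; rewrite inE /= in_itv/= andbT.
  by apply: ltW; exact: lt_le_trans h2.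
rewrite integral_mkcond; under eq_integral do rewrite -inner1.
rewrite (fubini_tonelli (m1 := lam) (m2 := mu))//.
under eq_integral do rewrite inner2.
rewrite -integral_mkcond ge0_integralZr//.
- rewrite integral_shell_weight// sphere_areaE [RHS]muleAC -EFinM.
  by congr (_%:E * _)%E; ring.
- apply/measurable_EFinP; apply: measurable_funM; first exact: measurable_pow.
  apply: measurable_funB; last exact: measurable_cst.
  exact: measurable_funX.
- move=> t; rewrite /= in_itv/= andbT => rt; have t0 := lt_le_trans r0 rt.
  rewrite lee_fin mulr_ge0//; first by rewrite mulr_ge0 ?powR_ge0// ltW.
  by rewrite subr_ge0 lerXn2r ?nnegrE ?(ltW r0) ?(ltW t0).
Qed.

End Radial.

(** * Measurability and translation invariance of hollow configurations *)

Section ConfigurationSets.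
Context {R : realType} {d : nat}.
Local Notation pt := (d.-tuple R).

Definition row_tuple (v : 'rV[R]_d) : pt := [tuple v ord0 i | i < d].

Lemma continuous_edist_row (c : pt) : continuous (fun v => edist (row_tuple v) c).
Proof.
rewrite (_ : (fun _ => _) =
    @Num.sqrt R \o (fun v : 'rV[R]_d => \sum_(i < d) (v ord0 i - tnth c i) ^+ 2)).
  move=> v; apply: continuous_comp; last exact: sqrt_continuous.
  move: v; elim: (index_enum _) => [|i s ih].
    rewrite (_ : (fun _ => _) = cst 0); first exact: cst_continuous.
    by apply/funext => v; rewrite big_nil.
  rewrite (_ : (fun _ => _) = (fun v : 'rV[R]_d => (v ord0 i - tnth c i) * (v ord0 i - tnth c i)
    + \sum_(j <- s) (v ord0 j - tnth c j) ^+ 2)).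
    move=> v; apply: continuousD; last exact: ih.
    apply: (@continuous_comp _ _ _ (fun v : 'rV[R]_d => v ord0 i)
      (fun x : R => (x - tnth c i) * (x - tnth c i))); first exact: coord_continuous.
    by apply: continuousM; apply: continuousB => //; exact: cst_continuous.
  by apply/funext => v; rewrite big_cons expr2.
apply/funext => v /=; rewrite /edist /enorm; congr Num.sqrt.
by apply: eq_bigr => i _; rewrite !tnth_mktuple.
Qed.

(** Approximate common points stay in a compact cube, and any cluster point of
    them is a common point because the balls are closed. *)
Lemma common_point_limit m (t : m.-tuple pt) (A : pred 'I_m) :
  (forall N : nat, exists z, forall j, A j -> edist z (tnth t j) <= 1 + N.+1%:R^-1) ->
  exists z, forall j, A j -> edist z (tnth t j) <= 1.
Proof.
move=> h; have [/existsP[j0 Aj0]|noA] := boolP [exists j, A j]; last first.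
  exists origin => j Aj; case/negP: noA; apply/existsP; by exists j.
have {h}/choice[z zP] := h.
pose u (N : nat) : 'rV[R]_d := \row_i tnth (z N) i.
have uz N : row_tuple (u N) = z N.
  by apply: eq_from_tnth => i; rewrite tnth_mktuple mxE.
pose C : set 'rV[R]_d := [set v | forall i,
   `[tnth (tnth t j0) i - 2, tnth (tnth t j0) i + 2]%classic (v ord0 i)].
have cC : compact C.
  by apply: (rV_compact (A := fun i =>
    `[tnth (tnth t j0) i - 2, tnth (tnth t j0) i + 2]%classic)) => i;
    exact: segment_compact.
have uC N : C (u N).
  move=> i /=; rewrite in_itv/= mxE.
  have := le_enorm (tsub (z N) (tnth t j0)) i; rewrite tnth_mktuple.
  move=> /le_trans/(_ (zP N j0 Aj0)).
  have : (N.+1%:R^-1 : R) <= 1 by rewrite invf_le1 ?ltr0n// ler1n.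
  by move: (N.+1%:R^-1) => a; rewrite ler_norml; lra.
have [v [Cv vcl]] : C `&` cluster (u @ \oo) !=set0.
  by apply: cC; exists 0%N => // N _; exact: uC.
exists (row_tuple v) => j Aj; apply/ler_addgt0Pr => e e0.
have [M Me] : exists M : nat, (M.+1%:R^-1 : R) < e.
  exists (Num.bound e^-1); rewrite -[ltRHS]invrK ltf_pV2 ?posrE ?invr_gt0 ?ltr0n//.
  apply: lt_trans (_ : (Num.bound e^-1)%:R < _); last by rewrite ltr_nat.
  by apply: archi_boundP; rewrite invr_ge0 ltW.
suff h : edist (row_tuple v) (tnth t j) <= 1 + M.+1%:R^-1.
  by apply: (le_trans h); rewrite lerD2l ltW.
pose S : set 'rV[R]_d := [set w | edist (row_tuple w) (tnth t j) <= 1 + M.+1%:R^-1].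
have cS : closed S.
  apply: (@preimage_closed _ _ (fun w => edist (row_tuple w) (tnth t j))
    [set x | x <= 1 + M.+1%:R^-1]); last exact: closed_le.
  by move=> w _; exact: continuous_edist_row.
move: vcl; rewrite clusterE => /(_ S) vS; suff : S v by [].
rewrite (closure_id S).1//; apply: vS.
exists M => // N /= MN; rewrite /S /= uz.
apply: (le_trans (zP N j Aj)); rewrite lerD2l lef_pV2 ?posrE ?ltr0n//.
by rewrite ler_nat ltnS.
Qed.

Lemma rational_approx (z : pt) (e : R) : 0 < e ->
  exists q : d.-tuple rat, edist [tuple ratr (tnth q i) | i < d] z <= e.
Proof.
(* d + 1 rather than d, so that the quotient makes sense for d = 0. *)
move=> e0; pose h := e / d.+1%:R.
have h0 : 0 < h by rewrite divr_gt0// ltr0n.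
have /choice[q qP] : forall i : 'I_d, exists q : rat, `|ratr q - tnth z i| <= h.
  move=> i; have [q] := @rat_in_itvoo R (tnth z i) (tnth z i + h) ltac:(by rewrite ltrDl).
  by rewrite in_itv/= => /andP[q1 q2]; exists q; rewrite ler_norml; lra.
exists [tuple q i | i < d].
have /(enorm_le_sup (ltW h0)) : forall i,
    `|tnth (tsub [tuple ratr (tnth [tuple q i | i < d] i) | i < d] z) i| <= h.
  by move=> i; rewrite !tnth_mktuple.
move=> /le_trans; apply; rewrite /h mulrCA ger_pMr// ler_pdivrMr ?ltr0n// mul1r.
by rewrite ler_nat.
Qed.

Definition common_point m (A : pred 'I_m) : set (m.-tuple pt) :=
  [set t | exists z, forall j, A j -> edist z (tnth t j) <= 1].

Let measurable_ball_at m (z : pt) (r : R) (j : 'I_m) :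
  measurable [set t : m.-tuple pt | edist z (tnth t j) <= r].
Proof.
rewrite -[X in measurable X]setTI.
rewrite (_ : [set t | _] = (fun t : m.-tuple pt => edist z (tnth t j)) @^-1` `]-oo, r]%classic).
  by apply: measurable_edist => //; exact: measurable_tnth.
by apply/seteqP; split => x /=; rewrite in_itv.
Qed.

(** By [common_point_limit] the existence of a common point can be tested with
    slack 1 / (N + 1) for all N, and with slack a rational centre suffices: only
    countable operations remain. *)
Lemma measurable_common_point m (A : pred 'I_m) : measurable (common_point A).
Proof.
pose B (N : nat) (q : d.-tuple rat) : set (m.-tuple pt) := [set t | forall j, A j ->
  edist [tuple ratr (tnth q i) | i < d] (tnth t j) <= 1 + N.+1%:R^-1].
have -> : common_point A = \bigcap_N \bigcup_q B N q.
  apply/seteqP; split => [t [z hz] N _|t h].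
    have N0 : 0 < (N.+1%:R^-1 : R) by rewrite invr_gt0 ltr0n.
    have [q qz] := rational_approx z N0; exists q => // j Aj.
    apply: le_trans (edist_triangle _ z _) _.
    by rewrite addrC; apply: lerD => //; exact: hz.
  apply: common_point_limit => N; have [q _ hq] := h N Logic.I.
  by exists [tuple ratr (tnth q i) | i < d].
apply: bigcapT_measurable => N; apply: countable_bigcupT_measurable => [|q].
  exact: countableP.
have -> : B N q = \bigcap_(j in [set j | A j]) [set t : m.-tuple pt |
    edist [tuple ratr (tnth q i) | i < d] (tnth t j) <= 1 + N.+1%:R^-1].
  by apply/seteqP; split => t h j; exact: h.
by apply: fin_bigcap_measurable => [|j _]; [exact: finite_finset|exact: measurable_ball_at].
Qed.

Lemma measurable_hollow_config m : measurable (@hollow_config R d m).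
Proof.
have -> : @hollow_config R d m =
   (\bigcap_(i in [set: 'I_m]) common_point (fun j => j != i)) `\` common_point xpredT.
  apply/seteqP; split => [t [h1 h2]|t [h1 h2]]; split.
  - by move=> i _; exact: h1.
  - by move=> [z hz]; apply: h2; exists z => j; exact: hz.
  - by move=> i; exact: h1.
  - by move=> [z hz]; apply: h2; exists z => j _; exact: hz.
apply: measurableD; last exact: measurable_common_point.
apply: fin_bigcap_measurable => // i _; exact: measurable_common_point.
Qed.

Lemma measurable_far1 r : measurable [set x : pt | r < enorm x].
Proof.
rewrite -[X in measurable X]setTI.
rewrite (_ : [set t | _] = @enorm R d @^-1` `]r, +oo[%classic).
  exact: measurable_enorm.
by apply/seteqP; split => x /=; rewrite in_itv/= andbT.
Qed.

Lemma measurable_far m r : measurable (@far R d m r).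
Proof. exact: (measurable_rectangle (fun i => measurable_far1 r)). Qed.

Lemma measurable_clustered m : measurable (@clustered R d m).
Proof.
have -> : @clustered R d m = \bigcap_(i in [set: 'I_m]) \bigcap_(j in [set: 'I_m])
    [set t | edist (tnth t i) (tnth t j) <= 6].
  apply/seteqP; split => [t h i _ j _|t h i j]; first exact: h.
  exact: (h i Logic.I j Logic.I).
apply: fin_bigcap_measurable => // i _; apply: fin_bigcap_measurable => // j _.
rewrite -[X in measurable X]setTI.
rewrite (_ : [set t | _] =
  (fun t : m.-tuple pt => edist (tnth t i) (tnth t j)) @^-1` `]-oo, 6]%classic).
  by apply: measurable_edist => //; exact: measurable_tnth.
by apply/seteqP; split => x /=; rewrite in_itv.
Qed.

Lemma edist_tadd (x y v : pt) : edist (tadd x v) (tadd y v) = edist x y.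
Proof.
rewrite /edist; congr enorm; apply: eq_from_tnth => i; rewrite !tnth_mktuple; ring.
Qed.

Lemma hollow_config_tadd m (t : m.-tuple pt) v :
  hollow_config [tuple tadd (tnth t i) v | i < m] <-> hollow_config t.
Proof.
suff h (s : m.-tuple pt) w : hollow_config s -> hollow_config [tuple tadd (tnth s i) w | i < m].
  split; last exact: h.
  move=> /(h _ [tuple - tnth v i | i < d]); congr hollow_config.
  apply: eq_from_tnth => i; rewrite !tnth_mktuple.
  by apply: eq_from_tnth => j; rewrite !tnth_mktuple addrK.
move=> [h1 h2]; split.
  move=> i; have [z hz] := h1 i; exists (tadd z w) => j ji.
  by rewrite tnth_mktuple edist_tadd; exact: hz.
move=> [z hz]; apply: h2; exists (tadd z [tuple - tnth w i | i < d]) => j.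
have := hz j; rewrite tnth_mktuple -(edist_tadd _ _ [tuple - tnth w i | i < d]).
congr (edist _ _ <= _).
by apply: eq_from_tnth => i; rewrite !tnth_mktuple addrK.
Qed.

End ConfigurationSets.

(** * Volume of the hollow configurations *)

Section HollowIndicator.
Context {R : realType} {d : nat}.
Local Notation pt := (d.-tuple R).

Lemma subtuple_setT m (t : m.-tuple pt) :
  subtuple (nth origin t) m [set: 'I_m]%SET = t.
Proof.
apply: eq_from_tnth => i; rewrite tnth_mktuple (tnth_nth origin); congr nth.
rewrite -[X in _ = X](nth_iota 0%N 0 (ltn_ord i)) -val_enum_ord.
congr (nth _ _ _); congr map; by apply: eq_enum => j; rewrite inE.
Qed.

(** For a sample of exactly m points the only candidate is the full index set. *)
Lemma count_full m (t : m.-tuple pt) (E : set (m.-tuple pt)) :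
  count_config (nth origin t) m E = `[< E t >].
Proof.
rewrite /count_config; case: asboolP => Et /=.
  rewrite (_ : finset _ = [set [set: 'I_m]]%SET) ?cards1//.
  apply/finset.setP => J; rewrite !inE; apply/andP/eqP => [[/eqP Jm _]|->].
    by apply/eqP; rewrite eqEcard cardsT card_ord Jm leqnn andbT finset.subsetT.
  by rewrite cardsT card_ord subtuple_setT; split => //; apply/asboolP.
apply/eqP; rewrite cards_eq0; apply/eqP/finset.setP => J; rewrite !inE.
apply/negP => /andP[/eqP Jm /asboolP EJ]; apply: Et.
rewrite -(subtuple_setT t); suff <- : J = [set: 'I_m]%SET by [].
by apply/eqP; rewrite eqEcard cardsT card_ord Jm leqnn andbT finset.subsetT.
Qed.

Lemma count_too_many p n m (E : set (m.-tuple pt)) : (n < m)%N -> @count_config R d p n m E = 0%N.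
Proof.
move=> nm; apply/eqP; rewrite cards_eq0; apply/eqP/finset.setP => J; rewrite !inE.
apply/negP => /andP[/eqP Jm _]; move: nm; rewrite -Jm ltnNge.
by rewrite -[X in (_ <= X)%N]card_ord max_card.
Qed.

(** With k + 3 points there is no room for larger clusters, so the two bounds on
    the Betti number by counts coincide and equal 0 or 1. *)
Lemma Tk_hollow k (t : k.+3.-tuple pt) :
  Tk k.+1 [fset x in tval t]%fset = (`[< hollow_config t >])%:R :> R.
Proof.
set Y := [fset x in tval t]%fset; set p := nth origin t.
have YP x : x \in Y <-> exists2 i : 'I_k.+3, p i = x & -1 < enorm x.
  rewrite /Y inE; split => [/tnthP[i ->]|[i <- _]].
    by exists i; rewrite /p -?tnth_nth// (lt_le_trans _ (enorm_ge0 _))// ltrN10.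
  by rewrite /p -tnth_nth mem_tnth.
have far1 : far (-1) t by move=> i; rewrite (lt_le_trans _ (enorm_ge0 _))// ltrN10.
have far1' : far (-3) t.
  by move=> i; rewrite (lt_le_trans _ (enorm_ge0 _))// oppr_lt0.
have up := betti_le_count YP k; rewrite (count_too_many _ _ (ltnSn _)) muln0 addn0 count_full in up.
rewrite /Tk; congr ((nat_of_bool _)%:R); apply/idP/idP.
  move=> /andP[_ /eqP b1]; move: up; rewrite b1 lt0b.
  by move=> /asboolP[h _]; apply/asboolP.
move=> /asboolP ht; apply/andP; split.
  rewrite /Y card_fseq undup_id ?size_tuple//.
  apply/tuple_uniqP; exact: hollow_config_inj.
rewrite eqn_leq (leq_trans up (leq_b1 _)) /=.
apply: leq_trans (betti_ge_count YP k (lexx _)).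
rewrite /count_isolated card_gt0; apply/set0Pn; exists [set: 'I_k.+3]%SET.
rewrite inE cardsT card_ord eqxx /=; apply/asboolP; split.
  by rewrite subtuple_setT; split.
by move=> i; rewrite inE.
Qed.

Lemma Tk0_hollow k (y : k.+2.-tuple pt) :
  Tk0 y = (\1_(@hollow_config R d k.+3) [tuple of origin :: y] : R).
Proof.
rewrite /Tk0 -[(origin :: y)]/(tval [tuple of origin :: y]) Tk_hollow indicE.
by [].
Qed.

End HollowIndicator.

Section SimplexVectors.
Context {R : realType} {d : nat}.
Implicit Types x y z : 'I_d -> R.

Definition dot x y : R := \sum_a x a * y a.

Lemma dotC x y : dot x y = dot y x.
Proof. by apply: eq_bigr => a _; rewrite mulrC. Qed.

Lemma dot_lin (b c : R) x y z : dot (fun a => b * x a + c * y a) z = b * dot x z + c * dot y z.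
Proof. by rewrite /dot !mulr_sumr -big_split /=; apply: eq_bigr => a _; ring. Qed.

Lemma dot_linr (b c : R) x y z : dot z (fun a => b * x a + c * y a) = b * dot z x + c * dot z y.
Proof. by rewrite dotC dot_lin ![dot _ z]dotC. Qed.

Variable m : nat.
Hypotheses (m0 : (0 < m)%N) (md : (m <= d)%N).

Let unit_vec (i : nat) (a : 'I_d) : R := (a == i :> nat)%:R.
Let ones (a : 'I_d) : R := (a < m)%N%:R.

Let dot_unit_vec i x (id : (i < d)%N) : dot (unit_vec i) x = x (Ordinal id).
Proof.
rewrite /dot (bigD1 (Ordinal id))//= /unit_vec eqxx mul1r big1 ?addr0// => a ai.
by rewrite (_ : (a == i :> nat) = false) ?mul0r//; apply: contraNF ai => /eqP ai; apply/eqP/val_inj.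
Qed.

Let dot_ones : dot ones ones = m%:R.
Proof.
rewrite /dot (eq_bigr (fun a : 'I_d => if (a < m)%N then 1 else 0)); last first.
  by move=> a _; rewrite /ones; case: (a < m)%N; rewrite ?mulr1 ?mulr0.
by rewrite -big_mkcond /= -(big_ord_widen d (fun=> 1) md) sumr_const card_ord.
Qed.

(** For i < m these are the coordinate vectors e_i shifted by -(1, ..., 1) / (2m);
    the last one is -(1, ..., 1) / 2.  They sum to 0, and all pairwise inner
    products are negative, as for the vertices of a simplex around its centre.
    Only the first m coordinates of R^d are used. *)
Definition simplex_vec (i : 'I_m.+1) (a : 'I_d) : R :=
  (i < m)%N%:R * unit_vec i a + (- (if (i < m)%N then (2 * m%:R)^-1 else 2^-1)) * ones a.

Lemma simplex_vec_obtuse i j : i != j -> dot (simplex_vec i) (simplex_vec j) < 0.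
Proof.
move=> ij; rewrite /simplex_vec !(dot_lin, dot_linr) dot_ones.
have mR : 0 < (m%:R : R) by rewrite ltr0n.
have e_ones k : (k < m)%N -> dot (unit_vec k) ones = 1.
  by move=> km; rewrite (dot_unit_vec _ (leq_trans km md)) /ones /= km.
have ones_e k : (k < m)%N -> dot ones (unit_vec k) = 1.
  by move=> km; rewrite dotC e_ones.
have [im|im] := ltnP i m; have [jm|jm] := ltnP j m.
- rewrite !e_ones ?ones_e// (dot_unit_vec _ (leq_trans im md)) /unit_vec /=.
  rewrite (_ : (i == j :> nat) = false); last exact: negbTE.
  have -> : 1 * (1 * false%:R + - (2 * m%:R)^-1 * 1) + - (2 * m%:R)^-1 * (1 * 1 + - (2 * m%:R)^-1 * m%:R)
     = - (3 / 4) * (m%:R^-1 : R) by rewrite mulr0n; field; exact: lt0r_neq0.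
  by rewrite nmulr_rlt0 ?invr_gt0//; lra.
- rewrite e_ones// !mul0r.
  have -> : 1 * (0 + - 2^-1 * 1) + - (2 * m%:R)^-1 * (0 + - 2^-1 * m%:R) = - 4^-1 :> R
    by field; exact: lt0r_neq0.
  by rewrite oppr_lt0 invr_gt0.
- rewrite ones_e// !mul0r.
  have -> : 0 + - 2^-1 * (1 * 1 + - (2 * m%:R)^-1 * m%:R) = - 4^-1 :> R
    by field; exact: lt0r_neq0.
  by rewrite oppr_lt0 invr_gt0.
- case/eqP: ij; apply/val_inj => /=.
  by have := ltn_ord i; have := ltn_ord j; lia.
Qed.

Lemma simplex_vec_norm_gt0 i : 0 < dot (simplex_vec i) (simplex_vec i).
Proof.
rewrite /simplex_vec !(dot_lin, dot_linr) dot_ones.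
have mR : 1 <= (m%:R : R) by rewrite ler1n.
have mn0 : (m%:R : R) != 0 by rewrite pnatr_eq0 -lt0n.
have [im|im] := ltnP i m.
  have e_ones : dot (unit_vec i) ones = 1.
    by rewrite (dot_unit_vec _ (leq_trans im md)) /ones /= im.
  rewrite [dot ones _]dotC e_ones (dot_unit_vec _ (leq_trans im md)) /unit_vec /= eqxx.
  have -> : 1 * (1 * 1 + - (2 * m%:R)^-1 * 1) + - (2 * m%:R)^-1 * (1 * 1 + - (2 * m%:R)^-1 * m%:R)
     = 1 - (3 / 4) * (m%:R^-1 : R) by field.
  have : (m%:R^-1 : R) <= 1 by rewrite invf_le1// (lt_le_trans ltr01).
  lra.
rewrite !mul0r; have -> : 0 + - 2^-1 * (0 + - 2^-1 * m%:R) = m%:R / 4 :> R by field.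
by rewrite divr_gt0// (lt_le_trans ltr01).
Qed.

Lemma sum_simplex_vec a : \sum_i simplex_vec i a = 0.
Proof.
have mn0 : (m%:R : R) != 0 by rewrite pnatr_eq0 -lt0n.
rewrite big_ord_recr /= /simplex_vec /= ltnn mul0r add0r.
rewrite (eq_bigr (fun i : 'I_m => unit_vec i a - (2 * m%:R)^-1 * ones a)); last first.
  by move=> i _; rewrite /= ltn_ord mul1r mulNr.
rewrite big_split /= sumrN sumr_const card_ord -mulr_natl.
have -> : \sum_(i < m) unit_vec i a = ones a.
  rewrite /ones; case: (ltnP a m) => am.
    rewrite (bigD1 (Ordinal am))//= /unit_vec eqxx big1 ?addr0// => i ia.
    rewrite (_ : (a == i :> nat) = false)//; apply: contraNF ia => /eqP ai.
    exact/eqP/val_inj.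
  rewrite big1// => i _; rewrite /unit_vec (_ : (a == i :> nat) = false)//.
  by apply/negbTE; rewrite neq_ltn (leq_trans (ltn_ord i) am) orbT.
by field.
Qed.

End SimplexVectors.

Section HollowNeighbourhood.
Context {R : realType} {d : nat}.
Local Notation pt := (d.-tuple R).

Lemma positive_lower_bound (I : finType) (P : pred I) (f : I -> R) :
  (forall i, P i -> 0 < f i) -> exists2 c, 0 < c <= 1 & forall i, P i -> c <= f i.
Proof.
move=> f0; pose S := 1 + \sum_(i | P i) (f i)^-1.
have S0 : 0 <= \sum_(i | P i) (f i)^-1.
  by apply: sumr_ge0 => i /f0/ltW; rewrite invr_ge0.
have S1 : 1 <= S by rewrite /S lerDl.
exists S^-1; first by rewrite invr_gt0 (lt_le_trans ltr01)//= invf_le1// (lt_le_trans ltr01).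
move=> i Pi; have fi := f0 i Pi.
rewrite -[leRHS]invrK lef_pV2 ?posrE ?invr_gt0// ?(lt_le_trans ltr01)//.
rewrite /S (bigD1 i)//= addrCA lerDl addr_ge0// sumr_ge0// => j /andP[/f0/ltW + _].
by rewrite invr_ge0.
Qed.

Lemma edist_sqr (x y : pt) : edist x y ^+ 2 =
  dot (tnth x) (tnth x) - 2 * dot (tnth x) (tnth y) + dot (tnth y) (tnth y).
Proof.
rewrite enorm_sqr /dot mulr_sumr -sumrB -big_split /=.
by apply: eq_bigr => i _; rewrite tnth_mktuple; ring.
Qed.

(** Put the points at p_i = rho * u_i with u_i of norm 1 in the direction of q_i
    and rho slightly larger than 1.  A weighted mean of the u_i is 0, so for every
    z the same mean of the squared distances |z - p_i|^2 is |z|^2 + rho^2 > 1: the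
    balls have no common point.  Moving from 0 in the direction opposite to u_i
    brings z closer to all the other p_j, because the inner products are
    negative: the balls other than the i-th meet.  Both properties hold with room
    to spare, hence for all nearby tuples. *)
Lemma hollow_neighbourhood n (q : 'I_n -> 'I_d -> R) : (0 < n)%N ->
  (forall i j, i != j -> dot (q i) (q j) < 0) ->
  (forall i, 0 < dot (q i) (q i)) -> (forall a, \sum_i q i a = 0) ->
  exists (p : 'I_n -> pt) (e : R), 0 < e /\
    forall t : n.-tuple pt, (forall i, edist (tnth t i) (p i) <= e) -> hollow_config t.
Proof.
move=> n0 q_lt0 q_gt0 q_sum.
pose l i := Num.sqrt (dot (q i) (q i)).
have l0 i : 0 < l i by rewrite sqrtr_gt0.
have l2 i : l i ^+ 2 = dot (q i) (q i) by rewrite sqr_sqrtr// ltW.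
have scale_dot (b c : R) x y : dot (fun a => b * x a) (fun a => c * y a) = b * c * dot x y.
  by rewrite /dot mulr_sumr; apply: eq_bigr => a _; ring.
have scale_dotr (c : R) (x y : 'I_d -> R) : dot x (fun a => c * y a) = c * dot x y.
  by rewrite /dot mulr_sumr; apply: eq_bigr => a _; ring.
pose u i a := (l i)^-1 * q i a.
have u1 i : dot (u i) (u i) = 1.
  by rewrite scale_dot -l2; field; rewrite lt0r_neq0.
have [c /andP[c0 c1] cu] : exists2 c, 0 < c <= 1 &
    forall p : 'I_n * 'I_n, p.1 != p.2 -> c <= - dot (u p.1) (u p.2).
  apply: (positive_lower_bound (P := fun p : 'I_n * 'I_n => p.1 != p.2)).
  move=> [i j] /= ij; rewrite oppr_gt0 scale_dot pmulr_rlt0 ?mulr_gt0 ?invr_gt0//.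
  exact: q_lt0.
have dot_u x i : dot x (u i) = (l i)^-1 * dot x (q i) by exact: scale_dotr.
clearbody u.
(* The radius excess de is small compared with the square of the gain c. *)
pose de := c ^+ 2 / 4; pose rho := 1 + de; pose e := de / 2.
have de0 : 0 < de by rewrite divr_gt0// exprn_gt0.
have e0 : 0 < e by rewrite divr_gt0.
have dec : 4 * de = c ^+ 2 by rewrite /de; field.
have de1 : de <= 4^-1.
  have : c ^+ 2 <= 1 by rewrite expr_le1// ltW.
  by move: dec; lra.
have e2 : e * 2 = de by rewrite /e; field.
pose p i : pt := [tuple rho * u i a | a < d].
have pE i : tnth (p i) = fun a => rho * u i a.
  by apply/funext => a; rewrite tnth_mktuple.
exists p, e; split => // t tp; split.
  move=> i; exists [tuple (- c) * u i a | a < d] => j ji.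
  set z := mktuple _; have zE : tnth z = fun a => (- c) * u i a.
    by apply/funext => a; rewrite tnth_mktuple.
  suff zp : edist z (p j) <= 1 - e.
    apply: (le_trans (edist_triangle _ (p j) _)).
    by have := tp j; rewrite edistC; move: zp; lra.
  rewrite -(@ler_pXn2r _ 2)// ?nnegrE ?enorm_ge0//; last by lra.
  rewrite edist_sqr zE pE !scale_dot !u1.
  have := cu (i, j); rewrite /= eq_sym => /(_ ji) cij.
  have rho1 : 1 <= rho by rewrite /rho lerDl ltW.
  have crc : c * rho * c <= c * rho * - dot (u i) (u j).
    by rewrite ler_wpM2l// mulr_ge0// ?ltW// (lt_le_trans ltr01).
  have ccr : c * c <= c * rho * c.
    by rewrite ler_wpM2r ?ler_peMr// ltW.
  have cc : c * c = 4 * de by rewrite -expr2 dec.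
  have dd : de * de <= 4^-1 * de by rewrite ler_wpM2r// ltW.
  have ee : e * e = de * de / 4 by rewrite /e; field.
  have dede : 0 <= de * de by rewrite mulr_ge0 ?ltW.
  have -> : (1 - e) ^+ 2 = 1 - de + de * de / 4 by rewrite -ee -e2; ring.
  (* Squared distance from - c * u_i to p_j, written in terms of the excess. *)
  have -> : - c * - c * 1 - 2 * (- c * rho * dot (u i) (u j)) + rho * rho * 1
     = c * c - 2 * (c * rho * - dot (u i) (u j)) + (1 + 2 * de + de * de).
    by rewrite /rho; ring.
  move: crc ccr; set X := c * rho * _; set Y := c * rho * c => ? ?.
  lra.
move=> [z hz].
have zp i : edist z (p i) ^+ 2 <= (1 + e) ^+ 2.
  rewrite ler_pXn2r ?nnegrE ?enorm_ge0//; last by lra.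
  apply: (le_trans (edist_triangle _ (tnth t i) _)); apply: lerD; first exact: hz.
  exact: tp.
have L0 : 0 < \sum_i l i.
  rewrite (bigD1 (Ordinal n0))//= ltr_pwDl// sumr_ge0// => i _; exact: ltW.
(* The weights l i make the mean of the directions u_i vanish. *)
have : \sum_i l i * edist z (p i) ^+ 2 <= (\sum_i l i) * (1 + e) ^+ 2.
  by rewrite mulr_suml; apply: ler_sum => i _; rewrite ler_wpM2l// ltW.
have -> : \sum_i l i * edist z (p i) ^+ 2 =
    (\sum_i l i) * (dot (tnth z) (tnth z) + rho ^+ 2).
  rewrite (eq_bigr (fun i => l i * (dot (tnth z) (tnth z) + rho ^+ 2)
      - 2 * rho * dot (tnth z) (q i))); last first.
    move=> i _; rewrite edist_sqr pE scale_dot u1 scale_dotr.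
    rewrite dot_u; by field; exact: lt0r_neq0.
  rewrite big_split /= -mulr_suml sumrN -mulr_sumr.
  rewrite (_ : \sum_i dot _ _ = 0) ?mulr0 ?subr0//.
  rewrite /dot exchange_big /= big1// => a _.
  by rewrite -mulr_sumr q_sum mulr0.
rewrite ler_pM2l//.
have zz : 0 <= dot (tnth z) (tnth z).
  by apply: sumr_ge0 => a _; rewrite -expr2 sqr_ge0.
have : (1 + e) ^+ 2 < rho ^+ 2.
  rewrite ltr_pXn2r ?nnegrE//; last first.
  - by rewrite /rho; lra.
  - by lra.
  by rewrite /rho; lra.
by lra.
Qed.

(** After translating the first point to the origin, the neighbourhood given by
    [hollow_neighbourhood] contains a product of cubes. *)
Lemma hollow_volume_gt0 k : (k.+2 <= d)%N ->
  (0 < power_measure (lebesgue R d) k.+2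
     [set y : k.+2.-tuple pt | @hollow_config R d k.+3 [tuple of origin :: y]])%E.
Proof.
move=> kd.
have [p [e [e0 hp]]] := @hollow_neighbourhood k.+3 (@simplex_vec R d k.+2) isT
  (@simplex_vec_obtuse R d k.+2 isT kd) (@simplex_vec_norm_gt0 R d k.+2 isT kd)
  (@sum_simplex_vec R d k.+2 isT).
pose r := e / d.+1%:R.
have r0 : 0 < r by rewrite divr_gt0// ltr0n.
pose c (i : 'I_k.+2) : pt := tsub (p (lift ord0 i)) (p ord0).
pose C (i : 'I_k.+2) : set pt := [set x | forall a, tnth (c i) a - r <= tnth x a <= tnth (c i) a + r].
have mC i : measurable (C i).
  rewrite (_ : C i = rectangle (fun a => `[(tnth (c i) a - r)%R, (tnth (c i) a + r)%R]%classic)).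
    exact: measurable_rectangle.
  by apply/seteqP; split => x /= h a; have := h a; rewrite /= in_itv.
apply: (@lt_le_trans _ _ (power_measure (lebesgue R d) k.+2 (rectangle C))).
  rewrite power_measure_rectangle//.
  rewrite (eq_bigr (fun=> ((2 * r) ^+ d)%:E)); last first.
    by move=> i _; apply: lebesgue_cube; exact: ltW.
  by rewrite prodEFin lte_fin prodr_const exprn_gt0// exprn_gt0// mulr_gt0.
apply: le_measure; rewrite ?inE.
- exact: measurable_rectangle.
- by apply: measurable_section; exact: measurable_hollow_config.
move=> y yC; apply: (hollow_config_tadd [tuple of origin :: y] (p ord0)).1.
apply: hp => i; rewrite tnth_mktuple; have [j ->|->] := unliftP ord0 i; last first.
  rewrite (_ : tadd _ _ = p ord0) ?edistxx ?ltW//.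
  by apply: eq_from_tnth => a; rewrite !tnth_mktuple add0r.
rewrite tnthS /edist.
have /(enorm_le_sup (ltW r0)) : forall a,
    `|tnth (tsub (tadd (tnth [tuple of y] j) (p ord0)) (p (lift ord0 j))) a| <= r.
  move=> a; rewrite !tnth_mktuple ler_norml.
  have := yC j a; rewrite !tnth_mktuple.
  rewrite (_ : tnth [tuple of y] j = tnth y j)//; last by rewrite !(tnth_nth origin).
  by lra.
move=> /le_trans; rewrite (_ : tnth [tuple of y] j = tnth y j)//; last by rewrite !(tnth_nth origin).
apply; rewrite /r mulrCA ger_pMr// ler_pdivrMr ?ltr0n// mul1r.
by rewrite ler_nat.
Qed.

Lemma hollow_volume_fin k :
  (power_measure (lebesgue R d) k.+2
     [set y : k.+2.-tuple pt | @hollow_config R d k.+3 [tuple of origin :: y]] < +oo)%E.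
Proof.
pose B : set pt := [set x | edist x origin <= 2].
have mB : measurable B.
  rewrite -[X in measurable X]setTI.
  rewrite (_ : B = (fun x => edist x origin) @^-1` `]-oo, 2]%classic).
    by apply: measurable_edist => //; exact: measurable_cst.
  by apply/seteqP; split => x /=; rewrite /B /= in_itv.
apply: (@le_lt_trans _ _ (power_measure (lebesgue R d) k.+2 (rectangle (fun=> B)))).
  apply: le_measure; rewrite ?inE.
  - by apply: measurable_section; exact: measurable_hollow_config.
  - exact: measurable_rectangle.
  move=> y /= hy i.
  have := @hollow_config_le2 R d k.+3 _ isT hy (lift ord0 i) ord0.
  by rewrite tnthS.
rewrite power_measure_rectangle//.
have Bfin : lebesgue R d B \is a fin_num.
  rewrite ge0_fin_numE//; apply: (le_lt_trans (lebesgue_ball_fin _ _)) => //.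
  exact: ltry.
by rewrite -(fineK Bfin) prodEFin ltry.
Qed.

End HollowNeighbourhood.

(** * Probability of configurations and clusters far from the origin *)

Section PowerLawBounds.
Context {R : realType} {d : nat}.
Variables (alpha cp : R).
Hypotheses (d_gt0 : (0 < d)%N) (d_alpha : d%:R < alpha) (cp0 : 0 < cp).
Local Notation pt := (d.-tuple R).
Local Notation lam := (lebesgue R d).
Local Notation f := (@power_density R d alpha cp).
Variable nu : {sigma_finite_measure set pt -> \bar R}.
Hypothesis nuE : forall A, measurable A -> nu A = (\int[lam]_(x in A) (f x)%:E)%E.

Definition sphere_area_real : R := fine (sphere_area R d).

Lemma sphere_area_fin : sphere_area R d \is a fin_num.
Proof.
rewrite sphere_areaE fin_numM// ge0_fin_numE//; exact: lebesgue_punctured_ball1_fin.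
Qed.

Lemma area_gt0 : 0 < sphere_area_real.
Proof.
rewrite -lte_fin /sphere_area_real fineK ?sphere_area_fin// sphere_areaE.
by rewrite mule_gt0 ?lte_fin ?ltr0n//; exact: lebesgue_punctured_ball1_gt0.
Qed.

Lemma alpha_gt0 : 0 < alpha.
Proof. by apply: le_lt_trans d_alpha; rewrite ler0n. Qed.

Lemma density_ge0 x : 0 <= f x.
Proof. by rewrite divr_ge0 ?addr_ge0 ?powR_ge0// ltW. Qed.

Lemma measurable_density : measurable_fun setT f.
Proof.
rewrite (_ : f = fun x : pt => cp * (1 + enorm x `^ alpha) `^ (-1)); last first.
  by apply/funext => x; rewrite powR_inv1// addr_ge0// powR_ge0.
apply: measurable_funM; first exact: measurable_cst.
apply: (measurableT_comp (f := fun t : R => t `^ (-1)) (measurable_powR (-1))).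
apply: measurable_funD; first exact: measurable_cst.
exact: (measurableT_comp (f := fun t : R => t `^ alpha) (measurable_powR alpha) measurable_enorm).
Qed.

Lemma density_le (x : pt) (r : R) : 0 < r -> r <= enorm x -> f x <= cp * r `^ (- alpha).
Proof.
move=> r0 rx; rewrite /power_density ler_wpM2l ?(ltW cp0)// powRN.
rewrite lef_pV2 ?posrE ?powR_gt0//; last by rewrite ltr_wpDr ?powR_ge0.
apply: (@le_trans _ _ (enorm x `^ alpha)); last by rewrite lerDr ler01.
by apply: ge0_ler_powR; rewrite ?nnegrE ?enorm_ge0 ?(ltW alpha_gt0) ?(ltW r0).
Qed.

(** The loss in bounding 1 + |y|^alpha by a multiple of |x|^alpha when |x| >= r
    and |y| <= |x| + 2; it tends to 1 as r grows. *)
Definition slack (r : R) : R := (r `^ (- alpha) + (1 + 2 / r) `^ alpha)^-1.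

Lemma slack_gt0 r : 0 < r -> 0 < slack r.
Proof.
move=> r0; rewrite invr_gt0 ltr_pwDl ?powR_gt0//.
exact: powR_ge0.
Qed.

Lemma density_ge (x y : pt) (r : R) : 0 < r -> r <= enorm x -> enorm y <= enorm x + 2 ->
  cp * slack r * enorm x `^ (- alpha) <= f y.
Proof.
move=> r0 rx yx; have x0 : 0 < enorm x by apply: lt_le_trans rx.
have a0 := alpha_gt0.
rewrite /power_density -mulrA ler_wpM2l ?(ltW cp0)// /slack [enorm x `^ _]powRN -invfM.
have D0 : 0 < r `^ (- alpha) + (1 + 2 / r) `^ alpha.
  by rewrite ltr_pwDl ?powR_gt0// powR_ge0.
rewrite lef_pV2 ?posrE ?mulr_gt0 ?powR_gt0//; last by rewrite ltr_wpDr ?powR_ge0.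
rewrite mulrDl; apply: lerD.
  rewrite powRN mulrC ler_pdivlMr ?powR_gt0// mul1r.
  by apply: ge0_ler_powR; rewrite ?nnegrE ?enorm_ge0// ?(ltW a0) ?(ltW r0).
rewrite -powRM ?enorm_ge0//; last by rewrite addr_ge0// divr_ge0// ltW.
apply: ge0_ler_powR; rewrite ?nnegrE ?enorm_ge0//; first exact: ltW.
  by rewrite mulr_ge0 ?enorm_ge0// addr_ge0// divr_ge0// ltW.
apply: (le_trans yx); rewrite mulrDl mul1r lerD2l mulrAC ler_pdivlMr//.
by rewrite ler_wpM2l.
Qed.

Lemma integral_far (C b r : R) : 0 <= C -> d%:R < b -> 0 < r ->
  (\int[lam]_x ((fun x : pt => (C * enorm x `^ (- b))%:E) \_ [set x | (r < enorm x)%R]) x =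
   (C * sphere_area_real * r `^ (d%:R - b) / (b - d%:R))%:E)%E.
Proof.
move=> C0 db r0; rewrite -integral_mkcond.
under eq_integral do rewrite EFinM.
rewrite ge0_integralZl//.
- by rewrite radial_integral// -(fineK sphere_area_fin) -!EFinM -/sphere_area_real !mulrA.
- exact: measurable_far1.
- apply/measurable_EFinP/measurable_funTS.
  exact: (measurableT_comp (f := fun t : R => t `^ (- b)) (measurable_powR _) measurable_enorm).
- by move=> x _; rewrite lee_fin powR_ge0.
Qed.

Lemma measurable_pow_far (C b r : R) : measurable_fun setT
  ((fun x : pt => (C * enorm x `^ (- b))%:E) \_ [set x | (r < enorm x)%R]).
Proof.
apply/(measurable_restrictT _ _).1; first exact: measurable_far1.
apply/measurable_EFinP/measurable_funTS; apply: measurable_funM; first exact: measurable_cst.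
exact: (measurableT_comp (f := fun t : R => t `^ (- b)) (measurable_powR _) measurable_enorm).
Qed.

(** The first coordinate is integrated by [radial_integral], so a pointwise bound
    of the section by a power of the norm is enough. *)
Lemma power_nu_le n (B : set (n.+1.-tuple pt)) (C b r : R) :
  0 <= C -> d%:R < b -> 0 < r -> measurable B ->
  (forall x, ~ r < enorm x -> [set t : n.-tuple pt | B [tuple of x :: t]] = set0) ->
  (forall x, r < enorm x ->
    (power_measure nu n [set t : n.-tuple pt | B [tuple of x :: t]] * (f x)%:E <=
     (C * enorm x `^ (- b))%:E)%E) ->
  (power_measure nu n.+1 B <= (C * sphere_area_real * r `^ (d%:R - b) / (b - d%:R))%:E)%E.
Proof.
move=> C0 db r0 mB out inn; rewrite -integral_far// power_measureS.
have mS := measurable_fun_section nu mB.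
rewrite (integral_density (mu := lam) measurable_density density_ge0 nuE)//.
apply: ge0_le_integral => //.
- by move=> x _; apply: mule_ge0 => //; rewrite lee_fin density_ge0.
- by apply: emeasurable_funM => //; apply/measurable_EFinP; exact: measurable_density.
- exact: measurable_pow_far.
move=> x _; rewrite patchE; case: ifPn; rewrite ?inE /=; first exact: inn.
by move=> rx; rewrite out ?measure0 ?mul0e// => h; case/negP: rx; rewrite inE.
Qed.

Lemma power_nu_ge n (B : set (n.+1.-tuple pt)) (C b r : R) :
  0 <= C -> d%:R < b -> 0 < r -> measurable B ->
  (forall x, r < enorm x ->
    ((C * enorm x `^ (- b))%:E <=
     power_measure nu n [set t : n.-tuple pt | B [tuple of x :: t]] * (f x)%:E)%E) ->
  ((C * sphere_area_real * r `^ (d%:R - b) / (b - d%:R))%:E <= power_measure nu n.+1 B)%E.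
Proof.
move=> C0 db r0 mB inn; rewrite -integral_far// power_measureS.
have mS := measurable_fun_section nu mB.
rewrite (integral_density (mu := lam) measurable_density density_ge0 nuE)//.
have pos x : (0 <= power_measure nu n [set t : n.-tuple pt | B [tuple of x :: t]] * (f x)%:E)%E.
  by apply: mule_ge0 => //; rewrite lee_fin density_ge0.
apply: ge0_le_integral => //.
- by move=> x _; rewrite patchE; case: ifP => // _; rewrite lee_fin mulr_ge0 ?powR_ge0.
- exact: measurable_pow_far.
- by apply: emeasurable_funM => //; apply/measurable_EFinP; exact: measurable_density.
by move=> x _; rewrite patchE; case: ifPn => // /[!inE] /=; exact: inn.
Qed.

Lemma measurable_eball (x : pt) (r : R) : measurable [set y | edist y x <= r].
Proof.
rewrite -[X in measurable X]setTI.
rewrite (_ : [set y | _] = (fun y => edist y x) @^-1` `]-oo, r]%classic).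
  by apply: measurable_edist => //; exact: measurable_cst.
by apply/seteqP; split => y /=; rewrite in_itv.
Qed.

(** Given the first point, each of the n others lies in a ball of radius 6 on which
    the density is at most cp * r^(-alpha).  The volume of that ball is at most
    12^d, that of a cube. *)
Lemma clustered_bound n (r : R) : 0 < r ->
  (power_measure nu n.+1 (@clustered R d n.+1 `&` @far R d n.+1 r) <=
   ((cp * 12 ^+ d) ^+ n * cp * sphere_area_real / (alpha - d%:R) *
     (r `^ (- alpha) ^+ n * r `^ (d%:R - alpha)))%:E)%E.
Proof.
move=> r0; pose c := cp * r `^ (- alpha) * 12 ^+ d.
have c0 : 0 <= c by rewrite !mulr_ge0 ?powR_ge0 ?exprn_ge0// ltW.
have -> : (cp * 12 ^+ d) ^+ n * cp * sphere_area_real / (alpha - d%:R) *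
     (r `^ (- alpha) ^+ n * r `^ (d%:R - alpha)) =
   (c ^+ n * cp) * sphere_area_real * r `^ (d%:R - alpha) / (alpha - d%:R).
  have -> : c ^+ n = (cp * 12 ^+ d) ^+ n * r `^ (- alpha) ^+ n.
    by rewrite /c mulrAC exprMn.
  by move: (_ ^+ n) (_ ^+ n) => a a'; ring.
have mB : measurable (@clustered R d n.+1 `&` @far R d n.+1 r).
  by apply: measurableI; [exact: measurable_clustered|exact: measurable_far].
apply: power_nu_le => //; first by rewrite mulr_ge0 ?exprn_ge0// ltW.
  by move=> x xr; apply/seteqP; split => // t /= [_ /(_ ord0)].
move=> x rx.
pose W : set pt := [set y | edist y x <= 6] `&` [set y | r < enorm y].
have mW : measurable W by apply: measurableI; [exact: measurable_eball|exact: measurable_far1].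
have nuW : (nu W <= c%:E)%E.
  rewrite nuE//; apply: (@le_trans _ _ (\int[lam]_(y in W) (cp * r `^ (- alpha))%:E)%E).
    apply: ge0_le_integral => //.
    - by move=> y _; rewrite lee_fin density_ge0.
    - by apply/measurable_EFinP/measurable_funTS; exact: measurable_density.
    - by move=> y [_ /= ry]; rewrite lee_fin density_le// ltW.
  rewrite integral_cst// /c [leRHS]EFinM lee_wpmul2l//.
    by rewrite lee_fin mulr_ge0 ?powR_ge0// ltW.
  apply: (@le_trans _ _ (lam [set y | edist y x <= 6])).
    by apply: le_measure; rewrite ?inE//; [exact: measurable_eball|move=> y []].
  apply: (le_trans (lebesgue_ball_fin _ _)) => //.
  by rewrite (_ : 2 * 6 = 12 :> R)//; ring.
rewrite -mulrA [leRHS]EFinM; apply: lee_pmul => //.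
- by rewrite lee_fin density_ge0.
- apply: (@le_trans _ _ (power_measure nu n (rectangle (fun=> W)))).
    apply: le_measure; rewrite ?inE.
    + exact: measurable_section.
    + exact: measurable_rectangle.
    + move=> t /= [tc tf] i; split => /=.
        by have := tc (lift ord0 i) ord0; rewrite tnthS.
      by have := tf (lift ord0 i); rewrite tnthS.
  rewrite power_measure_rectangle//.
  apply: (@le_trans _ _ (\prod_(i < n) c%:E)%E); last first.
    by rewrite prodEFin prodr_const card_ord.
  suff [] : (0 <= \prod_(i < n) nu W /\ \prod_(i < n) nu W <= \prod_(i < n) c%:E)%E by [].
  elim/big_ind2 : _ => // x1 x2 y1 y2 [a1 a2] [b1 b2].
  by split; [exact: mule_ge0|exact: lee_pmul].
- by rewrite lee_fin; apply: density_le => //; exact: lt_trans rx.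
Qed.

Lemma density_le_cp x : f x <= cp.
Proof.
rewrite /power_density ler_pdivrMr ?ltr_wpDr ?powR_ge0//.
by rewrite ler_peMr ?(ltW cp0)// lerDl powR_ge0.
Qed.

Lemma powRN_expS (x : R) m :
  x `^ (- alpha) ^+ m * x `^ (- alpha) = x `^ (- (alpha * m.+1%:R)).
Proof. by rewrite -exprSr -powR_mulrn ?powR_ge0// -powRrM mulNr. Qed.

Section Config.
Variables (m : nat) (E : set (m.+1.-tuple pt)) (I : R).
Hypothesis mE : measurable E.
Hypothesis E_tadd : forall t v, E [tuple tadd (tnth t i) v | i < m.+1] <-> E t.
Hypothesis E2 : forall t, E t -> forall i j, edist (tnth t i) (tnth t j) <= 2.
Hypothesis EI : power_measure lam m [set y : m.-tuple pt | E [tuple of origin :: y]] = I%:E.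
Local Notation beta := (alpha * m.+1%:R).

Let I0 : 0 <= I.
Proof. by rewrite -lee_fin -EI. Qed.

Let d_beta : d%:R < beta.
Proof.
apply: lt_le_trans d_alpha _; rewrite ler_peMr ?(ltW alpha_gt0)//.
by rewrite ler1n.
Qed.

(** Translation invariance of the configurations and of Lebesgue measure. *)
Lemma section_volume x :
  power_measure lam m [set t : m.-tuple pt | E [tuple of x :: t]] = I%:E.
Proof.
rewrite -EI -(power_lebesgue_translate x); last exact: measurable_section.
congr (power_measure lam m _); apply/seteqP; split => y /=.
  move=> h; apply/(E_tadd _ x); move: h; congr E; apply: eq_from_tnth => i.
  rewrite tnth_mktuple; have [j ->|->] := unliftP ord0 i.
    by rewrite !tnthS tnth_mktuple.
  by apply: eq_from_tnth => a; rewrite !tnth_mktuple add0r.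
move=> /(E_tadd _ x); congr E; apply: eq_from_tnth => i.
rewrite tnth_mktuple; have [j ->|->] := unliftP ord0 i.
  by rewrite !tnthS tnth_mktuple.
by apply: eq_from_tnth => a; rewrite !tnth_mktuple add0r.
Qed.

Let mB r : measurable (E `&` @far R d m.+1 r).
Proof. by apply: measurableI => //; exact: measurable_far. Qed.

(** Given the first point x with |x| > r, the other points satisfy
    |y| >= |x| - 2 >= (1 - 2 / r) * |x|. *)
Lemma config_upper (r : R) : 2 < r ->
  (power_measure nu m.+1 (E `&` @far R d m.+1 r) <=
   (cp ^+ m.+1 * (1 - 2 / r) `^ (- alpha) ^+ m * I * sphere_area_real
     * r `^ (d%:R - beta) / (beta - d%:R))%:E)%E.
Proof.
move=> r2; have r0 : 0 < r by apply: lt_trans r2.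
have c0 : 0 < 1 - 2 / r by rewrite subr_gt0 ltr_pdivrMr// mul1r.
apply: power_nu_le => //.
  by rewrite !mulr_ge0 ?exprn_ge0 ?powR_ge0// ltW.
  by move=> x xr; apply/seteqP; split => // t /= [_ /(_ ord0)].
move=> x rx; have x0 : 0 < enorm x by exact: lt_trans rx.
pose b := cp * ((1 - 2 / r) * enorm x) `^ (- alpha).
have b0 : 0 <= b by rewrite mulr_ge0 ?powR_ge0// ltW.
pose W : set pt := [set y | edist y x <= 2].
have Wb y : W y -> 0 <= f y <= b.
  rewrite /W /= => yx; rewrite density_ge0 /=; apply: density_le; first by rewrite mulr_gt0.
  have := enorm_le_edist x y; rewrite edistC => xy.
  have h : 2 <= 2 / r * enorm x by rewrite mulrAC ler_pdivlMr// ler_wpM2l// ltW.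
  by rewrite mulrBl mul1r; move: h; set z := 2 / r * _; lra.
pose Bx := [set t : m.-tuple pt | (E `&` @far R d m.+1 r) [tuple of x :: t]].
have mBx : measurable Bx by exact: measurable_section.
have BW : Bx `<=` [set t | forall i, W (tnth t i)].
  move=> t [/= Et _] i; rewrite /W /=.
  by have := E2 Et (lift ord0 i) ord0; rewrite tnthS.
have [_ up] := andP (power_measure_density_bounds measurable_density density_ge0 nuE
  (lexx 0) Wb mBx BW).
have -> : cp ^+ m.+1 * (1 - 2 / r) `^ (- alpha) ^+ m * I * enorm x `^ (- beta) =
    (b ^+ m * I) * (cp * enorm x `^ (- alpha)).
  rewrite -powRN_expS /b powRM ?enorm_ge0 ?(ltW c0)// !exprMn exprS.
  by move: (cp ^+ m) (_ ^+ m) (_ ^+ m) => a a' a''; ring.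
rewrite [leRHS]EFinM; apply: lee_pmul => //.
- by rewrite lee_fin density_ge0.
- apply: (le_trans up); rewrite EFinM; apply: lee_wpmul2l.
    by rewrite lee_fin exprn_ge0.
  rewrite -(section_volume x); apply: le_measure; rewrite ?inE//.
    exact: measurable_section.
  by move=> t [].
- by rewrite lee_fin; apply: density_le.
Qed.

(** Taking the first point beyond r + 2 guarantees that the whole configuration
    lies beyond r. *)
Lemma config_lower (r : R) : 0 < r ->
  ((cp ^+ m.+1 * slack r ^+ m.+1 * I * sphere_area_real
     * (r + 2) `^ (d%:R - beta) / (beta - d%:R))%:E <=
   power_measure nu m.+1 (E `&` @far R d m.+1 r))%E.
Proof.
move=> r0; have s0 := slack_gt0 r0.
apply: power_nu_ge => //.
- by rewrite !mulr_ge0 ?exprn_ge0 ?powR_ge0// ltW.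
- by rewrite addr_gt0.
move=> x rx; have rx' : r <= enorm x by lra.
pose a := cp * slack r * enorm x `^ (- alpha).
have a0 : 0 <= a by rewrite !mulr_ge0 ?powR_ge0// ltW.
pose W : set pt := [set y | edist y x <= 2].
have Wa y : W y -> a <= f y <= cp.
  rewrite /W /= => yx; rewrite density_le_cp andbT; apply: density_ge => //.
  by have := enorm_le_edist y x; lra.
pose Bx := [set t : m.-tuple pt | (E `&` @far R d m.+1 r) [tuple of x :: t]].
have BxE : Bx = [set t : m.-tuple pt | E [tuple of x :: t]].
  apply/seteqP; split => [t []//|t /= Et]; split => // i.
  have [j ->|->] := unliftP ord0 i; last first.
    by rewrite /=; move: rx; rewrite /tnth /=; lra.
  have := E2 Et (lift ord0 j) ord0.
  set y := tnth _ (lift _ _); move=> yx.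
  have : enorm x <= enorm y + edist x y by exact: enorm_le_edist.
  by rewrite edistC; move: yx rx; rewrite (_ : tnth _ ord0 = x)//; lra.
have mBx : measurable Bx by exact: measurable_section.
have BW : Bx `<=` [set t | forall i, W (tnth t i)].
  move=> t [/= Et _] i; rewrite /W /=.
  by have := E2 Et (lift ord0 i) ord0; rewrite tnthS.
have [lo _] := andP (power_measure_density_bounds measurable_density density_ge0 nuE
  a0 Wa mBx BW).
have -> : cp ^+ m.+1 * slack r ^+ m.+1 * I * enorm x `^ (- beta) = (a ^+ m * I) * a.
  rewrite -powRN_expS /a !exprMn !exprS.
  by move: (cp ^+ m) (_ ^+ m) (_ ^+ m) => b b' b''; ring.
rewrite EFinM; apply: lee_pmul => //.
- by rewrite lee_fin mulr_ge0// exprn_ge0.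
- apply: le_trans lo; rewrite BxE section_volume EFinM; exact: lexx.
- by rewrite lee_fin; apply: density_ge => //; rewrite lerDl.
Qed.

End Config.
End PowerLawBounds.

(** * Expected numbers of configurations *)

Section ExpectedCounts.
Local Open Scope ereal_scope.
Context {disp : measure_display} {Om : measurableType disp} {R : realType}.
Context {P : probability Om R} {d : nat}.
Local Notation pt := (d.-tuple R).
Variable X : nat -> {RV P >-> pt}.
Hypothesis X_indep : mutually_independent X.
Hypothesis X_ident : forall i A, measurable A ->
  distribution P (X i) A = distribution P (X 0%N) A.
Local Notation nu := (distribution P (X 0%N)).
Local Notation pts w := (fun i => X i w).

(** Compares integrals of functions that may fail to be measurable, such as the
    Betti number of a random complex: the integral of a nonnegative function is a
    supremum over the simple functions below it. *)
Lemma ge0_le_integral_any (f g : Om -> \bar R) : (forall w, 0 <= f w) ->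
  (forall w, f w <= g w) -> \int[P]_w f w <= \int[P]_w g w.
Proof.
move=> f0 fg; rewrite !ge0_integralTE//; last by move=> w; exact: le_trans (fg w).
apply: le_ereal_sup => _ [h hf <-]; exists h => // w.
exact: le_trans (hf w) (fg w).
Qed.

Definition config_event m n (J : {set 'I_n}) (E : set (m.-tuple pt)) : set Om :=
  [set w | E (subtuple (pts w) m J)].

Let indices m n (J : {set 'I_n}) : m.-tuple nat :=
  [tuple nth 0%N [seq val j | j <- enum J] i | i < m].

Let eventE m n (J : {set 'I_n}) (E : set (m.-tuple pt)) :
  config_event J E = [set w | E [tuple X (tnth (indices m J) i) w | i < m]].
Proof.
apply/seteqP; split => w; rewrite /config_event /=; congr E;
  by apply: eq_from_tnth => i; rewrite !tnth_mktuple.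
Qed.

Lemma event_prob m n (J : {set 'I_n}) (E : set (m.-tuple pt)) : #|J| = m ->
  measurable E -> P (config_event J E) = power_measure nu m E.
Proof.
move=> Jm mE; rewrite eventE; apply: (iid_law X_indep X_ident) => //.
apply/tuple_uniqP => i j; rewrite !tnth_mktuple => /eqP.
have sz : size [seq val j | j <- enum J] = m by rewrite size_map -cardE.
rewrite nth_uniq ?sz//; last by rewrite map_inj_uniq ?enum_uniq//; exact: val_inj.
by move=> /eqP ?; exact: val_inj.
Qed.

Lemma measurable_event m n (J : {set 'I_n}) (E : set (m.-tuple pt)) :
  measurable E -> measurable (config_event J E).
Proof.
move=> mE; rewrite eventE -[X in measurable X]setTI.
exact: (@measurable_joint _ _ _ P _ _ X m (indices m J)).
Qed.

Lemma integral_sum_indic n (D : {set {set 'I_n}}) (A : {set 'I_n} -> set Om) :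
  (forall J, measurable (A J)) ->
  \int[P]_w (\sum_(J in D) \1_(A J) w)%:E = \sum_(J in D) P (A J).
Proof.
move=> mA; under eq_integral do rewrite -sumEFin.
rewrite (eq_integral (fun w => \sum_(J <- enum D) (\1_(A J) w)%:E)); last first.
  by move=> w _; rewrite big_enum.
rewrite ge0_integral_sum//.
  by rewrite big_enum /=; apply: eq_bigr => J _; rewrite integral_indic// setIT.
by move=> J; apply/measurable_EFinP; exact: measurable_indic.
Qed.

Let subsets n m : {set {set 'I_n}} := finset (fun J : {set 'I_n} => #|J| == m).

Let card_subsets n m : #|subsets n m| = 'C(n, m).
Proof. by rewrite card_draws card_ord. Qed.

Let count_sum n m (E : set (m.-tuple pt)) w :
  (count_config (pts w) n E)%:R = (\sum_(J in subsets n m) \1_(config_event J E) w)%R :> R.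
Proof.
rewrite /count_config -sum1_card natr_sum.
rewrite [RHS](bigID (fun J => `[< E (subtuple (pts w) m J) >])) /=.
rewrite [X in (_ = _ + X)%R]big1 ?addr0.
  apply: eq_big => [J|J]; first by rewrite !inE.
  by rewrite !inE => /andP[_ /asboolP h]; rewrite indicE mem_set.
move=> J /andP[_ /asboolP h]; rewrite indicE memNset//.
Qed.

Lemma expected_count n m (E : set (m.-tuple pt)) : measurable E ->
  \int[P]_w (count_config (pts w) n E)%:R%:E = ('C(n, m)%:R)%:E * power_measure nu m E.
Proof.
move=> mE; under eq_integral do rewrite count_sum.
rewrite integral_sum_indic; last by move=> J; exact: measurable_event.
rewrite (eq_bigr (fun=> power_measure nu m E)); last first.
  by move=> J; rewrite inE => /eqP Jm; exact: event_prob.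
by rewrite sumr_const card_subsets mule_natl.
Qed.

Lemma expected_upper n m m' (E : set (m.-tuple pt)) (E' : set (m'.-tuple pt))
    (b : Om -> nat) (c : nat) : measurable E -> measurable E' ->
  (forall w, (b w <= count_config (pts w) n E + c * count_config (pts w) n E')%N) ->
  \int[P]_w (b w)%:R%:E <= ('C(n, m)%:R)%:E * power_measure nu m E +
    ((c * 'C(n, m'))%:R)%:E * power_measure nu m' E'.
Proof.
move=> mE mE' bE.
apply: (@le_trans _ _ (\int[P]_w ((count_config (pts w) n E)%:R%:E +
    c%:R%:E * (count_config (pts w) n E')%:R%:E))).
  apply: ge0_le_integral_any => w; first by rewrite lee_fin ler0n.
  by rewrite -EFinM -EFinD lee_fin -natrM -natrD ler_nat.
have mc k (F : set (k.-tuple pt)) : measurable F ->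
    measurable_fun setT (fun w => (count_config (pts w) n F)%:R%:E : \bar R).
  move=> mF; apply/measurable_EFinP.
  rewrite (_ : (fun _ => _) = fun w => (\sum_(J <- enum (subsets n k)) \1_(config_event J F) w)%R); last first.
    by apply/funext => w; rewrite count_sum big_enum.
  by apply: measurable_sum => J; apply: measurable_indic; exact: measurable_event.
have mc2 := emeasurable_funM (@measurable_cst _ _ Om _ setT (c%:R%:E : \bar R)) (mc _ _ mE').
have pos2 w : setT w -> 0 <= c%:R%:E * (count_config (pts w) n E')%:R%:E :> \bar R.
  by move=> _; rewrite -EFinM lee_fin mulr_ge0.
rewrite (ge0_integralD _ measurableT _ (mc _ _ mE) pos2 mc2); last first.
  by move=> w _; rewrite lee_fin.
rewrite ge0_integralZl//; last by apply: mc.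
by rewrite !expected_count// natrM EFinM muleA.
Qed.

(** A configuration fails to be isolated only if it forms a cluster with one of
    the at most n other indices; the union bound gives the term n * q. *)
Lemma expected_lower n m (E : set (m.-tuple pt)) (r : R) (b : Om -> nat) (p q : R) :
  measurable E ->
  p%:E <= power_measure nu m (E `&` @far R d m r) ->
  power_measure nu m.+1 (@clustered R d m.+1 `&` @far R d m.+1 (r - 2)) <= q%:E ->
  (forall w, (count_isolated (pts w) n E r <= b w)%N) ->
  ('C(n, m)%:R * (p - n%:R * q))%:E <= \int[P]_w (b w)%:R%:E.
Proof.
move=> mE pE qE bE.
pose F := E `&` @far R d m r.
pose F' := @clustered R d m.+1 `&` @far R d m.+1 (r - 2).
have mF : measurable F by apply: measurableI => //; exact: measurable_far.
have mF' : measurable F'.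
  by apply: measurableI; [exact: measurable_clustered|exact: measurable_far].
pose bad (J : {set 'I_n}) : set Om := \big[setU/set0]_(i | i \notin J) config_event (i |: J)%SET F'.
pose good (J : {set 'I_n}) : set Om := config_event J F `\` bad J.
have mbad J : measurable (bad J).
  by apply: bigsetU_measurable => i _; exact: measurable_event.
have mgood J : measurable (good J).
  by apply: measurableD => //; exact: measurable_event.
have badP (J : {set 'I_n}) w : bad J w <-> exists2 i : 'I_n, i \notin J & F' (subtuple (pts w) m.+1 (i |: J)%SET).
  rewrite /bad -bigcup_seq_cond; split.
    by move=> [i /= /andP[_ iJ] h]; exists i.
  by move=> [i iJ h]; exists i => //=; rewrite mem_index_enum.
have goodP (J : {set 'I_n}) : #|J| = m -> (p - n%:R * q)%:E <= P (good J).
  move=> Jm.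
  have h1 : p%:E <= P (config_event J F) by rewrite event_prob.
  have q0 : (0 <= q)%R by rewrite -lee_fin; apply: le_trans qE.
  have h2 : P (bad J) <= (n%:R * q)%:E.
    apply: (@le_trans _ _ (\sum_(i | i \notin J) P (config_event (i |: J)%SET F'))).
      suff [] : measurable (bad J) /\ P (bad J) <= \sum_(i | i \notin J) P (config_event (i |: J)%SET F').
        by [].
      rewrite /bad; elim/big_ind2 : _ => [|x A y B [mx hx] [mA hA]|i iJ].
      - by rewrite measure0.
      - split; first exact: measurableU.
        by apply: le_trans (measureU2 _ _ _) _ => //; exact: leeD.
      - by split => //; exact: measurable_event.
    apply: (@le_trans _ _ (\sum_(i | i \notin J) q%:E)).
      apply: lee_sum => i iJ; rewrite event_prob//.
      by rewrite cardsU1 iJ Jm.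
    rewrite sumEFin lee_fin sumr_const -[leLHS]mulr_natl ler_wpM2r// ler_nat.
    by rewrite -[X in (_ <= X)%N](card_ord n) max_card.
  rewrite EFinB leeBlDr//; apply: (le_trans h1).
  apply: (@le_trans _ _ (P (good J) + P (bad J))); last exact: leeD2l.
  apply: le_trans (measureU2 _ (mgood J) (mbad J)).
  apply: le_measure; rewrite ?inE//.
  - exact: measurable_event.
  - exact: measurableU.
  - by move=> w Fw; have [b'|nb] := pselect (bad J w); [right|left; split].
apply: (@le_trans _ _ (\sum_(J in subsets n m) P (good J))).
  apply: (@le_trans _ _ (\sum_(J in subsets n m) (p - n%:R * q)%:E)).
    by rewrite sumEFin sumr_const card_subsets mulr_natl.
  by apply: lee_sum => J; rewrite inE => /eqP; exact: goodP.
rewrite -integral_sum_indic//; apply: ge0_le_integral_any => w.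
  by rewrite lee_fin sumr_ge0.
rewrite lee_fin; apply: (@le_trans _ _ (count_isolated (pts w) n E r)%:R%R).
  rewrite /count_isolated -sum1_card natr_sum [leRHS]big_mkcond [leLHS]big_mkcond /=.
  apply: ler_sum => J _; rewrite !inE; case: ifPn => // Jm; rewrite indicE /=.
  have [gw|gw] := pselect (good J w); last by rewrite memNset//; case: ifP.
  rewrite mem_set// ifT//; apply/asboolP; case: gw => Fw nb; split => // i iJ h.
  by apply: nb; apply/badP; exists i.
by rewrite ler_nat.
Qed.

End ExpectedCounts.

(** * Growth rates *)

Section SequenceLimits.
Context {R : realType}.

Lemma natr_powRN_cvg0 (c : R) : 0 < c -> n%:R `^ (- c) @[n --> \oo] --> (0 : R).
Proof. by move=> c0; exact: (cvg_comp _ _ (@cvgr_idn R) (cvg_powRN c0)). Qed.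

Lemma natr_powR_cvgy (c : R) : 0 < c -> n%:R `^ c @[n --> \oo] --> (+oo : set_system R).
Proof.
move=> c0; apply/cvgryPge => A; near=> n.
have [A0|A0] := leP A 0; first by apply: (le_trans A0); exact: powR_ge0.
have -> : A = (A `^ c^-1) `^ c by rewrite -powRrM mulVf ?lt0r_neq0// powRr1// ltW.
apply: ge0_ler_powR; rewrite ?nnegrE ?powR_ge0 ?ler0n ?(ltW c0)//.
near: n; exact: nbhs_infty_ger.
Unshelve. all: by end_near. Qed.

Lemma powR_cvg1 (x : nat -> R) (c : R) : x n @[n --> \oo] --> (1 : R) ->
  x n `^ c @[n --> \oo] --> (1 : R).
Proof.
move=> x1; have ct : {for (1 : R), continuous (fun t : R => t `^ c)}.
  apply: differentiable_continuous; apply/derivable1_diffP/derivable_powR.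
  by rewrite in_itv/= ltr01.
move: ct; rewrite /prop_for /continuous_at powR1 => ct.
exact: (cvg_comp _ _ x1 ct).
Qed.

(** The falling factorial n (n - 1) ... (n - m + 1) is equivalent to n^m. *)
Lemma binomial_ratio_cvg (m : nat) :
  ('C(n, m)%:R / n%:R ^+ m : R) @[n --> \oo] --> (m`!%:R^-1 : R).
Proof.
have inv0 : (n%:R^-1 : R) @[n --> \oo] --> (0 : R).
  rewrite (_ : (fun n => n%:R^-1) = fun n : nat => n%:R `^ (- 1) : R).
    exact: natr_powRN_cvg0.
  by apply/funext => n; rewrite powR_inv1.
have fal : ((n ^_ m)%:R / n%:R ^+ m : R) @[n --> \oo] --> (1 : R).
  elim: m => [|m ih].
    by under eq_fun do rewrite ffactn0 expr0 divr1; exact: cvg_cst.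
  rewrite -[X in _ --> X](mulr1 1).
  apply: (@cvg_trans _ (((n ^_ m)%:R / n%:R ^+ m * (1 - m%:R * n%:R^-1) : R) @[n --> \oo])).
    apply: near_eq_cvg; near=> n.
    have mn : (m < n)%N by near: n; exact: nbhs_infty_gt.
    have n0 : (n%:R : R) != 0 by rewrite pnatr_eq0 -lt0n (leq_ltn_trans _ mn).
    rewrite ffactnSr natrM natrB ?(ltnW mn)// exprSr.
    have nm0 : (n%:R : R) ^+ m != 0 by rewrite expf_neq0.
    by move: (_ ^+ m) nm0 => a a0; field; rewrite n0 a0.
  apply: cvgM => //; rewrite -[X in _ --> X](subr0 1); apply: cvgB; first exact: cvg_cst.
  by rewrite -[X in _ --> X](mulr0 m%:R); apply: cvgM => //; exact: cvg_cst.
have -> : (fun n => 'C(n, m)%:R / n%:R ^+ m : R) =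
    (fun n => (n ^_ m)%:R / n%:R ^+ m * (m`!%:R^-1)).
  apply/funext => n; rewrite -bin_ffact natrM.
  have : (m`!%:R : R) != 0 by rewrite pnatr_eq0 -lt0n fact_gt0.
  by move=> m0; rewrite [RHS]mulrAC mulfK.
rewrite -[X in _ --> X]mul1r; apply: cvgM => //; exact: cvg_cst.
Unshelve. all: by end_near. Qed.

Lemma binomial_ratio_le (n m : nat) : ('C(n, m)%:R : R) <= n%:R ^+ m / m`!%:R.
Proof.
rewrite ler_pdivlMr ?ltr0n ?fact_gt0// -natrM bin_ffact -natrX ler_nat.
elim: m => [|m ih]; first by rewrite ffactn0.
by rewrite ffactnSr expnSr leq_mul// leq_subr.
Qed.

End SequenceLimits.

Section Rates.
Context {R : realType}.
Variables (d m c : nat) (alpha rho G K : R).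
Hypotheses (alpha0 : 0 < alpha) (rho0 : 0 < rho) (rho_alpha : 1 < rho * alpha).
Hypotheses (G0 : 0 <= G) (K0 : 0 <= K).
Local Notation M := m.+1.
Local Notation beta := (alpha * M%:R).
Local Notation rad n := (n%:R `^ rho : R).
Local Notation rate n := ((n%:R : R) `^ (M%:R - rho * (beta - d%:R))).

(** What remains of the upper bound for the expectation at radius n^rho once the
    power of n is factored out. *)
Definition upper_factor (n : nat) : R :=
  G * (1 - 2 / rad n) `^ (- alpha) ^+ m / M`!%:R + c%:R * K * n%:R `^ (1 - rho * alpha).

(** The same for the lower bound. *)
Definition lower_factor (n : nat) : R :=
  'C(n, M)%:R / n%:R ^+ M *
  (G * slack alpha (rad n) ^+ M * (1 + 2 / rad n) `^ (d%:R - beta)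
   - K * n%:R `^ (1 - rho * alpha) * (1 - 2 / rad n) `^ (d%:R - beta - alpha)).

(** The powers of n collect to n^M * r^(-gamma); a cluster with one more point has
    the additional factor n * r^(-alpha) = n^(1 - rho * alpha). *)
Lemma upper_rate n : (0 < n)%N -> 2 < rad n ->
  'C(n, M)%:R * (G * (1 - 2 / rad n) `^ (- alpha) ^+ m * rad n `^ (d%:R - beta)) +
  (c * 'C(n, M.+1))%:R * (K * (rad n `^ (- alpha) ^+ M * rad n `^ (d%:R - alpha)))
  <= rate n * upper_factor n.
Proof.
move=> n0 r2; have nR : 0 < (n%:R : R) by rewrite ltr0n.
have nn0 : (n%:R : R) != 0 by rewrite lt0r_neq0.
have nD (a b : R) : n%:R `^ (a + b) = n%:R `^ a * n%:R `^ b :> R.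
  by rewrite powRD// nn0 implybT.
have e1 : n%:R ^+ M * rad n `^ (d%:R - beta) = rate n.
  by rewrite -powR_mulrn ?ler0n// -powRrM -nD; congr powR; ring.
have e2 : n%:R ^+ M.+1 * (rad n `^ (- alpha) ^+ M * rad n `^ (d%:R - alpha)) =
    rate n * n%:R `^ (1 - rho * alpha).
  rewrite -[_ ^+ M.+1]powR_mulrn ?ler0n// -[_ `^ (- alpha) ^+ M]powR_mulrn ?powR_ge0//.
  rewrite -!powRrM -!nD; congr powR; rewrite -[M.+1%:R]natr1; ring.
rewrite mulrDr; apply: lerD.
  have -> : rate n * (G * (1 - 2 / rad n) `^ (- alpha) ^+ m / M`!%:R) =
      n%:R ^+ M / M`!%:R * (G * (1 - 2 / rad n) `^ (- alpha) ^+ m * rad n `^ (d%:R - beta)).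
    by rewrite -e1; move: (_ `^ _ ^+ m) (_ `^ (d%:R - beta)) (n%:R ^+ M) => a a' a''; ring.
  rewrite ler_wpM2r ?binomial_ratio_le// !mulr_ge0 ?powR_ge0// exprn_ge0// powR_ge0//.
have -> : rate n * (c%:R * K * n%:R `^ (1 - rho * alpha)) =
    c%:R * n%:R ^+ M.+1 * (K * (rad n `^ (- alpha) ^+ M * rad n `^ (d%:R - alpha))).
  rewrite mulrCA -e2; move: (_ `^ _ ^+ M) (_ `^ (d%:R - alpha)) (n%:R ^+ M.+1) => a a' a''; ring.
rewrite natrM ler_wpM2r//.
  by rewrite !mulr_ge0 ?powR_ge0 ?exprn_ge0 ?powR_ge0.
rewrite ler_wpM2l//; apply: (le_trans (binomial_ratio_le _ _)).
by rewrite ler_pdivrMr ?ltr0n ?fact_gt0// ler_peMr ?exprn_ge0// ler1n fact_gt0.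
Qed.

Lemma lower_rate n : (0 < n)%N -> 2 < rad n ->
  'C(n, M)%:R * (G * slack alpha (rad n) ^+ M * (rad n + 2) `^ (d%:R - beta)
    - n%:R * (K * ((rad n - 2) `^ (- alpha) ^+ M * (rad n - 2) `^ (d%:R - alpha))))
  = rate n * lower_factor n.
Proof.
move=> n0 r2; have nR : 0 < (n%:R : R) by rewrite ltr0n.
have nn0 : (n%:R : R) != 0 by rewrite lt0r_neq0.
have nD (a b : R) : n%:R `^ (a + b) = n%:R `^ a * n%:R `^ b :> R.
  by rewrite powRD// nn0 implybT.
have r0 : 0 < rad n by exact: powR_gt0.
have rn0 : rad n != 0 by rewrite lt0r_neq0.
have e1 : n%:R ^+ M * rad n `^ (d%:R - beta) = rate n.
  by rewrite -powR_mulrn ?ler0n// -powRrM -nD; congr powR; ring.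
have -> : rad n + 2 = rad n * (1 + 2 / rad n) by rewrite mulrDr mulr1 mulrCA mulfV// mulr1.
have -> : rad n - 2 = rad n * (1 - 2 / rad n) by rewrite mulrBr mulr1 mulrCA mulfV// mulr1.
have h1 : 0 <= 1 + 2 / rad n by rewrite addr_ge0// divr_ge0// ltW.
have h2 : 0 < 1 - 2 / rad n by rewrite subr_gt0 ltr_pdivrMr// mul1r.
rewrite -[_ `^ (- alpha) ^+ M]powR_mulrn ?powR_ge0// -[_ `^ _ `^ M%:R]powRrM.
rewrite -powRD; last by rewrite mulf_neq0 ?implybT// lt0r_neq0.
rewrite !powRM ?powR_ge0//; last exact: ltW.
have -> : - alpha * M%:R + (d%:R - alpha) = (d%:R - beta) - alpha by ring.
have e3 : n%:R * rad n `^ (d%:R - beta - alpha) =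
    rad n `^ (d%:R - beta) * n%:R `^ (1 - rho * alpha).
  rewrite -{1}[n%:R]powRr1 ?ler0n// -!powRrM -!nD; congr powR; ring.
have nM0 : (n%:R : R) ^+ M != 0 by rewrite expf_neq0.
have -> : 'C(n, M)%:R = 'C(n, M)%:R / n%:R ^+ M * n%:R ^+ M :> R by rewrite divfK.
rewrite /lower_factor -e1; move: ('C(n, M)%:R / n%:R ^+ M) (slack _ _ ^+ M) => a a'.
have -> : n%:R * (K * (rad n `^ (d%:R - beta - alpha) * (1 - 2 / rad n) `^ (d%:R - beta - alpha)))
  = K * (rad n `^ (d%:R - beta) * n%:R `^ (1 - rho * alpha)) * (1 - 2 / rad n) `^ (d%:R - beta - alpha).
  by rewrite -e3; ring.
by move: (n%:R ^+ M) => b; ring.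
Qed.

Lemma inv_rad_cvg0 : 2 / rad n @[n --> \oo] --> (0 : R).
Proof.
rewrite -[X in _ --> X](mulr0 (2 : R)); apply: cvgM; first exact: cvg_cst.
under eq_fun do rewrite -powRN; exact: natr_powRN_cvg0.
Qed.

Let tail_cvg0 : (n%:R : R) `^ (1 - rho * alpha) @[n --> \oo] --> (0 : R).
Proof. by rewrite -opprB; apply: natr_powRN_cvg0; rewrite subr_gt0. Qed.

Let one_sub_cvg : 1 - 2 / rad n @[n --> \oo] --> (1 : R).
Proof.
rewrite -[X in _ --> X](subr0 (1 : R)); apply: cvgB; first exact: cvg_cst.
exact: inv_rad_cvg0.
Qed.

Let one_add_cvg : 1 + 2 / rad n @[n --> \oo] --> (1 : R).
Proof.
rewrite -[X in _ --> X](addr0 (1 : R)); apply: cvgD; first exact: cvg_cst.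
exact: inv_rad_cvg0.
Qed.

Let expr_cvg1 (x : nat -> R) k : x n @[n --> \oo] --> (1 : R) -> x n ^+ k @[n --> \oo] --> (1 : R).
Proof.
move=> x1; elim: k => [|k ih]; first by under eq_fun do rewrite expr0; exact: cvg_cst.
rewrite (_ : (fun n => x n ^+ k.+1) = (fun n => x n * x n ^+ k)); last first.
  by apply/funext => n; rewrite exprS.
by rewrite -[X in _ --> X](mulr1 (1 : R)); exact: cvgM.
Qed.

Lemma slack_cvg1 : slack alpha (rad n) @[n --> \oo] --> (1 : R).
Proof.
rewrite -[X in _ --> X]invr1 /slack; apply: cvgV; first exact: oner_neq0.
rewrite -[X in _ --> X](add0r (1 : R)); apply: cvgD.
  under eq_fun do rewrite -powRrM mulrN.
  by apply: natr_powRN_cvg0; rewrite mulr_gt0.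
exact: powR_cvg1.
Qed.

Lemma upper_factor_cvg : upper_factor n @[n --> \oo] --> G / M`!%:R.
Proof.
rewrite -[X in _ --> X]addr0; apply: cvgD; last first.
  rewrite -[X in _ --> X](mulr0 (c%:R * K)); apply: cvgM; [exact: cvg_cst|exact: tail_cvg0].
apply: cvgM; last exact: cvg_cst.
rewrite -[X in _ --> X]mulr1; apply: cvgM; first exact: cvg_cst.
by apply: expr_cvg1; exact: powR_cvg1.
Qed.

Lemma lower_factor_cvg : lower_factor n @[n --> \oo] --> G / M`!%:R.
Proof.
rewrite mulrC; apply: cvgM; first exact: binomial_ratio_cvg.
rewrite -[X in _ --> X]subr0; apply: cvgB.
  rewrite -[X in _ --> X]mulr1; apply: cvgM; last exact: powR_cvg1.
  rewrite -[X in _ --> X]mulr1; apply: cvgM; first exact: cvg_cst.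
  by apply: expr_cvg1; exact: slack_cvg1.
rewrite -[X in _ --> X](mul0r (1 : R)); apply: cvgM; last exact: powR_cvg1.
rewrite -[X in _ --> X](mulr0 K); apply: cvgM; [exact: cvg_cst|exact: tail_cvg0].
Qed.

Lemma near_rad : \forall n \near \oo, (0 < n)%N /\ 2 < rad n.
Proof.
near=> n; split; near: n; first exact: nbhs_infty_gt.
by have /cvgryPgt := natr_powR_cvgy rho0; apply.
Unshelve. all: by end_near. Qed.

End Rates.

(** * Limits of the expected Betti numbers *)

Section CrackleLimit.
Context {disp : measure_display} {Om : measurableType disp} {R : realType}.
Context {P : probability Om R} {d : nat}.
Local Notation pt := (d.-tuple R).
Variables (alpha cp : R) (X : nat -> {RV P >-> pt}) (rad : nat -> R).
Hypotheses (d_gt0 : (0 < d)%N) (d_alpha : d%:R < alpha) (cp0 : 0 < cp).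
Hypothesis X_indep : mutually_independent X.
Hypothesis X_dens : forall i, has_density (X i) (power_density alpha cp).
Local Notation nu := (distribution P (X 0%N)).
Local Notation pts w := (fun i => X i w).

Let X_ident i A : measurable A -> distribution P (X i) A = nu A.
Proof. by move=> mA; rewrite (X_dens i mA) (X_dens 0 mA). Qed.

Variables (m c : nat) (E : set (m.+1.-tuple pt)) (I : R) (b : nat -> Om -> nat).
Hypothesis mE : measurable E.
Hypothesis E_tadd : forall t v, E [tuple tadd (tnth t i) v | i < m.+1] <-> E t.
Hypothesis E2 : forall t, E t -> forall i j, edist (tnth t i) (tnth t j) <= 2.
Hypothesis EI : power_measure (lebesgue R d) m
  [set y : m.-tuple pt | E [tuple of origin :: y]] = I%:E.
Hypothesis b_upper : forall n w, (b n w <= count_config (pts w) n (E `&` @far R d m.+1 (rad n))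
  + c * count_config (pts w) n (@clustered R d m.+2 `&` @far R d m.+2 (rad n)))%N.
Hypothesis b_lower : forall n w r, rad n <= r ->
  (count_isolated (pts w) n E r <= b n w)%N.

Local Notation beta := (alpha * m.+1%:R).
Local Notation sphere_area_real := (@sphere_area_real R d).
(** The limiting probability that m + 1 points form a configuration beyond r,
    after multiplication by r^gamma. *)
Definition limit_const : R := cp ^+ m.+1 * I * sphere_area_real / (beta - d%:R).
Local Notation G := limit_const.
Let K : R := (cp * 12 ^+ d) ^+ m.+1 * cp * sphere_area_real / (alpha - d%:R).
Local Notation rho0 := (m.+1%:R / (beta - d%:R)).

Let area0 : 0 < sphere_area_real. Proof. exact: area_gt0. Qed.
Let I0 : 0 <= I. Proof. by rewrite -lee_fin -EI. Qed.
Let a0 : 0 < alpha. Proof. exact: (alpha_gt0 d_alpha). Qed.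
Let bd : 0 < beta - d%:R.
Proof.
rewrite subr_gt0; apply: lt_le_trans d_alpha _.
by rewrite ler_peMr ?(ltW a0)// ler1n.
Qed.
Let K0 : 0 <= K.
Proof.
rewrite divr_ge0 ?subr_ge0 ?(ltW d_alpha)// mulr_ge0 ?(ltW area0)//.
by rewrite mulr_ge0 ?exprn_ge0 ?mulr_ge0 ?exprn_ge0 ?(ltW cp0).
Qed.
Let G0 : 0 <= G.
Proof. by rewrite divr_ge0 ?(ltW bd)// !mulr_ge0 ?exprn_ge0 ?(ltW area0) ?(ltW cp0). Qed.

Lemma mean_upper rho : 0 < rho ->
  (forall n, (0 < n)%N -> rad n = n%:R `^ rho) ->
  \forall n \near \oo, (\int[P]_w (b n w)%:R%:E <=
    (n%:R `^ (m.+1%:R - rho * (beta - d%:R)) *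
     upper_factor m c alpha rho G K n)%:E)%E.
Proof.
move=> rho0 radE; near=> n.
have [n0 r2] : (0 < n)%N /\ 2 < (n%:R `^ rho : R).
  by near: n; exact: near_rad.
have r0 : 0 < (n%:R `^ rho : R) by exact: lt_trans r2.
have mEf : measurable (E `&` @far R d m.+1 (rad n)).
  by apply: measurableI => //; exact: measurable_far.
have mCf : measurable (@clustered R d m.+2 `&` @far R d m.+2 (rad n)).
  by apply: measurableI; [exact: measurable_clustered|exact: measurable_far].
apply: (le_trans (expected_upper X_indep X_ident mEf mCf (b_upper n))).
rewrite radE//.
apply: (@le_trans _ _ ('C(n, m.+1)%:R * (G * (1 - 2 / n%:R `^ rho) `^ (- alpha) ^+ m
     * (n%:R `^ rho) `^ (d%:R - beta)) + (c * 'C(n, m.+2))%:R *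
     (K * ((n%:R `^ rho) `^ (- alpha) ^+ m.+1 * (n%:R `^ rho) `^ (d%:R - alpha))))%:E); last first.
  by rewrite lee_fin; exact: upper_rate.
rewrite EFinD !EFinM; apply: leeD; apply: lee_wpmul2l; rewrite ?lee_fin//.
  apply: le_trans (config_upper d_alpha cp0 (X_dens 0) mE E_tadd E2 EI r2) _.
  by rewrite -!EFinM lee_fin /limit_const; move: (_ ^+ m) (cp ^+ m.+1) (_ `^ (d%:R - beta)) => x y z;
    rewrite le_eqVlt; apply/orP; left; apply/eqP; ring.
apply: le_trans (clustered_bound d_alpha cp0 (X_dens 0) m.+1 r0) _.
by rewrite -!EFinM.
Unshelve. all: by end_near. Qed.

Lemma mean_lower rho : 0 < rho -> (forall n, (0 < n)%N -> rad n <= n%:R `^ rho) ->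
  \forall n \near \oo, ((n%:R `^ (m.+1%:R - rho * (beta - d%:R)) *
     lower_factor d m alpha rho G K n)%:E <= \int[P]_w (b n w)%:R%:E)%E.
Proof.
move=> rho0 radE; near=> n.
have [n0 r2] : (0 < n)%N /\ 2 < (n%:R `^ rho : R).
  by near: n; exact: near_rad.
have r0 : 0 < (n%:R `^ rho : R) by exact: lt_trans r2.
have r20 : 0 < (n%:R `^ rho : R) - 2 by rewrite subr_gt0.
rewrite -lower_rate//.
apply: (expected_lower X_indep X_ident mE _ _ (fun w => b_lower w (radE n n0))).
  apply: le_trans (config_lower d_alpha cp0 (X_dens 0) mE E_tadd E2 EI r0).
  by rewrite lee_fin /limit_const; move: (slack _ _ ^+ _) (cp ^+ m.+1) (_ `^ (d%:R - beta)) => x y z;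
    rewrite le_eqVlt; apply/orP; left; apply/eqP; ring.
exact: le_trans (clustered_bound d_alpha cp0 (X_dens 0) m.+1 r20) _.
Unshelve. all: by end_near. Qed.

Let rho0_gt0 : 0 < rho0. Proof. by rewrite divr_gt0 ?ltr0n. Qed.

Let rho0_alpha : 1 < rho0 * alpha.
Proof.
rewrite mulrAC ltr_pdivlMr// mul1r mulrC gtrDl oppr_lt0 ltr0n.
exact: d_gt0.
Qed.

Let exponentE eta : m.+1%:R - (rho0 + eta) * (beta - d%:R) = - (eta * (beta - d%:R)).
Proof. by rewrite mulrDl divfK ?lt0r_neq0// opprD addrA subrr sub0r. Qed.

Lemma mean_ge0 n : (0 <= \int[P]_w (b n w)%:R%:E)%E.
Proof. by apply: integral_ge0 => w _; rewrite lee_fin. Qed.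

Lemma mean_cvg0 eps : 0 < eps ->
  (forall n, (0 < n)%N -> rad n = n%:R `^ (rho0 + eps)) ->
  (\int[P]_w (b n w)%:R%:E @[n --> \oo] --> 0)%E.
Proof.
move=> e0 radE; have rho_gt0 : 0 < rho0 + eps by rewrite addr_gt0.
have rho_alpha : 1 < (rho0 + eps) * alpha.
  by rewrite mulrDl; apply: ltr_pwDr; [exact: mulr_gt0|exact: ltW].
apply: (@squeeze_cvge _ _ _ _ (cst 0%E) _ (fun n => (n%:R `^ (m.+1%:R - (rho0 + eps) * (beta - d%:R)) *
     upper_factor m c alpha (rho0 + eps) G K n)%:E)).
- near=> n; rewrite mean_ge0 /=; near: n; exact: mean_upper.
- exact: cvg_cst.
- apply: cvg_EFin; first exact: nearW.
  rewrite -[X in _ --> X](mul0r (G / m.+1`!%:R)); apply: cvgM.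
    rewrite exponentE; apply: natr_powRN_cvg0; exact: mulr_gt0.
  exact: upper_factor_cvg.
Unshelve. all: by end_near. Qed.

Lemma mean_cvg_critical :
  (forall n, (0 < n)%N -> rad n = n%:R `^ rho0) ->
  (\int[P]_w (b n w)%:R%:E @[n --> \oo] --> (G / m.+1`!%:R)%:E)%E.
Proof.
move=> radE.
have rate1 n : n%:R `^ (m.+1%:R - rho0 * (beta - d%:R)) = 1 :> R.
  by rewrite -[rho0]addr0 exponentE mul0r oppr0 powRr0.
have up := mean_upper rho0_gt0 radE.
have radle n : (0 < n)%N -> rad n <= n%:R `^ rho0 by move=> n0; rewrite radE.
have lo := mean_lower rho0_gt0 radle.
apply: (@squeeze_cvge _ _ _ _ (fun n => (lower_factor d m alpha rho0 G K n)%:E) _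
  (fun n => (upper_factor m c alpha rho0 G K n)%:E)).
- by apply: filterS2 lo up => n; rewrite rate1 !mul1r => -> ->.
- apply: cvg_EFin; [exact: nearW|exact: lower_factor_cvg].
- apply: cvg_EFin; [exact: nearW|exact: upper_factor_cvg].
Qed.

(** The given radius may be small, even tend to 0.  Only configurations beyond the
    larger radius n^(rho0 - e) are counted, where e is at most eps and keeps
    rho0 - e above 1 / alpha, so that clusters remain negligible. *)
Lemma mean_cvg_infty eps : 0 < I -> 0 < eps ->
  (forall n, (0 < n)%N -> rad n = n%:R `^ (rho0 - eps)) ->
  (\int[P]_w (b n w)%:R%:E @[n --> \oo] --> +oo)%E.
Proof.
move=> I_gt0 e0 radE.
have G_gt0 : 0 < G by rewrite divr_gt0// !mulr_gt0// exprn_gt0.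
(* Half of the gap between the exponents 1 / alpha and rho0. *)
pose gap := (rho0 - alpha^-1) / 2.
have gap0 : 0 < gap.
  by rewrite divr_gt0// subr_gt0 -[X in X < _]mul1r ltr_pdivrMr.
pose e := Num.min eps gap.
have e_gt0 : 0 < e by rewrite lt_min e0.
have e_eps : e <= eps by rewrite ge_min lexx.
have e_gap : e <= gap by rewrite ge_min lexx orbT.
have rhoa : alpha^-1 < rho0 - e.
  have : alpha^-1 < rho0 by rewrite -[X in X < _]mul1r ltr_pdivrMr.
  by move: e_gap; rewrite /gap; move: (rho0) (alpha^-1) => x y; lra.
have rho_gt0 : 0 < rho0 - e by apply: lt_trans rhoa; rewrite invr_gt0.
have rho_alpha : 1 < (rho0 - e) * alpha by rewrite -ltr_pdivrMr// div1r.
have radle n : (0 < n)%N -> rad n <= n%:R `^ (rho0 - e).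
  by move=> n0; rewrite radE// ler_powR ?ler1n// lerB.
have lo := mean_lower rho_gt0 radle.
apply: (gee_cvgy lo); apply/cvgeryP.
have ex : m.+1%:R - (rho0 - e) * (beta - d%:R) = e * (beta - d%:R).
  by rewrite exponentE mulNr opprK.
have ge_half : \forall n \near \oo, G / m.+1`!%:R / 2 <= lower_factor d m alpha (rho0 - e) G K n.
  have Gf : 0 < G / m.+1`!%:R by rewrite divr_gt0// ltr0n fact_gt0.
  have : lower_factor d m alpha (rho0 - e) G K n @[n --> \oo] --> G / m.+1`!%:R.
    exact: lower_factor_cvg.
  by move=> /cvgr_ge; apply; rewrite ltr_pdivrMr// ltr_pMr// ltr1n.
have main : (n%:R : R) `^ (e * (beta - d%:R)) * (G / m.+1`!%:R / 2) @[n --> \oo] --> +oo.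
  have hM : 0 < G / m.+1`!%:R / 2 by rewrite divr_gt0// divr_gt0// ltr0n fact_gt0.
  have he : 0 < e * (beta - d%:R) by rewrite mulr_gt0.
  apply/cvgryPge => A; have /cvgryPge/(_ (A / (G / m.+1`!%:R / 2))) := natr_powR_cvgy he.
  by apply: filterS => n; rewrite ler_pdivrMr.
apply/cvgryPge => A; move/cvgryPge: main => /(_ A) main.
apply: filterS2 ge_half main => n hn; move/le_trans; apply.
by rewrite ex ler_wpM2l ?powR_ge0.
Qed.

End CrackleLimit.

Section Application.
Context {disp : measure_display} {Om : measurableType disp} {R : realType}.
Context {P : probability Om R} {d : nat}.
Local Notation pt := (d.-tuple R).
Variables (X : nat -> {RV P >-> pt}) (rad : nat -> R).

Lemma outer_sampleP n w x :
  x \in [fset x in sample X n w | x \in ~` eball origin (rad n)]%fset <->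
  exists2 i : 'I_n, X i w = x & rad n < enorm x.
Proof.
rewrite !inE /=; split.
  move=> /andP[/mapP[i]]; rewrite mem_iota add0n => /andP[_ i_n] -> /asboolP h.
  exists (Ordinal i_n) => //; rewrite ltNge; apply/negP => le_r.
  by apply: h; rewrite /eball /= -/(edist _ _) edist_origin.
move=> [i <- hr]; apply/andP; split.
  by apply/mapP; exists (val i) => //; rewrite mem_iota add0n ltn_ord.
by apply/asboolP; rewrite /setC /eball /= -/(edist _ _) edist_origin; apply/negP; rewrite -ltNge.
Qed.

End Application.

(** * The three regimes *)

Theorem corollary2p3 (R : realType) (d : nat) (alpha cp : R)
    (disp : measure_display) (T : measurableType disp) (P : probability T R)
    (X : nat -> {RV P >-> d.-tuple R}) (rad : nat -> R) :
  (1 <= d)%N -> d%:R < alpha -> 0 < cp ->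
  (\int[lebesgue R d]_x (power_density alpha cp x)%:E = 1)%E ->
  mutually_independent X ->
  (forall i : nat, has_density (X i) (power_density alpha cp)) ->
  (forall n : nat, (0 < n)%N -> 0 < rad n) ->
  forall (k : nat) (eps : R), (k <= d - 1)%N -> 0 < eps ->
  [/\ (forall n : nat, (0 < n)%N -> rad n = critical_radius d alpha k eps n) ->
        ('E_P[betti_crackle X rad k n] @[n --> \oo] --> 0)%E,
      (forall n : nat, (0 < n)%N -> rad n = critical_radius d alpha k 0 n) ->
        ('E_P[betti_crackle X rad k n] @[n --> \oo] --> mu_limit d alpha cp k)%E &
      (forall n : nat, (0 < n)%N ->
          rad n = critical_radius d alpha k (- eps) n) ->
        ('E_P[betti_crackle X rad k n] @[n --> \oo] --> +oo)%E].
Proof.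
move=> d_gt0 d_alpha cp0 _ X_indep X_dens _ k eps kd eps0.
pose b n w := betti (cech [fset x in sample X n w | x \in ~` eball origin (rad n)]%fset 1) k.
have EbE n : ('E_P[betti_crackle X rad k n] = \int[P]_w (b n w)%:R%:E)%E.
  by rewrite unlock.
under [X in X @ _ --> 0%E]eq_fun do rewrite EbE.
under [X in X @ _ --> mu_limit _ _ _ _]eq_fun do rewrite EbE.
under [X in X @ _ --> +oo%E]eq_fun do rewrite EbE.
have areaE : sphere_area R d = (@sphere_area_real R d)%:E by rewrite /sphere_area_real fineK// sphere_area_fin.
case: k => [|k] in kd b EbE *.
  have EI : power_measure (lebesgue R d) 0
      [set y : 0.-tuple (d.-tuple R) | [set: 1.-tuple (d.-tuple R)] [tuple of origin :: y]] = 1%:E.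
    by rewrite /= diracE mem_set.
  have b_upper n w : (b n w <= count_config (fun i => X i w) n
      ([set: 1.-tuple (d.-tuple R)] `&` @far R d 1 (rad n))
      + 0 * count_config (fun i => X i w) n (@clustered R d 2 `&` @far R d 2 (rad n)))%N.
    rewrite mul0n addn0 setTI; apply: betti0_le_count => x; exact: outer_sampleP.
  have b_lower n w r : rad n <= r ->
      (count_isolated (fun i => X i w) n [set: 1.-tuple (d.-tuple R)] r <= b n w)%N.
    by apply: betti0_ge_count => x; exact: outer_sampleP.
  have mE := @measurableT _ (1.-tuple (d.-tuple R)).
  have E_tadd (t : 1.-tuple (d.-tuple R)) v :
    [set: 1.-tuple (d.-tuple R)] [tuple tadd (tnth t i) v | i < 1] <-> [set: 1.-tuple (d.-tuple R)] t by [].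
  have E2 (t : 1.-tuple (d.-tuple R)) : [set: 1.-tuple (d.-tuple R)] t ->
      forall i j, edist (tnth t i) (tnth t j) <= 2.
    by move=> _ i j; rewrite (ord1 i) (ord1 j) edistxx.
  have radE eta n : critical_radius d alpha 0 eta n =
      n%:R `^ (1%:R / (alpha * 1%:R - d%:R) + eta) by rewrite mulr1 div1r.
  split=> hrad.
  - apply: (mean_cvg0 d_gt0 d_alpha cp0 X_indep X_dens mE E_tadd E2 EI b_upper eps0).
    by move=> n n0; rewrite hrad.
  - have -> : mu_limit d alpha cp 0 = (limit_const alpha cp (d := d) 0 1 / 1`!%:R)%:E.
      rewrite /mu_limit /= areaE /limit_const -EFinM !mulr1 divr1 expr1.
      by congr EFin; ring.
    apply: (mean_cvg_critical d_gt0 d_alpha cp0 X_indep X_dens mE E_tadd E2 EI b_upper b_lower).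
    by move=> n n0; rewrite hrad// radE addr0.
  - apply: (mean_cvg_infty d_gt0 d_alpha cp0 X_indep X_dens mE E_tadd E2 EI b_lower ltr01 eps0).
    by move=> n n0; rewrite hrad// radE.
have kd2 : (k.+2 <= d)%N by rewrite -(subnK d_gt0) addn1.
pose S := [set y : k.+2.-tuple (d.-tuple R) | @hollow_config R d k.+3 [tuple of origin :: y]].
pose I := fine (power_measure (lebesgue R d) k.+2 S).
have Sfin : power_measure (lebesgue R d) k.+2 S \is a fin_num.
  by rewrite ge0_fin_numE//; exact: hollow_volume_fin.
have EI : power_measure (lebesgue R d) k.+2 S = I%:E by rewrite /I fineK.
have I_gt0 : 0 < I by rewrite -lte_fin -EI; exact: hollow_volume_gt0.
have mE := @measurable_hollow_config R d k.+3.
have b_upper n w : (b n w <= count_config (fun i => X i w) n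
    (@hollow_config R d k.+3 `&` @far R d k.+3 (rad n))
    + 2 ^ k.+4 * count_config (fun i => X i w) n (@clustered R d k.+4 `&` @far R d k.+4 (rad n)))%N.
  by apply: betti_le_count => x; exact: outer_sampleP.
have b_lower n w r : rad n <= r ->
    (count_isolated (fun i => X i w) n (@hollow_config R d k.+3) r <= b n w)%N.
  by apply: betti_ge_count => x; exact: outer_sampleP.
have E_tadd := @hollow_config_tadd R d k.+3.
have E2 (t : k.+3.-tuple (d.-tuple R)) := @hollow_config_le2 R d k.+3 t isT.
have radE eta n : critical_radius d alpha k.+1 eta n =
    n%:R `^ (k.+3%:R / (alpha * k.+3%:R - d%:R) + eta).
  have gen (K : R) : K != 0 -> K / (alpha * K - d%:R) = (alpha - d%:R / K)^-1.
    by move=> K0; rewrite -invf_div mulrBl mulfK.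
  by rewrite gen ?pnatr_eq0.
split=> hrad.
- apply: (mean_cvg0 d_gt0 d_alpha cp0 X_indep X_dens mE E_tadd E2 EI b_upper eps0).
  by move=> n n0; rewrite hrad// radE.
- have -> : mu_limit d alpha cp k.+1 = (limit_const alpha cp (d := d) k.+2 I / k.+3`!%:R)%:E.
    rewrite /mu_limit [k.+1 == 0%N]/= areaE.
    have -> : (\int[power_measure (lebesgue R d) k.+2]_y (Tk0 y)%:E = I%:E)%E.
      rewrite -EI -[S]setIT -integral_indic//; last exact: measurable_section.
      by apply: eq_integral => y _; rewrite Tk0_hollow.
    rewrite /limit_const -!EFinM invfM; congr EFin; ring.
  apply: (mean_cvg_critical d_gt0 d_alpha cp0 X_indep X_dens mE E_tadd E2 EI b_upper b_lower).
  by move=> n n0; rewrite hrad// radE addr0.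
- apply: (mean_cvg_infty d_gt0 d_alpha cp0 X_indep X_dens mE E_tadd E2 EI b_lower I_gt0 eps0).
  by move=> n n0; rewrite hrad// radE.
Qed.
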